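(* The operad $\mathcal{Q}uad=\mathcal{D}end\,\blacksquare\,\mathcal{D}end$ is Koszul over $\mathbb{Z}$.
   Context: Work over the ring $\mathbb{Z}$. A non-symmetric operad $\{\mathcal{P}'_n\}_{n\ge1}$ is an operad without symmetric group actions; $\Sigma$ associates to it the operad $\mathcal{P}(n)=\mathcal{P}'_n\otimes\mathbb{Z}[\mathbb{S}_n]$ (a regular operad). A binary quadratic regular operad is $\Sigma(\mathcal{F}(V')/(R'))$, with $V'$ a finitely generated free module in arity $2$, $\mathcal{F}(V')$ the free non-symmetric operad, and $R'\subset\mathcal{F}(V')(3)$, where $\mathcal{F}(V')(3)$ is spanned by $\mu\circ_1\nu=\mu(\nu(x,y),z)$ and $\mu\circ_2\nu=\mu(x,\nu(y,z))$. Black square product: for $\mathcal{P}=\Sigma(\mathcal{F}(V')/(R'))$, $\mathcal{Q}=\Sigma(\mathcal{F}(W')/(S'))$, $\mathcal{P}\,\blacksquare\,\mathcal{Q}=\Sigma(\mathcal{F}(V'\otimes W')/(\Psi(R'\otimes S')))$ with $\Psi((\mu\circ_i\nu)\otimes(\mu'\circ_j\nu'))=\delta_{ij}(-1)^{i-1}(\mu\otimes\mu')\circ_i(\nu\otimes\nu')$. $\mathcal{D}end$ is the regular operad of dendriform algebras: operations $\prec,\succ$ with $(x\prec y)\prec z=x\prec(y\prec z)+x\prec(y\succ z)$, $(x\succ y)\prec z=x\succ(y\prec z)$, $(x\prec y)\succ z+(x\succ y)\succ z=x\succ(y\succ z)$. $\mathcal{Q}uad$ is the operad of quadri-algebras of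 Aguiar and Loday. A quadratic operad $\mathcal{P}$ is Koszul if the homology of its bar construction $\mathcal{B}(\mathcal{P})=\mathcal{F}^c(s\overline{\mathcal{P}})$ (cofree connected cooperad on the suspension of the augmentation ideal, differential induced by partial compositions) is concentrated in top dimension: in weight $\omega$ (number of generating operations) the homology is concentrated in degree $\omega$ (number of vertices). *)

(* Defs.v *)
From HB Require Import structures.
From mathcomp Require Import all_boot all_order fingroup perm all_algebra.
From mathcomp Require Import zify boolp classical_sets freeg.

Set Implicit Arguments.
Unset Strict Implicit.
Unset Printing Implicit Defensive.

Import GRing.Theory.
Local Open Scope ring_scope.

(* The subgroup generated by A. *)
Inductive zspan (M : zmodType) (A : set M) : set M :=
| zspan_gen x of A x : zspan A x
| zspan0 : zspan A 0
| zspanB x y of zspan A x & zspan A y : zspan A (x - y).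

Section FreeLinear.
Variables (K : choiceType) (M : zmodType).

Definition fglin (f : K -> M) (c : {freeg K}) : M :=
  fglift (fun x => f x : zmodule M) c.

Lemma fglinU f x : fglin f << x >> = f x.
Proof. by rewrite /fglin liftU scale1r. Qed.

Lemma fglinB f c c' : fglin f (c - c') = fglin f c - fglin f c'.
Proof. exact: (@lift_is_additive int K (zmodule M)). Qed.

Lemma fglin0 f : fglin f 0 = 0.
Proof. by rewrite -[0 in LHS](subrr 0) fglinB subrr. Qed.

Lemma fglinD f c c' : fglin f (c + c') = fglin f c + fglin f c'.
Proof. by rewrite -[c' in LHS]opprK fglinB -[- c']sub0r fglinB fglin0 sub0r opprK. Qed.

Lemma freeg_indB (P : {freeg K} -> Prop) :
  P 0 -> (forall c c', P c -> P c' -> P (c - c')) -> (forall x, P << x >>) ->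
  forall c, P c.
Proof.
move=> P0 PB PU c.
have PD a b : P a -> P b -> P (a + b).
  by move=> Pa Pb; rewrite -[b]opprK; apply: (PB) => //; rewrite -sub0r; apply: (PB).
rewrite -[c]freeg_sumE; apply: big_ind => // x _.
rewrite -[coeff x c]intz -freegU_mulz; move: (coeff x c) => z.
have Pn n : P (<< x >> *+ n) by elim: n => [|n IH]; rewrite ?mulr0n ?mulrS //; apply: PD.
case: z => n; first by rewrite -pmulrn.
by rewrite NegzE mulrNz -pmulrn -sub0r; apply: (PB).
Qed.

Lemma fglin_eq f g : f =1 g -> fglin f =1 fglin g.
Proof. by move=> /funext ->. Qed.

Lemma fglin_addf f g c : fglin (fun x => f x + g x) c = fglin f c + fglin g c.
Proof.
elim/freeg_indB: c => [|c c' IH IH'|x]; rewrite ?fglin0 ?addr0 ?fglinU //.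
by rewrite !fglinB IH IH' opprD addrACA.
Qed.

End FreeLinear.

(* [ns_comp k i a b] is the partial composite of b into the input i of a, where
   inputs are numbered from 0 (so it is written a \circ_(i+1) b on paper).  The
   target arity k is a parameter in order to avoid casts; the operation is
   meaningful, and specified by the axioms, only if k + 1 = m + n and i < m. *)
Record ns_operad := NsOperad {
  ns_car :> nat -> zmodType;
  ns_id : ns_car 1%N;
  ns_comp : forall k m n : nat, nat -> ns_car m -> ns_car n -> ns_car k;
  ns_compDl : forall k m n i (a a' : ns_car m) (b : ns_car n),
    k.+1 = (m + n)%N -> (i < m)%N ->
    ns_comp k i (a + a') b = ns_comp k i a b + ns_comp k i a' b;
  ns_compDr : forall k m n i (a : ns_car m) (b b' : ns_car n),
    k.+1 = (m + n)%N -> (i < m)%N ->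
    ns_comp k i a (b + b') = ns_comp k i a b + ns_comp k i a b';
  ns_assoc_seq : forall k p q m n l i j
      (a : ns_car m) (b : ns_car n) (c : ns_car l),
    p.+1 = (m + n)%N -> q.+1 = (n + l)%N -> k.+1 = (p + l)%N ->
    (i < m)%N -> (j < n)%N ->
    ns_comp k (i + j) (ns_comp p i a b) c = ns_comp k i a (ns_comp q j b c);
  ns_assoc_par : forall k p q m n l i j
      (a : ns_car m) (b : ns_car n) (c : ns_car l),
    p.+1 = (m + n)%N -> q.+1 = (m + l)%N -> k.+1 = (p + l)%N ->
    (i < j < m)%N ->
    ns_comp k (j + n).-1 (ns_comp p i a b) c = ns_comp k i (ns_comp q j a c) b;
  ns_id_l : forall n (b : ns_car n), ns_comp n 0%N ns_id b = b;
  ns_id_r : forall m i (a : ns_car m), (i < m)%N -> ns_comp m i a ns_id = a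
}.
Arguments ns_comp {n0} k {m n} _ _ _ : rename.

Section NsTheory.
Variables (P : ns_operad) (k m n i : nat).
Hypotheses (kmn : k.+1 = (m + n)%N) (im : (i < m)%N).
Implicit Types (a : P m) (b : P n).

Lemma ns_comp0l b : ns_comp k i (0 : P m) b = 0.
Proof. by apply: (addrI (ns_comp k i (0 : P m) b)); rewrite -ns_compDl // !addr0. Qed.

Lemma ns_comp0r a : ns_comp k i a (0 : P n) = 0.
Proof. by apply: (addrI (ns_comp k i a (0 : P n))); rewrite -ns_compDr // !addr0. Qed.

Lemma ns_compBl a a' b :
  ns_comp k i (a - a') b = ns_comp k i a b - ns_comp k i a' b.
Proof. by apply: (addIr (ns_comp k i a' b)); rewrite -ns_compDl // !subrK. Qed.

Lemma ns_compBr a b b' :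
  ns_comp k i a (b - b') = ns_comp k i a b - ns_comp k i a b'.
Proof. by apply: (addIr (ns_comp k i a b')); rewrite -ns_compDr // !subrK. Qed.

End NsTheory.

(* Planar binary trees with vertices labelled in X.  Those with n leaves form a
   basis of the arity n part of the free non-symmetric operad on the free module
   with basis X placed in arity 2. *)
Inductive ptree (X : Type) := PLeaf | PNode of X & ptree X & ptree X.
Arguments PLeaf {X}.
HB.instance Definition _ (X : Type) := gen_eqMixin (ptree X).
HB.instance Definition _ (X : Type) := gen_choiceMixin (ptree X).

Section FreeNsOperad.
Variable X : Type.
Implicit Types t s u : ptree X.

Fixpoint nleaves t : nat :=
  if t is PNode _ l r then (nleaves l + nleaves r)%N else 1%N.

Fixpoint graft (i : nat) t s : ptree X :=
  if t is PNode x l r then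
    if (i < nleaves l)%N then PNode x (graft i l s) r
    else PNode x l (graft (i - nleaves l) r s)
  else s.

Lemma nleaves_gt0 t : (0 < nleaves t)%N.
Proof. by elim: t => //= x l IHl r IHr; rewrite addn_gt0 IHl. Qed.

Lemma nleaves_graft i t s : (i < nleaves t)%N ->
  (nleaves (graft i t s)).+1 = (nleaves t + nleaves s)%N.
Proof.
elim: t i => [|x l IHl r IHr] i /=; first by rewrite add1n.
case: (ltnP i (nleaves l)) => il ilr /=; first by have := IHl i il; lia.
by have := IHr (i - nleaves l)%N; lia.
Qed.

Lemma graft_seq i j t s u : (i < nleaves t)%N -> (j < nleaves s)%N ->
  graft (i + j) (graft i t s) u = graft i t (graft j s u).
Proof.
move=> + js; elim: t i => [|x l IHl r IHr] i /=.
  by rewrite ltnS leqn0 => /eqP ->.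
case: (ltnP i (nleaves l)) => il ilr /=.
  have := nleaves_graft s il => E.
  have -> : (i + j < nleaves (graft i l s))%N by lia.
  by rewrite IHl.
have -> : (i + j < nleaves l)%N = false by lia.
by rewrite addnC -addnBA // addnC IHr //; lia.
Qed.

Lemma graft_par i j t s u : (i < j < nleaves t)%N ->
  graft (j + nleaves s).-1 (graft i t s) u = graft i (graft j t u) s.
Proof.
have s0 := nleaves_gt0 s.
elim: t i j => [|x l IHl r IHr] i j /=; first by lia.
move=> ij; case: (ltnP j) => jl /=.
  have il : (i < nleaves l)%N by lia.
  have E := nleaves_graft s il; have E' := nleaves_graft u jl.
  have u0 := nleaves_gt0 u.
  rewrite il /=.
  have -> : (i < nleaves (graft j l u))%N by lia.
  have -> : ((j + nleaves s).-1 < nleaves (graft i l s))%N by lia.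
  by rewrite IHl //; lia.
case: (ltnP i (nleaves l)) => il /=.
  have E := nleaves_graft s il.
  have -> : ((j + nleaves s).-1 < nleaves (graft i l s))%N = false by lia.
  by congr (PNode _ _ (graft _ _ _)); lia.
have -> : ((j + nleaves s).-1 < nleaves l)%N = false by lia.
by rewrite -IHr; first congr (PNode _ _ (graft _ _ _)); lia.
Qed.

Lemma graft_leaf i t : (i < nleaves t)%N -> graft i t PLeaf = t.
Proof.
elim: t i => //= x l IHl r IHr i.
by case: (ltnP i (nleaves l)) => il ilr; rewrite ?IHl ?IHr //; lia.
Qed.

Definition ptree_of (n : nat) := {t : ptree X | nleaves t == n}.

Definition fr_car n : zmodType := {freeg (ptree_of n)}.

(* The basis element t; by convention 0 if t does not have n leaves. *)
Definition tree_elt (n : nat) t : fr_car n :=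
  if insub t is Some u then << u >> else 0.

Lemma tree_eltE n t (tn : nleaves t == n) :
  tree_elt n t = << (exist _ t tn : ptree_of n) >>.
Proof. by rewrite /tree_elt insubT. Qed.

Definition fr_comp (k m n i : nat) (a : fr_car m) (b : fr_car n) : fr_car k :=
  fglin (fun t : ptree_of m =>
    fglin (fun s : ptree_of n => tree_elt k (graft i (val t) (val s))) b) a.

Lemma fr_compBl k m n i (a a' : fr_car m) (b : fr_car n) :
  fr_comp k i (a - a') b = fr_comp k i a b - fr_comp k i a' b.
Proof. exact: fglinB. Qed.

Lemma fr_compDl k m n i (a a' : fr_car m) (b : fr_car n) :
  fr_comp k i (a + a') b = fr_comp k i a b + fr_comp k i a' b.
Proof. exact: fglinD. Qed.

Lemma fr_compDr k m n i (a : fr_car m) (b b' : fr_car n) :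
  fr_comp k i a (b + b') = fr_comp k i a b + fr_comp k i a b'.
Proof. by rewrite -fglin_addf; apply: fglin_eq => t; apply: fglinD. Qed.

Lemma fr_comp0l k m n i (b : fr_car n) : fr_comp k i (0 : fr_car m) b = 0.
Proof. exact: fglin0. Qed.

Lemma fr_comp0r k m n i (a : fr_car m) : fr_comp k i a (0 : fr_car n) = 0.
Proof.
by apply: (addrI (fr_comp k i a (0 : fr_car n))); rewrite -fr_compDr !addr0.
Qed.

Lemma fr_compBr k m n i (a : fr_car m) (b b' : fr_car n) :
  fr_comp k i a (b - b') = fr_comp k i a b - fr_comp k i a b'.
Proof. by apply: (addIr (fr_comp k i a b')); rewrite -fr_compDr !subrK. Qed.

Lemma fr_ind n (P : fr_car n -> Prop) :
  P 0 -> (forall c c', P c -> P c' -> P (c - c')) ->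
  (forall t, nleaves t = n -> P (tree_elt n t)) -> forall c, P c.
Proof.
move=> P0 PB PU; apply: freeg_indB => // -[u un].
by have := PU u (eqP un); rewrite (tree_eltE un).
Qed.

Lemma fr_compU k m n i t s : nleaves t = m -> nleaves s = n ->
  fr_comp k i (tree_elt m t) (tree_elt n s) = tree_elt k (graft i t s).
Proof.
move=> /eqP tm /eqP sn.
by rewrite /fr_comp (tree_eltE tm) (tree_eltE sn) [LHS]fglinU [LHS]fglinU.
Qed.

Lemma fr_assoc_seq k p q m n l i j (a : fr_car m) (b : fr_car n) (c : fr_car l) :
  p.+1 = (m + n)%N -> q.+1 = (n + l)%N -> k.+1 = (p + l)%N ->
  (i < m)%N -> (j < n)%N ->
  fr_comp k (i + j) (fr_comp p i a b) c = fr_comp k i a (fr_comp q j b c).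
Proof.
move=> hp hq hk im jn.
elim/fr_ind: a => [|a a' IH IH'|t tm]; rewrite ?fr_comp0l // ?fr_compBl ?IH ?IH' //.
elim/fr_ind: b => [|b b' IH IH'|s sn];
  rewrite ?(fr_comp0l, fr_comp0r) // ?(fr_compBl, fr_compBr) ?IH ?IH' //.
elim/fr_ind: c => [|c c' IH IH'|u ul];
  rewrite ?(fr_comp0l, fr_comp0r) // ?(fr_compBl, fr_compBr) ?IH ?IH' //.
have := @nleaves_graft i t s; have := @nleaves_graft j s u => E1 E2.
by rewrite !fr_compU ?graft_seq //; lia.
Qed.

Lemma fr_assoc_par k p q m n l i j (a : fr_car m) (b : fr_car n) (c : fr_car l) :
  p.+1 = (m + n)%N -> q.+1 = (m + l)%N -> k.+1 = (p + l)%N ->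
  (i < j < m)%N ->
  fr_comp k (j + n).-1 (fr_comp p i a b) c = fr_comp k i (fr_comp q j a c) b.
Proof.
move=> hp hq hk ijm.
elim/fr_ind: a => [|a a' IH IH'|t tm]; rewrite ?fr_comp0l // ?fr_compBl ?IH ?IH' //.
elim/fr_ind: b => [|b b' IH IH'|s sn];
  rewrite ?(fr_comp0l, fr_comp0r) // ?(fr_compBl, fr_compBr) ?IH ?IH' //.
elim/fr_ind: c => [|c c' IH IH'|u ul];
  rewrite ?(fr_comp0l, fr_comp0r) // ?(fr_compBl, fr_compBr) ?IH ?IH' //.
have := @nleaves_graft i t s; have := @nleaves_graft j t u => E1 E2.
by rewrite !fr_compU -?sn ?graft_par //; lia.
Qed.

Lemma fr_id_l n (b : fr_car n) : fr_comp n 0 (tree_elt 1 PLeaf) b = b.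
Proof.
elim/fr_ind: b => [|b b' IH IH'|s sn]; first exact: fr_comp0r.
  by rewrite fr_compBr IH IH'.
by rewrite fr_compU.
Qed.

Lemma fr_id_r m i (a : fr_car m) : (i < m)%N ->
  fr_comp m i a (tree_elt 1 PLeaf) = a.
Proof.
move=> im; elim/fr_ind: a => [|a a' IH IH'|t tm]; first exact: fr_comp0l.
  by rewrite fr_compBl IH IH'.
by rewrite fr_compU ?graft_leaf ?tm.
Qed.

Definition free_ns_operad : ns_operad :=
  NsOperad (fun k m n i a a' b _ _ => @fr_compDl k m n i a a' b)
    (fun k m n i a b b' _ _ => @fr_compDr k m n i a b b')
    fr_assoc_seq fr_assoc_par fr_id_l fr_id_r.

End FreeNsOperad.

Section QuotientNsOperad.
Variables (P : ns_operad) (R : set (P 3%N)).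

(* The operadic ideal generated by R. *)
Inductive ns_ideal : forall n, set (P n) :=
| ns_ideal_gen r of R r : ns_ideal r
| ns_ideal0 n : ns_ideal (0 : P n)
| ns_idealB n (x y : P n) of ns_ideal x & ns_ideal y : ns_ideal (x - y)
| ns_ideal_compl k m n i (a : P m) (b : P n)
    of k.+1 = (m + n)%N & (i < m)%N & ns_ideal a : ns_ideal (ns_comp k i a b)
| ns_ideal_compr k m n i (a : P m) (b : P n)
    of k.+1 = (m + n)%N & (i < m)%N & ns_ideal b : ns_ideal (ns_comp k i a b).

Definition ns_ideal_pred n : {pred P n} := fun x => `[< ns_ideal x >].

Lemma ns_ideal_zmod_closed n : zmod_closed (@ns_ideal_pred n).
Proof.
split=> [|x y /asboolP hx /asboolP hy]; apply/asboolP; first exact: ns_ideal0.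
exact: ns_idealB.
Qed.
HB.instance Definition _ n :=
  GRing.isZmodClosed.Build (P n) (@ns_ideal_pred n) (@ns_ideal_zmod_closed n).


Definition quo_car n : zmodType := Quotient.quot (@ns_ideal_pred n).

Definition quo_pi n (a : P n) : quo_car n := \pi_(quo_car n)%qT a.

Definition quo_comp (k m n i : nat) (a : quo_car m) (b : quo_car n) : quo_car k :=
  quo_pi (ns_comp k i (generic_quotient.repr a) (generic_quotient.repr b)).

Lemma quo_piP n (a b : P n) : quo_pi a = quo_pi b <-> ns_ideal (a - b).
Proof.
have E : (a - b \in @ns_ideal_pred n) = (quo_pi a == quo_pi b).
  exact: Quotient.idealrBE.
split=> [/eqP|h]; first by rewrite -E => /asboolP.
by apply/eqP; rewrite -E; apply/asboolP.
Qed.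

Lemma quo_piK n (a : quo_car n) : quo_pi (generic_quotient.repr a) = a.
Proof. exact: reprK. Qed.

Lemma quo_piD n (a b : P n) : quo_pi (a + b) = quo_pi a + quo_pi b.
Proof. exact: (Quotient.pi_add (@ns_ideal_pred n)). Qed.

Lemma quo_ind n (Q : quo_car n -> Prop) :
  (forall a, Q (quo_pi a)) -> forall a, Q a.
Proof. by move=> h a; rewrite -(quo_piK a). Qed.

Lemma quo_compE k m n i (a : P m) (b : P n) : k.+1 = (m + n)%N -> (i < m)%N ->
  quo_comp k i (quo_pi a) (quo_pi b) = quo_pi (ns_comp k i a b).
Proof.
move=> kmn im; apply/quo_piP.
set a' := generic_quotient.repr _; set b' := generic_quotient.repr _.
have ha : ns_ideal (a' - a) by apply/quo_piP; rewrite quo_piK.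
have hb : ns_ideal (b' - b) by apply/quo_piP; rewrite quo_piK.
have -> : ns_comp k i a' b' - ns_comp k i a b =
    ns_comp k i (a' - a) b' - (0 - ns_comp k i a (b' - b)).
  by rewrite sub0r opprK ns_compBl // ns_compBr // addrA subrK.
apply: ns_idealB; first exact: ns_ideal_compl.
by apply: ns_idealB; [exact: ns_ideal0 | exact: ns_ideal_compr].
Qed.

Lemma quo_compDl k m n i (a a' : quo_car m) (b : quo_car n) :
  k.+1 = (m + n)%N -> (i < m)%N ->
  quo_comp k i (a + a') b = quo_comp k i a b + quo_comp k i a' b.
Proof.
move=> kmn im; elim/quo_ind: a => a; elim/quo_ind: a' => a'; elim/quo_ind: b => b.
by rewrite -quo_piD !quo_compE // ns_compDl // quo_piD.
Qed.

Lemma quo_compDr k m n i (a : quo_car m) (b b' : quo_car n) :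
  k.+1 = (m + n)%N -> (i < m)%N ->
  quo_comp k i a (b + b') = quo_comp k i a b + quo_comp k i a b'.
Proof.
move=> kmn im; elim/quo_ind: a => a; elim/quo_ind: b => b; elim/quo_ind: b' => b'.
by rewrite -quo_piD !quo_compE // ns_compDr // quo_piD.
Qed.

Lemma quo_assoc_seq k p q m n l i j (a : quo_car m) (b : quo_car n) (c : quo_car l) :
  p.+1 = (m + n)%N -> q.+1 = (n + l)%N -> k.+1 = (p + l)%N ->
  (i < m)%N -> (j < n)%N ->
  quo_comp k (i + j) (quo_comp p i a b) c = quo_comp k i a (quo_comp q j b c).
Proof.
move=> hp hq hk im jn.
elim/quo_ind: a => a; elim/quo_ind: b => b; elim/quo_ind: c => c.
by rewrite !quo_compE ?(@ns_assoc_seq P k p q) //; lia.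
Qed.

Lemma quo_assoc_par k p q m n l i j (a : quo_car m) (b : quo_car n) (c : quo_car l) :
  p.+1 = (m + n)%N -> q.+1 = (m + l)%N -> k.+1 = (p + l)%N ->
  (i < j < m)%N ->
  quo_comp k (j + n).-1 (quo_comp p i a b) c = quo_comp k i (quo_comp q j a c) b.
Proof.
move=> hp hq hk ijm.
elim/quo_ind: a => a; elim/quo_ind: b => b; elim/quo_ind: c => c.
by rewrite !quo_compE ?(@ns_assoc_par P k p q) //; lia.
Qed.

Lemma quo_id_l n (b : quo_car n) : quo_comp n 0 (quo_pi (ns_id P)) b = b.
Proof. by elim/quo_ind: b => b; rewrite quo_compE // ns_id_l. Qed.

Lemma quo_id_r m i (a : quo_car m) : (i < m)%N ->
  quo_comp m i a (quo_pi (ns_id P)) = a.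
Proof. by move=> im; elim/quo_ind: a => a; rewrite quo_compE ?addn1 // ns_id_r. Qed.

Definition quo_ns_operad : ns_operad :=
  NsOperad quo_compDl quo_compDr quo_assoc_seq quo_assoc_par quo_id_l quo_id_r.

End QuotientNsOperad.

Section Words.

(* The permutation s of {0, ..., n-1} as the word (s 0, ..., s (n-1)). *)
Definition word n (s : 'S_n) : seq nat := [seq val (s j) | j <- enum 'I_n].

(* Substitution of the word t, on the letters 0, ..., size t - 1, for the letter
   i of s: the block t is shifted by i and the letters of s beyond i are shifted
   by size t - 1.  It describes the order of the inputs of a partial composite. *)
Definition subst_word (i : nat) (s t : seq nat) : seq nat :=
  flatten [seq if j == i then [seq (i + l)%N | l <- t]
               else [:: if (j < i)%N then j else (j + size t).-1] | j <- s].

Definition perm_of_word n (w : seq nat) : 'S_n :=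
  odflt 1%g [pick s | word s == w].

Definition perm_comp k m n i (s : 'S_m) (t : 'S_n) : 'S_k :=
  perm_of_word k (subst_word i (word s) (word t)).

Lemma size_word n (s : 'S_n) : size (word s) = n.
Proof. by rewrite size_map size_enum_ord. Qed.

Lemma word_inj n : injective (@word n).
Proof.
move=> s t /eq_in_map E; apply/permP => j; apply: val_inj.
by apply: E; rewrite mem_enum.
Qed.

Lemma perm_word n (s : 'S_n) : perm_eq (word s) (iota 0 n).
Proof.
rewrite -val_enum_ord /word (map_comp val s); apply: perm_map.
apply: uniq_perm; rewrite ?enum_uniq //.
  by rewrite map_inj_uniq ?enum_uniq //; exact: perm_inj.
move=> j; rewrite mem_enum; apply/mapP; exists ((s^-1)%g j); rewrite ?mem_enum //.
by rewrite permKV.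
Qed.

Lemma word1 n : word (1%g : 'S_n) = iota 0 n.
Proof. by rewrite -val_enum_ord; apply: eq_map => j; rewrite perm1. Qed.

Lemma uniq_word n (s : 'S_n) : uniq (word s).
Proof. by rewrite (perm_uniq (perm_word s)) iota_uniq. Qed.

Lemma mem_word n (s : 'S_n) i : (i \in word s) = (i < n)%N.
Proof. by rewrite (perm_mem (perm_word s)) mem_iota. Qed.

Lemma index_word n (s : 'S_n) i : (i < n)%N -> (index i (word s) < n)%N.
Proof. by move=> h; rewrite -{2}(size_word s) index_mem mem_word. Qed.

Lemma perm_of_wordK n w : perm_eq w (iota 0 n) -> word (perm_of_word n w) = w.
Proof.
move=> h; rewrite /perm_of_word; case: pickP => [s /eqP //|/= no].
have sw : size w == n by rewrite (perm_size h) size_iota.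
have : perm_eq (Tuple sw) (map_tuple val (ord_tuple n)).
  by rewrite /= val_enum_ord.
case/tuple_permP => s /= E; have := no s; rewrite E; case/eqP.
rewrite /word; apply: eq_map => j.
by rewrite tnth_map tnth_ord_tuple.
Qed.

Lemma subst_word_perml i s s' t : perm_eq s s' ->
  perm_eq (subst_word i s t) (subst_word i s' t).
Proof. by move=> h; apply: perm_flatten; apply: perm_map. Qed.

Lemma subst_word_cat i s s' t :
  subst_word i (s ++ s') t = subst_word i s t ++ subst_word i s' t.
Proof. by rewrite /subst_word map_cat flatten_cat. Qed.

Lemma subst_word_notin i (s t : seq nat) : i \notin s ->
  subst_word i s t = [seq if (j < i)%N then j else (j + size t).-1 | j <- s].
Proof.
elim: s => //= x s IH; rewrite inE negb_or eq_sym => /andP[/negbTE xi /IH].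
by rewrite /subst_word /= xi => ->.
Qed.

Lemma subst_word_in i (s s' t : seq nat) : i \notin s -> i \notin s' ->
  subst_word i (s ++ i :: s') t =
  [seq if (j < i)%N then j else (j + size t).-1 | j <- s] ++
  [seq (i + l)%N | l <- t] ++
  [seq if (j < i)%N then j else (j + size t).-1 | j <- s'].
Proof.
move=> h h'; rewrite subst_word_cat subst_word_notin //.
have -> : subst_word i (i :: s') t = [seq (i + l)%N | l <- t] ++ subst_word i s' t.
  by rewrite /subst_word /= eqxx.
by rewrite subst_word_notin.
Qed.

Lemma perm_subst_word k m n i s t : k.+1 = (m + n)%N -> (i < m)%N ->
  perm_eq s (iota 0 m) -> perm_eq t (iota 0 n) ->
  perm_eq (subst_word i s t) (iota 0 k).
Proof.
move=> kmn im sm tn; apply: perm_trans (subst_word_perml i t sm) _.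
have -> : m = (i + (1 + (m - i.+1)))%N by lia.
have nt : size t = n by rewrite (perm_size tn) size_iota.
rewrite 2!iotaD add0n [iota i 1]/= subst_word_in; try by rewrite mem_iota; lia.
have -> : k = (i + (n + (m - i.+1)))%N by lia.
rewrite 2!iotaD add0n; apply: perm_cat; last apply: perm_cat.
- rewrite -[X in perm_eq _ X]map_id; apply/seq.permP=> p; congr count.
  by apply/eq_in_map => j; rewrite mem_iota /= add0n => ->.
- by rewrite -[i in iota i n]addn0 iotaDl; apply: perm_map.
- have E x q : iota x q = [seq (x + l)%N | l <- iota 0 q] by rewrite -iotaDl addn0.
  rewrite (E (i + 1)%N) (E (i + n)%N) -map_comp nt.
  apply/seq.permP => p; congr count; apply: eq_map => j /=.
  by have -> : (i + 1 + j < i)%N = false; lia.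
Qed.

Lemma word_perm_comp k m n i (s : 'S_m) (t : 'S_n) :
  k.+1 = (m + n)%N -> (i < m)%N ->
  word (perm_comp k i s t) = subst_word i (word s) (word t).
Proof.
by move=> kmn im; apply/perm_of_wordK/perm_subst_word/perm_word/perm_word.
Qed.

Implicit Types (i j x : nat) (s t u : seq nat).

Lemma size_subst_word i s t : uniq s -> i \in s ->
  size (subst_word i s t) = (size s + size t).-1.
Proof.
move=> us si; case/splitPr: si us => s1 s2 us.
have /andP[h h'] : (i \notin s1) && (i \notin s2).
  by move: us; rewrite cat_uniq /= negb_or => /and3P[_ /andP[-> _] /andP[-> _]].
by rewrite subst_word_in // !size_cat !size_map /=; lia.
Qed.

Lemma subst_word_cons i x s t :
  subst_word i (x :: s) t =
  (if x == i then [seq (i + l)%N | l <- t]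
   else [:: if (x < i)%N then x else (x + size t).-1]) ++ subst_word i s t.
Proof. by []. Qed.

Lemma subst_word_addn i j t u :
  subst_word (i + j) [seq (i + l)%N | l <- t] u = [seq (i + l)%N | l <- subst_word j t u].
Proof.
elim: t => //= x t IH; rewrite !subst_word_cons IH map_cat eqn_add2l ltn_add2l.
case: ltngtP => xj //=; first by congr (_ :: _); lia.
by congr (_ ++ _); rewrite -map_comp; apply: eq_map => l /=; lia.
Qed.

Lemma subst_word_seq i j s t u : uniq t -> j \in t -> (j < size t)%N ->
  subst_word (i + j) (subst_word i s t) u = subst_word i s (subst_word j t u).
Proof.
move=> ut jt js; elim: s => //= x s IH.
rewrite !subst_word_cons subst_word_cat IH; congr (_ ++ _).
case: ltngtP => xi /=; last exact: subst_word_addn.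
  rewrite subst_word_cons cats0.
  have -> : (x == i + j)%N = false by lia.
  by have -> : (x < i + j)%N by lia.
rewrite subst_word_cons cats0 size_subst_word //.
have -> : ((x + size t).-1 == i + j)%N = false by lia.
have -> : ((x + size t).-1 < i + j)%N = false by lia.
by congr [:: _]; lia.
Qed.

Lemma subst_word_par i j s t u : (i < j)%N -> (forall y, y \in t -> (y < size t)%N) ->
  subst_word (j + size t).-1 (subst_word i s t) u = subst_word i (subst_word j s u) t.
Proof.
move=> ij ht; elim: s => //= x s IH.
rewrite !subst_word_cons !subst_word_cat IH; congr (_ ++ _).
case: (ltngtP x i) => xi /=.
- have -> : (x == j) = false by lia.
  have -> : (x < j)%N by lia.
  rewrite !subst_word_cons !cats0.
  have -> : (x == i) = false by lia.
  rewrite xi.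
  have -> : (x == (j + size t).-1) = false by lia.
  by have -> : (x < (j + size t).-1)%N by lia.
- case: (ltngtP x j) => xj /=.
  + rewrite !subst_word_cons !cats0.
    have -> : (x == i) = false by lia.
    have -> : (x < i)%N = false by lia.
    have -> : ((x + size t).-1 == (j + size t).-1) = false by lia.
    by have -> : ((x + size t).-1 < (j + size t).-1)%N by lia.
  + rewrite !subst_word_cons !cats0.
    have -> : ((x + size u).-1 == i) = false by lia.
    have -> : ((x + size u).-1 < i)%N = false by lia.
    have -> : ((x + size t).-1 == (j + size t).-1) = false by lia.
    have -> : ((x + size t).-1 < (j + size t).-1)%N = false by lia.
    by congr [:: _]; lia.
  + rewrite subst_word_cons cats0 xj eqxx.
    rewrite subst_word_notin; last by apply/mapP => -[y _]; lia.
    rewrite -map_comp; apply: eq_map => y /=.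
    by have -> : (j + y < i)%N = false; lia.
- have -> : (x == j) = false by lia.
  have -> : (x < j)%N by lia.
  rewrite subst_word_cons cats0 xi eqxx.
  rewrite subst_word_notin; last by apply/mapP => -[y /ht]; lia.
  rewrite -map_comp; apply/eq_in_map => y /ht hy /=.
  by have -> : (i + y < (j + size t).-1)%N by lia.
Qed.

Lemma index_notin_cat (T : eqType) (x : T) (s1 s2 : seq T) :
  x \notin s1 -> index x (s1 ++ s2) = (size s1 + index x s2)%N.
Proof. by rewrite index_cat => /negbTE ->. Qed.

Lemma index_subst_in i j s t : uniq s -> i \in s -> j \in t -> (j < size t)%N ->
  index (i + j)%N (subst_word i s t) = (index i s + index j t)%N.
Proof.
move=> us si jt js; case/splitPr: si us => s1 s2 us.
have /andP[h h'] : (i \notin s1) && (i \notin s2).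
  by move: us; rewrite cat_uniq /= negb_or => /and3P[_ /andP[-> _] /andP[-> _]].
rewrite subst_word_in // (index_notin_cat _ h) /= eqxx addn0 index_notin_cat; last first.
  apply/mapP => -[x xs1]; have xi : x != i by apply: contraNneq h => <-.
  by case: ltnP; lia.
rewrite size_map; congr (_ + _)%N.
rewrite index_cat map_f // index_map //; exact: addnI.
Qed.

Definition shiftl i n x := if (x < i)%N then x else (x + n).-1.

Lemma index_subst_out i x s t :
  (forall y, y \in t -> (y < size t)%N) -> uniq s -> i \in s -> x \in s -> x != i ->
  index (shiftl i (size t) x) (subst_word i s t) =
  if (index x s < index i s)%N then index x s else (index x s + size t).-1.
Proof.
move=> ht + + + xi; rewrite /shiftl; elim: s => //= y s IH /andP[ys us].
rewrite !inE subst_word_cons.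
have sinj a b : a != i -> b != i ->
   (if (a < i)%N then a else (a + size t).-1) =
   (if (b < i)%N then b else (b + size t).-1) -> a = b.
  by case: ltnP => ?; case: ltnP => ?; lia.
have [yi _|yi /= iis] := eqVneq y i; last first.
  have [-> _|yx /= xs] := eqVneq y x; first by rewrite eqxx.
  rewrite ifF; last by apply/negbTE/eqP => /sinj E; move/eqP: yx; apply; exact: E.
  rewrite IH // ltnS; case: ltnP => // le.
  have : index x s != index i s.
    by apply: contraNneq xi => E; rewrite -(nth_index 0%N xs) E nth_index.
  lia.
subst y; rewrite (negbTE xi) eq_sym (negbTE xi) /= => xs.
have nx : (if (x < i)%N then x else (x + size t).-1) \notin [seq (i + l)%N | l <- t].
  by apply/mapP => -[l /ht]; case: (ltnP x i); lia.
rewrite index_notin_cat // size_map subst_word_notin // addnC.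
congr (_ + _)%N; elim: s ys us xs {IH} => //= y s IH.
rewrite !inE negb_or => /andP[iy ys] /andP[_ us].
have [->|xy /= xs] := eqVneq x y; first by rewrite eqxx.
rewrite ifF; last first.
  by apply/negbTE/eqP => /esym /sinj E; move/eqP: xy; apply; apply: E => //; rewrite eq_sym.
by rewrite IH.
Qed.

End Words.

(* [op_act a s] is the operation (x_0, ..., x_(n-1)) |-> a(x_(s 0), ...,
   x_(s (n-1))).  With the left-to-right product of permutations this is a right
   action. *)
Record operad := Operad {
  op_ns :> ns_operad;
  op_act : forall n, op_ns n -> 'S_n -> op_ns n;
  op_actD : forall n (a b : op_ns n) s, op_act (a + b) s = op_act a s + op_act b s;
  op_act1 : forall n (a : op_ns n), op_act a 1%g = a;
  op_actM : forall n (a : op_ns n) s t, op_act a (s * t)%g = op_act (op_act a s) t;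
  op_equivariant : forall k m n (j : 'I_m) (a : op_ns m) (b : op_ns n)
      (s : 'S_m) (t : 'S_n),
    k.+1 = (m + n)%N ->
    ns_comp k (s j) (op_act a s) (op_act b t) =
    op_act (ns_comp k j a b) (perm_comp k (s j) s t)
}.

Section Regular.
Variable P : ns_operad.

(* P(n) (x) Z[S_n], with f standing for the sum of the f(s) (x) s; here a (x) s
   is the operation a(x_(s 0), ..., x_(s (n-1))). *)
Definition sg_car n : zmodType := {ffun 'S_n -> P n}.

Definition sg_elt n (a : P n) (s : 'S_n) : sg_car n :=
  [ffun t => if t == s then a else 0].

(* The input x_i of a (x) s sits at the position of i in the word of s. *)
Definition sg_comp (k m n i : nat) (f : sg_car m) (g : sg_car n) : sg_car k :=
  \sum_(s : 'S_m) \sum_(t : 'S_n)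
    sg_elt (ns_comp k (index i (word s)) (f s) (g t)) (perm_comp k i s t).

Definition sg_act n (f : sg_car n) (s : 'S_n) : sg_car n :=
  [ffun t : 'S_n => f (t * s^-1)%g].

Lemma sg_elt0 n (s : 'S_n) : sg_elt (0 : P n) s = 0.
Proof. by apply/ffunP => t; rewrite !ffunE if_same. Qed.

Lemma sg_eltD n (a b : P n) (s : 'S_n) : sg_elt (a + b) s = sg_elt a s + sg_elt b s.
Proof. by apply/ffunP => t; rewrite !ffunE; case: ifP; rewrite ?addr0. Qed.

Lemma sg_sum n (f : sg_car n) : f = \sum_s sg_elt (f s) s.
Proof.
apply/ffunP => t; rewrite sum_ffunE (bigD1 t) //= big1 ?addr0 ?ffunE ?eqxx //.
by move=> s /negbTE st; rewrite ffunE eq_sym st.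
Qed.

Lemma sg_ind n (Q : sg_car n -> Prop) :
  Q 0 -> (forall f g, Q f -> Q g -> Q (f + g)) -> (forall a s, Q (sg_elt a s)) ->
  forall f, Q f.
Proof. by move=> Q0 QD QU f; rewrite (sg_sum f); apply: big_ind. Qed.

Section InRange.
Variables (k m n i : nat).
Hypotheses (kmn : k.+1 = (m + n)%N) (im : (i < m)%N).
Implicit Types (f : sg_car m) (g : sg_car n).

Lemma sg_compDl f f' g : sg_comp k i (f + f') g = sg_comp k i f g + sg_comp k i f' g.
Proof.
rewrite -big_split; apply: eq_bigr => s _; rewrite -big_split.
by apply: eq_bigr => t _; rewrite ffunE ns_compDl ?sg_eltD ?index_word.
Qed.

Lemma sg_compDr f g g' : sg_comp k i f (g + g') = sg_comp k i f g + sg_comp k i f g'.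
Proof.
rewrite -big_split; apply: eq_bigr => s _; rewrite -big_split.
by apply: eq_bigr => t _; rewrite ffunE ns_compDr ?sg_eltD ?index_word.
Qed.

Lemma sg_comp0l g : sg_comp k i (0 : sg_car m) g = 0.
Proof. by apply: (addrI (sg_comp k i (0 : sg_car m) g)); rewrite -sg_compDl !addr0. Qed.

Lemma sg_comp0r f : sg_comp k i f (0 : sg_car n) = 0.
Proof. by apply: (addrI (sg_comp k i f (0 : sg_car n))); rewrite -sg_compDr !addr0. Qed.

Lemma sg_compU a s b t :
  sg_comp k i (sg_elt a s : sg_car m) (sg_elt b t : sg_car n) =
  sg_elt (ns_comp k (index i (word s)) a b) (perm_comp k i s t).
Proof.
rewrite /sg_comp (bigD1 s) //= [X in _ + X]big1 ?addr0; last first.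
  move=> s' /negbTE ss'; apply: big1 => t' _.
  by rewrite [sg_elt a s s']ffunE ss' ns_comp0l ?sg_elt0 ?index_word.
rewrite (bigD1 t) //= big1 ?addr0 ?ffunE ?eqxx //.
move=> t' /negbTE tt'.
by rewrite [sg_elt b t t']ffunE tt' ns_comp0r ?sg_elt0 ?index_word.
Qed.

End InRange.

Lemma sg_actD n (f g : sg_car n) s : sg_act (f + g) s = sg_act f s + sg_act g s.
Proof. by apply/ffunP => t; rewrite !ffunE. Qed.

Lemma sg_act0 n s : sg_act (0 : sg_car n) s = 0.
Proof. by apply/ffunP => t; rewrite !ffunE. Qed.

Lemma sg_act1 n (f : sg_car n) : sg_act f 1%g = f.
Proof. by apply/ffunP => t; rewrite ffunE invg1 mulg1. Qed.

Lemma sg_actM n (f : sg_car n) s t : sg_act f (s * t)%g = sg_act (sg_act f s) t.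
Proof. by apply/ffunP => u; rewrite !ffunE invMg mulgA. Qed.

Lemma sg_actU n (a : P n) s t : sg_act (sg_elt a s) t = sg_elt a (s * t)%g.
Proof.
apply/ffunP => u; rewrite !ffunE; congr (if _ then _ else _).
by rewrite -(inj_eq (mulIg t)) mulgKV.
Qed.

Lemma sg_assoc_seq k p q m n l i j (f : sg_car m) (g : sg_car n) (h : sg_car l) :
  p.+1 = (m + n)%N -> q.+1 = (n + l)%N -> k.+1 = (p + l)%N ->
  (i < m)%N -> (j < n)%N ->
  sg_comp k (i + j) (sg_comp p i f g) h = sg_comp k i f (sg_comp q j g h).
Proof.
move=> hp hq hk im jn.
have hk' : k.+1 = (m + q)%N by lia.
have ij : (i + j < p)%N by lia.
elim/sg_ind: f => [|f f' IH IH'|a s].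
- by rewrite !sg_comp0l.
- by rewrite !sg_compDl // IH IH'.
elim/sg_ind: g => [|g g' IH IH'|b t].
- by rewrite (sg_comp0l hq) // !(sg_comp0r hk') // (sg_comp0r hp) // sg_comp0l.
- by rewrite (sg_compDl hq) // (sg_compDr hp) // (sg_compDl hk) // sg_compDr // IH IH'.
elim/sg_ind: h => [|h h' IH IH'|c u].
- by rewrite (sg_comp0r hk) // (sg_comp0r hq) // sg_comp0r.
- by rewrite (sg_compDr hk) // (sg_compDr hq) // sg_compDr // IH IH'.
have E : perm_comp k (i + j) (perm_comp p i s t) u = perm_comp k i s (perm_comp q j t u).
  apply: word_inj; rewrite !word_perm_comp // subst_word_seq ?uniq_word ?mem_word //.
  by rewrite size_word.
rewrite !sg_compU // E; congr sg_elt.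
rewrite word_perm_comp // index_subst_in ?uniq_word ?mem_word ?size_word //.
by rewrite (@ns_assoc_seq P k p q) ?index_word.
Qed.

Lemma sg_assoc_par k p q m n l i j (f : sg_car m) (g : sg_car n) (h : sg_car l) :
  p.+1 = (m + n)%N -> q.+1 = (m + l)%N -> k.+1 = (p + l)%N ->
  (i < j < m)%N ->
  sg_comp k (j + n).-1 (sg_comp p i f g) h = sg_comp k i (sg_comp q j f h) g.
Proof.
move=> hp hq hk /andP[ij jm].
have hk' : k.+1 = (q + n)%N by lia.
have im : (i < m)%N by lia.
have iq : (i < q)%N by lia.
have jnp : ((j + n).-1 < p)%N by lia.
elim/sg_ind: f => [|f f' IH IH'|a s].
- by rewrite (sg_comp0l hp) // (sg_comp0l hk) // (sg_comp0l hq) // sg_comp0l.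
- by rewrite (sg_compDl hp) // (sg_compDl hk) // (sg_compDl hq) // sg_compDl // IH IH'.
elim/sg_ind: g => [|g g' IH IH'|b t].
- by rewrite (sg_comp0r hp) // (sg_comp0l hk) // sg_comp0r.
- by rewrite (sg_compDr hp) // (sg_compDl hk) // sg_compDr // IH IH'.
elim/sg_ind: h => [|h h' IH IH'|c u].
- by rewrite (sg_comp0r hk) // (sg_comp0r hq) // sg_comp0l.
- by rewrite (sg_compDr hk) // (sg_compDr hq) // sg_compDl // IH IH'.
have ht y : y \in word t -> (y < size (word t))%N by rewrite mem_word size_word.
have hu y : y \in word u -> (y < size (word u))%N by rewrite mem_word size_word.
have := subst_word_par (word s) (word u) ij ht; rewrite size_word => W.
have E : perm_comp k (j + n).-1 (perm_comp p i s t) u =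
         perm_comp k i (perm_comp q j s u) t.
  by apply: word_inj; rewrite !word_perm_comp.
rewrite !sg_compU // E; congr sg_elt; rewrite !word_perm_comp //.
have := @index_subst_out i j (word s) (word t) ht (uniq_word s).
have := @index_subst_out j i (word s) (word u) hu (uniq_word s).
have ji : (j < i)%N = false by lia.
rewrite /shiftl !mem_word !size_word ij ji.
move=> -> //; last by lia.
move=> -> //; last by lia.
have [li lj] := (index_word s im, index_word s jm).
case: (ltngtP (index j (word s)) (index i (word s))) => lij.
- by rewrite (@ns_assoc_par P k q p) // lij.
- by rewrite (@ns_assoc_par P k p q) // lij.
have := nth_index 0%N (etrans (mem_word s i) im).
by rewrite -lij nth_index ?mem_word //; lia.
Qed.

Definition sg_id : sg_car 1%N := sg_elt (ns_id P) 1%g.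

Lemma sg_id_l n (g : sg_car n) : sg_comp n 0 sg_id g = g.
Proof.
elim/sg_ind: g => [|g g' IH IH'|b t].
- by rewrite sg_comp0r.
- by rewrite sg_compDr // IH IH'.
rewrite sg_compU // word1 /= ns_id_l; congr sg_elt.
apply: word_inj; rewrite word_perm_comp // word1 /subst_word /= cats0.
by rewrite -[RHS]map_id; apply: eq_map.
Qed.

Lemma sg_id_r m i (f : sg_car m) : (i < m)%N -> sg_comp m i f sg_id = f.
Proof.
move=> im; have hm : m.+1 = (m + 1)%N by rewrite addn1.
elim/sg_ind: f => [|g g' IH IH'|a s].
- by rewrite sg_comp0l.
- by rewrite sg_compDl // IH IH'.
rewrite sg_compU // ns_id_r ?index_word //; congr sg_elt.
apply: word_inj; rewrite word_perm_comp // word1 /subst_word /=.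
rewrite -[RHS]flatten_seq1; congr flatten; apply: eq_map => j.
by case: eqVneq => [->|_]; rewrite ?addn0 ?addn1 ?if_same.
Qed.

Definition sg_ns_operad : ns_operad :=
  NsOperad (fun k m n i f f' g e h => sg_compDl e h f f' g)
    (fun k m n i f g g' e h => sg_compDr e h f g g') sg_assoc_seq sg_assoc_par sg_id_l sg_id_r.

Lemma index_wordE n (s : 'S_n) (j : 'I_n) : index (val j) (word s) = s^-1%g j.
Proof.
rewrite -{1}(permKV s j) /word (index_map (f := val \o s)) /=; last first.
  by move=> x y /= /val_inj /perm_inj.
by rewrite index_enum_ord.
Qed.

Lemma perm_compM k m n (j : 'I_m) (s r : 'S_m) (t p : 'S_n) : k.+1 = (m + n)%N ->
  perm_comp k (r j) (s * r)%g (t * p)%g =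
  (perm_comp k j s t * perm_comp k (r j) r p)%g.
Proof.
move=> kmn.
have wM q (a b : 'S_q) : word (a * b)%g = [seq nth 0%N (word b) x | x <- word a].
  rewrite /word -map_comp; apply: eq_map => x /=.
  by rewrite (nth_map x) ?size_enum_ord // nth_ord_enum permM.
apply: word_inj; rewrite wM !word_perm_comp // !wM.
have uj := uniq_word r; have jm := ltn_ord j; have rjm := ltn_ord (r j).
have hp y : y \in word p -> (y < size (word p))%N by rewrite mem_word size_word.
have wr (x : 'I_m) : nth 0%N (word r) x = r x.
  by rewrite /word (nth_map x) ?size_enum_ord // nth_ord_enum.
have ir (x : 'I_m) : index (val (r x)) (word r) = x.
  by rewrite index_wordE permK.
set S := subst_word (r j) (word r) (word p).
have sS : perm_eq S (iota 0 k) by apply: perm_subst_word (perm_word r) (perm_word p).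
have nS1 l : (l < n)%N -> nth 0%N S (j + l) = (r j + nth 0%N (word p) l)%N.
  move=> ln; have lp : nth 0%N (word p) l \in word p by rewrite mem_nth ?size_word.
  have := @index_subst_in (r j) (nth 0%N (word p) l) (word r) (word p) uj.
  rewrite mem_word lp size_word -(mem_word p) lp => /(_ rjm isT isT).
  rewrite ir index_uniq ?uniq_word ?size_word // => <-; rewrite nth_index //.
  rewrite (perm_mem sS) mem_iota.
  by move: lp; rewrite mem_word; lia.
have nS2 (x : 'I_m) : x != j -> nth 0%N S (shiftl j n x) = shiftl (r j) n (r x).
  move=> xj; have rxj : val (r x) != val (r j).
    by rewrite (inj_eq val_inj) (inj_eq perm_inj).
  have := index_subst_out hp uj _ _ rxj; rewrite !mem_word !ltn_ord size_word !ir.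
  move=> /(_ isT isT) E.
  rewrite {1}/shiftl -E nth_index // (perm_mem sS) mem_iota /= add0n.
  move: (ltn_ord (r x)) rxj; rewrite /shiftl /=; case: (ltnP (r x) (r j)); lia.
rewrite /subst_word map_flatten; set w := word s; set v := word t.
have hw x : x \in w -> (x < m)%N by rewrite mem_word.
have hv x : x \in v -> (x < n)%N by rewrite mem_word.
have sv : size v = n by rewrite size_word.
move: w v hw hv sv => w v hw hv sv.
rewrite -!map_comp; congr flatten.
apply/eq_in_map => x /hw xm; rewrite /= !size_map sv ?size_word.
case: (eqVneq x j) => [->|xj].
  by rewrite wr eqxx -!map_comp; apply/eq_in_map => l /hv ln /=; rewrite nS1.
have xj' : Ordinal xm != j by apply: contraNneq xj => <-.
rewrite -[x]/(val (Ordinal xm)) wr (inj_eq val_inj) (inj_eq perm_inj) (negbTE xj') /=.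
by congr [:: _]; have := nS2 _ xj'; rewrite /shiftl.
Qed.

Lemma sg_equivariant k m n (j : 'I_m) (f : sg_car m) (g : sg_car n)
    (s : 'S_m) (t : 'S_n) :
  k.+1 = (m + n)%N ->
  sg_comp k (s j) (sg_act f s) (sg_act g t) =
  sg_act (sg_comp k j f g) (perm_comp k (s j) s t).
Proof.
move=> kmn; have sj := ltn_ord (s j); have jm := ltn_ord j.
elim/sg_ind: f => [|f f' IH IH'|a s'].
- by rewrite sg_act0 !sg_comp0l // sg_act0.
- by rewrite sg_actD !sg_compDl // sg_actD IH IH'.
elim/sg_ind: g => [|g g' IH IH'|b t'].
- by rewrite sg_act0 !sg_comp0r // sg_act0.
- by rewrite sg_actD !sg_compDr // sg_actD IH IH'.
rewrite !sg_actU !sg_compU // sg_actU perm_compM //; congr (sg_elt (ns_comp _ _ _ _) _).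
by rewrite !index_wordE invMg permM permK.
Qed.

Definition regular_operad : operad :=
  @Operad sg_ns_operad sg_act sg_actD sg_act1 sg_actM sg_equivariant.

End Regular.

(* A finitely generated free module V', given by a finite basis, together with a
   submodule R' of F(V')(3). *)
Record bq_data := BQData {
  bq_gen : finType;
  bq_rel : set (free_ns_operad bq_gen 3%N);
  bq_rel0 : bq_rel 0;
  bq_relB : forall r r', bq_rel r -> bq_rel r' -> bq_rel (r - r')
}.

Definition span_bq (X : finType) (A : set (free_ns_operad X 3%N)) : bq_data :=
  @BQData X (zspan A) (zspan0 A) (@zspanB _ A).

Definition bq_operad (D : bq_data) : operad :=
  regular_operad (quo_ns_operad (@bq_rel D)).

Section Quadratic.
Variable X : Type.

Definition gen (x : X) : free_ns_operad X 2%N :=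
  tree_elt 2 (PNode x PLeaf PLeaf).

Definition comp1 (a b : free_ns_operad X 2%N) : free_ns_operad X 3%N := ns_comp 3%N 0%N a b.
Definition comp2 (a b : free_ns_operad X 2%N) : free_ns_operad X 3%N := ns_comp 3%N 1%N a b.

End Quadratic.

Section BlackSquare.
Variables X Y : finType.

(* PNode x (PNode y PLeaf PLeaf) PLeaf is the basis element comp1 x y, and
   PNode x PLeaf (PNode y PLeaf PLeaf) is comp2 x y; the other trees do not have
   three leaves. *)
Definition psi_tree (t : ptree X) (u : ptree Y) : free_ns_operad (X * Y)%type 3%N :=
  match t, u with
  | PNode x (PNode y PLeaf PLeaf) PLeaf, PNode x' (PNode y' PLeaf PLeaf) PLeaf =>
      comp1 (gen (x, x')) (gen (y, y'))
  | PNode x PLeaf (PNode y PLeaf PLeaf), PNode x' PLeaf (PNode y' PLeaf PLeaf) =>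
      - comp2 (gen (x, x')) (gen (y, y'))
  | _, _ => 0
  end.

Definition psi (r : free_ns_operad X 3%N) (s : free_ns_operad Y 3%N) :
    free_ns_operad (X * Y)%type 3%N :=
  fglin (fun t : ptree_of X 3 =>
    fglin (fun u : ptree_of Y 3 => psi_tree (val t) (val u)) s) r.

End BlackSquare.

Definition black_square (D E : bq_data) : bq_data :=
  @span_bq (bq_gen D * bq_gen E)%type
    [set psi r s | r in @bq_rel D & s in @bq_rel E].

Definition Dend : bq_data :=
  let prec := gen false in
  let succ := gen true in
  @span_bq bool [set` [::
    comp1 prec prec - (comp2 prec prec + comp2 prec succ);
    comp1 prec succ - comp2 succ prec;
    comp1 succ prec + comp1 succ succ - comp2 succ succ ]].

(* Aguiar and Loday's four operations, named by the directions of their arrows.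
   [nw] is the generator prec (x) prec, [ne] is succ (x) prec, [sw] is
   prec (x) succ and [se] is succ (x) succ. *)
Definition Quad : bq_data :=
  let nw := gen (false, false) in
  let ne := gen (true, false) in
  let sw := gen (false, true) in
  let se := gen (true, true) in
  let prec := nw + sw in
  let succ := ne + se in
  let wedge := nw + ne in
  let vee := sw + se in
  let star := nw + ne + sw + se in
  @span_bq (bool * bool)%type [set` [::
    comp1 nw nw - comp2 nw star;
    comp1 nw ne - comp2 ne prec;
    comp1 ne wedge - comp2 ne succ;
    comp1 nw sw - comp2 sw wedge;
    comp1 nw se - comp2 se nw;
    comp1 ne vee - comp2 se ne;
    comp1 sw prec - comp2 sw vee;
    comp1 sw succ - comp2 se sw;
    comp1 se star - comp2 se se ]].

(* Bar construction of an operad with P(0) = 0 and P(1) = Z id, so that the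
   augmentation ideal is the part of arity at least 2.

   BNode a ts stands for a vertex s a, of degree 1, grafted with the trees ts.
   The underlying module of F^c(s P), in arity n, is the quotient of the free
   module on the planar trees whose vertices are decorated by the augmentation
   ideal and whose leaves are labelled bijectively by {0, ..., n-1}, by the
   relations [bar_add] (tensor product over Z of the decorations) and [bar_act]
   (coinvariants, i.e. independence of the planar structure).  The suspended
   vertices of a tree are ordered depth first, from left to right. *)
Inductive bar_tree (P : operad) :=
| BLeaf of nat
| BNode k of P k & seq (bar_tree P).
Arguments BLeaf {P}.
HB.instance Definition _ (P : operad) := gen_eqMixin (bar_tree P).
HB.instance Definition _ (P : operad) := gen_choiceMixin (bar_tree P).

Section Bar.
Variable P : operad.
Implicit Types t u : bar_tree P.

Fixpoint bar_leaves t : seq nat :=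
  match t with
  | BLeaf i => [:: i]
  | BNode _ _ ts => flatten [seq bar_leaves u | u <- ts]
  end.

Fixpoint bar_degree t : nat :=
  match t with
  | BLeaf _ => 0
  | BNode _ _ ts => (sumn [seq bar_degree u | u <- ts]).+1
  end.

(* P is generated by binary operations: its part of arity k has weight k - 1. *)
Fixpoint bar_weight t : nat :=
  match t with
  | BLeaf _ => 0
  | BNode k _ ts => k.-1 + sumn [seq bar_weight u | u <- ts]
  end.

Fixpoint bar_wf t : bool :=
  match t with
  | BLeaf _ => true
  | BNode k _ ts => [&& (1 < k)%N, size ts == k & all bar_wf ts]
  end.

Definition bar_basis (n w d : nat) t : bool :=
  [&& bar_wf t, perm_eq (bar_leaves t) (iota 0 n), bar_weight t == w & bar_degree t == d].

Definition bar_chain (n w d : nat) : set {freeg (bar_tree P)} :=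
  [set c | all (bar_basis n w d) (dom c)].

(* Exponent of the Koszul sign for reordering ts as (ts_(s 0), ts_(s 1), ...). *)
Definition act_exponent k (s : 'S_k) (ts : seq (bar_tree P)) : nat :=
  let deg (i : 'I_k) := bar_degree (nth (BLeaf 0) ts i) in
  (\sum_(i < k) \sum_(j < k | (i < j) && (s j < s i)) deg (s i) * deg (s j))%N.

Inductive bar_add : bar_tree P -> bar_tree P -> bar_tree P -> Prop :=
| bar_add_root k (a b : P k) ts :
    bar_add (BNode (a + b) ts) (BNode a ts) (BNode b ts)
| bar_add_in k (a : P k) ts1 ts2 t t1 t2 of bar_add t t1 t2 :
    bar_add (BNode a (ts1 ++ t :: ts2))
      (BNode a (ts1 ++ t1 :: ts2)) (BNode a (ts1 ++ t2 :: ts2)).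

Inductive bar_act : nat -> bar_tree P -> bar_tree P -> Prop :=
| bar_act_root k (a : P k) (s : 'S_k) ts of size ts = k :
    bar_act (act_exponent s ts)
      (BNode (op_act a s) ts)
      (BNode a [seq nth (BLeaf 0) ts i | i <- word s])
| bar_act_in k (a : P k) ts1 ts2 e t t1 of bar_act e t t1 :
    bar_act e (BNode a (ts1 ++ t :: ts2)) (BNode a (ts1 ++ t1 :: ts2)).

Definition bar_rel : set {freeg (bar_tree P)} :=
  zspan ([set c | exists t t1 t2, bar_add t t1 t2 /\ c = << t >> - << t1 >> - << t2 >>]
     `|` [set c | exists e t t1, bar_act e t t1 /\ c = << t >> - << (-1) ^+ e *g t1 >>]).

(* The contractions of the internal edges of t, one for each vertex other than
   the root: an edge is listed at the place of its upper vertex. *)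
Fixpoint contractions t : seq (bar_tree P) :=
  match t with
  | BLeaf _ => [::]
  | BNode m a ts =>
    (fix go (ts1 ts2 : seq (bar_tree P)) : seq (bar_tree P) :=
      match ts2 with
      | [::] => [::]
      | u :: ts3 =>
          (if u is BNode n b us
           then [:: BNode (ns_comp (m + n).-1 (size ts1) a b) (ts1 ++ us ++ ts3)]
           else [::])
          ++ [seq BNode a (ts1 ++ v :: ts3) | v <- contractions u]
          ++ go (rcons ts1 u) ts3
      end) [::] ts
  end.

(* Contracting the edge below the vertex number l + 1 (the root being number 0)
   moves that vertex next to the vertex below it, and applies the degree -1 map
   s a (x) s b |-> s (a \circ b): the Koszul sign is (-1)^l. *)
Definition bar_diff (c : {freeg (bar_tree P)}) : {freeg (bar_tree P)} :=
  fglin (fun t => let ts := contractions t in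
    \sum_(l < size ts) << (-1) ^+ l *g nth t ts l >>) c.

(* Vanishing of the homology of the quotient complex in arity n, weight w and
   degree d. *)
Definition bar_acyclic (n w d : nat) : Prop :=
  forall c, bar_chain n w d c -> bar_rel (bar_diff c) ->
  exists2 b, bar_chain n w d.+1 b & bar_rel (c - bar_diff b).

Definition koszul : Prop := forall n w d, d <> w -> bar_acyclic n w d.

End Bar.

(* Main.v *)
Require Import Defs.
From HB Require Import structures.
From mathcomp Require Import all_boot all_order fingroup perm all_algebra.
From mathcomp Require Import zify boolp classical_sets freeg.

Set Implicit Arguments.
Unset Strict Implicit.
Unset Printing Implicit Defensive.

Import GRing.Theory.
Local Open Scope ring_scope.

(** Write the four operations of quadri-algebras as pairs of bits, [false] for prec and
[true] for succ, ordered coordinatewise.  There is one relation for every [x <= y]: the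
sum of [(a z b) x c] over [z] in [left_ops x y] equals the sum of [a y (b z c)] over [z]
in [right_ops x y], and [y] is the largest element of [left_ops x y].  The relation can
therefore be used as a rule that rewrites [(a y b) x c].  The normal forms are the binary
trees in which no left child of a vertex [x] has a label [y >= x]; an edge that violates
this is called critical.  The product [mul] is defined by rewriting to normal form, and
[quad_rel_normal] shows that it satisfies all the relations.  This is the confluence of
the rules, and it makes the normal trees a basis of the operad of quadri-algebras, in
which being normal is a condition on single edges.

Consequently the bar construction has a basis of marked trees: binary trees of operations
with marks on some internal edges, which separate the vertices of the bar construction,
such that all the critical edges are marked.  The differential [dmark] removes a mark and
normalises the result.  Rewriting lowers the weight [wt]; so, up to lighter trees, the
removal of a mark gives zero if its edge is critical and just erases the mark otherwise.
If a tree has an edge that is not critical, marking a distinguished such edge is a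
contracting homotopy up to lighter trees ([dlead_homotopy]), and an induction on the
weight shows that cycles are boundaries ([marked_cycle]).  If all the internal edges are
critical, all of them are marked, and then the degree equals the weight.

The rest compares this complex with the one of the bar construction of the symmetric
operad.  As the operad is regular, decorated trees modulo the symmetric groups have planar
representatives.  The map [phi] evaluates the decorations of a tree in the quadri-algebra
of marked trees, and [bar_of] cuts a marked tree at its marks; they are inverse to each
other modulo the relations ([phi_bar_of], [good_reduces]), and contracting an edge
corresponds to removing a mark ([contractions_spec]).  Signs are handled once and for all
by comparing the depth first order of the edges of a tree with an order that does not
depend on the planar structure: an edge is determined by the set of the leaves above it,
coded by the number [key].  The Koszul signs become parities of numbers of inversions
([inv_delete], [inv_flatten_perm]).

Finally, the relations of quadri-algebras are the products of those of dendriform algebras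
because the sets [left_ops x y] and [right_ops x y] are products ([psi_relator]). *)

(** * Free modules on a set: supports and bilinear extensions *)

Section Span.
Variable K : choiceType.
Implicit Types (Q : K -> Prop) (c : {freeg K}).

Definition span Q : set {freeg K} := zspan [set c | exists2 x, Q x & c = << x >>].

Lemma span_ind Q (R : {freeg K} -> Prop) :
  R 0 -> (forall c c', R c -> R c' -> R (c - c')) ->
  (forall x, Q x -> R << x >>) -> forall c, span Q c -> R c.
Proof. by move=> R0 RB RU c; elim=> [_ [x Qx ->]||]; auto. Qed.

Lemma spanU (Q : K -> Prop) x : Q x -> span Q << x >>.
Proof. by move=> Qx; apply: zspan_gen; exists x. Qed.

Lemma span0 Q : span Q 0. Proof. exact: zspan0. Qed.
Lemma spanB Q c c' : span Q c -> span Q c' -> span Q (c - c').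
Proof. exact: zspanB. Qed.
Lemma spanN Q c : span Q c -> span Q (- c).
Proof. by rewrite -sub0r; apply/spanB/span0. Qed.
Lemma spanD Q c c' : span Q c -> span Q c' -> span Q (c + c').
Proof. by move=> h /spanN h'; rewrite -[c']opprK; apply: spanB. Qed.
Lemma span_sum Q (I : eqType) (s : seq I) (F : I -> {freeg K}) :
  (forall i, i \in s -> span Q (F i)) -> span Q (\sum_(i <- s) F i).
Proof.
by move=> h; rewrite big_seq; apply: big_ind => // [|c c']; [exact: span0 | exact: spanD].
Qed.

Lemma span_sub (Q Q' : K -> Prop) c : (forall x, Q x -> Q' x) -> span Q c -> span Q' c.
Proof.
move=> h; elim/span_ind => [|c1 c2|x Qx]; [exact: span0 | exact: spanB |].
exact/spanU/h.
Qed.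

Lemma spanT c : span (fun=> True) c.
Proof. by elim/freeg_indB: c => [|c c'|x]; [exact: span0 | exact: spanB | exact: spanU]. Qed.

Lemma span_False c : span (fun=> False) c -> c = 0.
Proof. by elim/span_ind => // c1 c2 -> ->; rewrite subr0. Qed.

Lemma span_domP (p : pred K) c : all p (dom c) <-> span p c.
Proof.
split=> [/allP h|].
  rewrite -[c]freeg_sumE; apply: span_sum => x /h px.
  rewrite -[coeff x c]intz -freegU_mulz.
  have hn n : span p (<< x >> *+ n).
    by elim: n => [|n IH]; rewrite ?mulr0n ?mulrS; [exact: span0 | apply: spanD IH; exact: spanU].
  by case: (coeff x c) => n; rewrite ?NegzE ?mulrNz -pmulrn //; apply: spanN.
elim/span_ind => [|c1 c2 h1 h2|x px]; first by rewrite dom0.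
  apply/allP => x /domB; rewrite mem_cat => /orP[]; [exact: (allP h1) | exact: (allP h2)].
by rewrite domU1 /= px.
Qed.

End Span.

Lemma spanI (K : choiceType) (P Q : K -> Prop) c :
  span P c -> span Q c -> span (fun x => P x /\ Q x) c.
Proof.
move=> hP hQ; pose p x := `[< P x >]; pose q x := `[< Q x >].
have /span_domP/allP h1 : span p c by apply: span_sub hP => x /asboolP.
have /span_domP/allP h2 : span q c by apply: span_sub hQ => x /asboolP.
have /span_domP : all (fun x => p x && q x) (dom c) by apply/allP => x hx; rewrite h1 ?h2.
by apply: span_sub => x /andP[/asboolP ? /asboolP ?].
Qed.

Section FgLinear.
Variables (K : choiceType) (M : zmodType).
Implicit Types (f g : K -> M) (c : {freeg K}).

Lemma fglinN f c : fglin f (- c) = - fglin f c.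
Proof. by rewrite -[- c]sub0r fglinB fglin0 sub0r. Qed.

Lemma fglin_sum f (I : Type) (s : seq I) (F : I -> {freeg K}) :
  fglin f (\sum_(i <- s) F i) = \sum_(i <- s) fglin f (F i).
Proof. by elim/big_rec2: _ => [|i x y _ <-]; rewrite ?fglin0 ?fglinD. Qed.

Lemma fglin_subf f g c : fglin (fun x => f x - g x) c = fglin f c - fglin g c.
Proof.
elim/freeg_indB: c => [|c c' IH IH'|x]; last by rewrite !fglinU.
  by rewrite !fglin0 subr0.
by rewrite !fglinB IH IH' !opprD !opprK addrACA.
Qed.

Lemma fglin_0f c : fglin (fun=> 0 : M) c = 0.
Proof. by elim/freeg_indB: c => [|c c' h h'|x]; rewrite ?fglin0 ?fglinU ?fglinB ?h ?h' ?subr0. Qed.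

Lemma fglin_sumf (I : Type) (s : seq I) (F : I -> K -> M) c :
  fglin (fun x => \sum_(i <- s) F i x) c = \sum_(i <- s) fglin (F i) c.
Proof.
elim: s => [|i s IH]; first by rewrite big_nil -[RHS](fglin_0f c); apply: fglin_eq => x; rewrite big_nil.
by rewrite big_cons -IH -fglin_addf; apply: fglin_eq => x; rewrite big_cons.
Qed.

Lemma fglin_eq_span (Q : K -> Prop) f g c :
  span Q c -> (forall x, Q x -> f x = g x) -> fglin f c = fglin g c.
Proof.
move=> + h; elim/span_ind => [|c1 c2 h1 h2|x Qx]; rewrite ?fglin0 ?fglinB ?h1 ?h2 //.
by rewrite !fglinU h.
Qed.

Lemma span_fglin (K' : choiceType) (Q : K -> Prop) (Q' : K' -> Prop) (f : K -> {freeg K'}) c :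
  span Q c -> (forall x, Q x -> span Q' (f x)) -> span Q' (fglin f c).
Proof.
move=> + h; elim/span_ind => [|c1 c2 h1 h2|x Qx]; rewrite ?fglin0 ?fglinB ?fglinU.
- exact: span0.
- exact: spanB.
- exact: h.
Qed.

End FgLinear.

Lemma fglin_id (K : choiceType) (c : {freeg K}) : fglin (fun x => << x >>) c = c.
Proof. by elim/freeg_indB: c => [|c c' h h'|x]; rewrite ?fglin0 ?fglinB ?h ?h' ?fglinU. Qed.

Lemma fglin_comp (K K' : choiceType) (M : zmodType) (f : K -> {freeg K'}) (g : K' -> M) c :
  fglin g (fglin f c) = fglin (fun x => fglin g (f x)) c.
Proof. by elim/freeg_indB: c => [|c c' h h'|x]; rewrite ?fglin0 ?fglinB ?h ?h' ?fglinU. Qed.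

Section Bilinear.
Variables (K K' : choiceType) (M : zmodType) (f : K -> K' -> M).
Implicit Types (c : {freeg K}) (d : {freeg K'}).

Definition bilin c d : M := fglin (fun x => fglin (f x) d) c.

Lemma bilinU x y : bilin << x >> << y >> = f x y.
Proof. by rewrite /bilin !fglinU. Qed.
Lemma bilinUl x d : bilin << x >> d = fglin (f x) d.
Proof. by rewrite /bilin fglinU. Qed.
Lemma bilinUr c y : bilin c << y >> = fglin (f^~ y) c.
Proof. by apply: fglin_eq => x; rewrite fglinU. Qed.
Lemma bilinBl c c' d : bilin (c - c') d = bilin c d - bilin c' d.
Proof. exact: fglinB. Qed.
Lemma bilinDl c c' d : bilin (c + c') d = bilin c d + bilin c' d.
Proof. exact: fglinD. Qed.
Lemma bilin0l d : bilin 0 d = 0. Proof. exact: fglin0. Qed.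
Lemma bilin0r c : bilin c 0 = 0.
Proof. by rewrite -[RHS](fglin_0f M c); apply: fglin_eq => x; rewrite fglin0. Qed.
Lemma bilinBr c d d' : bilin c (d - d') = bilin c d - bilin c d'.
Proof. by rewrite -fglin_subf; apply: fglin_eq => x; rewrite fglinB. Qed.
Lemma bilin_suml d (I : Type) (s : seq I) F :
  bilin (\sum_(i <- s) F i) d = \sum_(i <- s) bilin (F i) d.
Proof. exact: fglin_sum. Qed.
Lemma bilin_sumr c (I : Type) (s : seq I) F :
  bilin c (\sum_(i <- s) F i) = \sum_(i <- s) bilin c (F i).
Proof. by rewrite -fglin_sumf; apply: fglin_eq => x; rewrite fglin_sum. Qed.

End Bilinear.

Lemma span_bilin (K K' K'' : choiceType) (f : K -> K' -> {freeg K''})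
  (Q : K -> Prop) (Q' : K' -> Prop) (Q'' : K'' -> Prop) c d :
  span Q c -> span Q' d -> (forall x y, Q x -> Q' y -> span Q'' (f x y)) ->
  span Q'' (bilin f c d).
Proof.
move=> hc hd h; apply: span_fglin hc _ => x Qx; apply: span_fglin hd _ => y Qy.
exact: h.
Qed.

(** * Operations and relations of quadri-algebras *)

Notation op := (bool * bool)%type.

Definition op_le (x y : op) : bool := (x.1 ==> y.1) && (x.2 ==> y.2).

(** The relation with leading term [(a y b) x c], for [x <= y], says that the sum of the
[(a z b) x c] over [z] in [left_ops x y] is the sum of the [a y (b z c)] over [z] in
[right_ops x y].  In one coordinate these are the three relations of dendriform algebras. *)
Definition left_coord (i j : bool) : seq bool := if i then [:: false; true] else [:: j].
Definition right_coord (i j : bool) : seq bool := if j then [:: i] else [:: false; true].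

Definition left_ops (x y : op) : seq op :=
  [seq (i, j) | j <- left_coord x.2 y.2, i <- left_coord x.1 y.1].

Definition right_ops (x y : op) : seq op :=
  [seq (i, j) | j <- right_coord x.2 y.2, i <- right_coord x.1 y.1].

Definition lower_ops (x y : op) : seq op := [seq z <- left_ops x y | z != y].

(** * Trees with marked vertices *)

(** A marked vertex starts a new block.  The blocks are the vertices of a tree of the bar
construction, decorated by binary trees of operations. *)
Inductive mtree := MLeaf of nat | MNode of bool & op & mtree & mtree.
HB.instance Definition _ := gen_eqMixin mtree.
HB.instance Definition _ := gen_choiceMixin mtree.

Notation mmod := {freeg mtree}.

Definition unmarked (t : mtree) : bool := if t is MNode b _ _ _ then ~~ b else true.

(** Two labels that form the leading term of a relation matter only if the edge between them
is inside a block, that is, if its upper vertex is unmarked. *)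
Definition crit (x : op) (t : mtree) : bool :=
  if t is MNode false y _ _ then op_le x y else false.

Fixpoint normal (t : mtree) : bool :=
  if t is MNode _ x l r then [&& normal l, normal r & ~~ crit x l] else true.

Definition nodeN (x : op) : mmod -> mmod -> mmod :=
  bilin (fun s t => << MNode false x s t >>).

(** The relation for [x <= y] rewrites the product of [a y b] and [t].  The products [a z b]
with [z != y] on its left hand side are grafted without further rewriting, which
[mul_lower] justifies; this is why a structural recursion suffices. *)
Fixpoint mul (x : op) (s t : mtree) {struct s} : mmod :=
  match s with
  | MNode false y a b =>
      if op_le x y then
        \sum_(z <- right_ops x y) nodeN y << a >> (mul z b t)
        - \sum_(z <- lower_ops x y) nodeN x (mul z a b) << t >>
      else << MNode false x s t >>
  | _ => << MNode false x s t >>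
  end.

Definition mulN (x : op) : mmod -> mmod -> mmod := bilin (mul x).

Lemma mul_ncrit x s t : ~~ crit x s -> mul x s t = << MNode false x s t >>.
Proof. by case: s => [i|[] y a b] //= /negbTE ->. Qed.

Lemma mul_crit x y a b t : op_le x y ->
  mul x (MNode false y a b) t =
  \sum_(z <- right_ops x y) nodeN y << a >> (mul z b t)
  - \sum_(z <- lower_ops x y) nodeN x (mul z a b) << t >>.
Proof. by move=> /= ->. Qed.

Lemma critP x s : reflect (exists y a b, s = MNode false y a b /\ op_le x y) (crit x s).
Proof.
apply: (iffP idP) => [|[y [a [b [-> //]]]]].
by case: s => [i|[] y a b] //= h; exists y, a, b.
Qed.

Lemma mul_ind (P : op -> mtree -> mtree -> Prop) :
  (forall x s t, ~~ crit x s -> P x s t) ->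
  (forall x y a b t, op_le x y -> (forall z, P z a b) -> (forall z, P z b t) ->
     P x (MNode false y a b) t) ->
  forall x s t, P x s t.
Proof.
move=> P1 P2 x s; elim: s x => [i|[] y a IHa b IHb] x t; try exact: P1.
by case E: (op_le x y); [apply: P2 | apply: P1; rewrite /= E].
Qed.

Lemma lower_ops_nle x y z : op_le x y -> z \in lower_ops x y -> ~~ op_le x z.
Proof. by case: x y z => [[] []] [[] []] [[] []]. Qed.

(** In [left_ops x y], an operation [z] other than [y] differs from [y] only at coordinates
where [x] and [y] are maximal, and is smaller there. *)
Lemma lower_ops_nle_above x y z p : op_le x y -> z \in lower_ops x y -> ~~ op_le y p ->
  op_le z p -> ~~ op_le x p.
Proof. by case: x y z p => [[] []] [[] []] [[] []] [[] []]. Qed.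

Definition has_root (Q : op -> Prop) (t : mtree) :=
  exists x l r, t = MNode false x l r /\ Q x.

Lemma nodeN_root (Q : op -> Prop) x c d : Q x -> span (has_root Q) (nodeN x c d).
Proof.
move=> Qx; apply: span_bilin (spanT c) (spanT d) _ => s t _ _.
by apply: spanU; exists x, s, t.
Qed.

Lemma mul_root x s t :
  span (has_root (fun y => y = x \/ (crit x s /\ exists a b, s = MNode false y a b))) (mul x s t).
Proof.
case: (boolP (crit x s)) => [/critP[y [a [b [-> xy]]]]|h].
  rewrite mul_crit //; apply: spanB; apply: span_sum => z _; apply: nodeN_root; last by left.
  by right; split=> //; exists a, b.
by rewrite mul_ncrit //; apply: spanU; exists x, s, t; split=> //; left.
Qed.

(** A root of a product [a z b] is [z] or the root of [a], and neither of them is above [x]. *)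
Lemma mul_lower x y z a b : op_le x y -> z \in lower_ops x y -> ~~ crit y a ->
  span (fun t => ~~ crit x t) (mul z a b).
Proof.
move=> xy hz ya; apply: span_sub (mul_root z a b) => t [w [l [r [-> hw]]]] /=.
case: hw ya => [->|[/critP[p [c [d [-> zp]]]] [c' [d' [<- _ _]]]]] /= ya.
  exact: lower_ops_nle xy hz.
exact: lower_ops_nle_above xy hz ya zp.
Qed.

Lemma mul_normal x s t : normal s -> normal t -> span normal (mul x s t).
Proof.
move: x s t; apply: mul_ind => [x s t h|x y a b t xy IHa IHb] /=.
  by move=> ns nt; rewrite mul_ncrit //; apply: spanU => /=; rewrite ns nt.
case/and3P=> na nb ya nt; rewrite -[X in span _ X]/(mul x (MNode false y a b) t) mul_crit //.
apply: spanB; apply: span_sum => z hz.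
  apply: span_bilin (spanU (Q := eq a) _) (IHb z nb nt) _ => // _ u <- nu.
  by apply: spanU => /=; rewrite na nu.
pose Q u := normal u && ~~ crit x u.
have hQ : span Q (mul z a b).
  have /span_domP/allP h1 := IHa z na nb.
  have /span_domP/allP h2 := mul_lower b xy hz ya.
  by apply/span_domP/allP => u hu; rewrite /Q h1 ?h2.
apply: span_bilin hQ (spanU (Q := eq t) _) _ => // u _ /andP[nu xu] <-.
by apply: spanU => /=; rewrite nu nt.
Qed.

Lemma mulN_normal x c d : span normal c -> span normal d -> span normal (mulN x c d).
Proof. by move=> hc hd; apply: span_bilin hc hd _ => s t; exact: mul_normal. Qed.

(** * The relations of quadri-algebras on normal trees *)

Definition lhs_pairs (x y : op) : seq (op * op) := [seq (x, z) | z <- left_ops x y].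
Definition rhs_pairs (x y : op) : seq (op * op) := [seq (y, z) | z <- right_ops x y].

(** The two sides of an identity are given by the pairs (outer operation, inner operation)
that occur in them. *)
Definition assoc_rel (L R : seq (op * op)) (a b c : mmod) : Prop :=
  \sum_(p <- L) mulN p.1 (mulN p.2 a b) c = \sum_(p <- R) mulN p.1 a (mulN p.2 b c).

Definition quad_rel x y := assoc_rel (lhs_pairs x y) (rhs_pairs x y).

Lemma quad_relE x y a b c : quad_rel x y a b c <->
  mulN x (\sum_(z <- left_ops x y) mulN z a b) c =
  mulN y a (\sum_(z <- right_ops x y) mulN z b c).
Proof. by rewrite /quad_rel /assoc_rel !big_map [X in _ <-> X = _]bilin_suml [X in _ <-> _ = X]bilin_sumr. Qed.

Lemma perm_left_ops x y : op_le x y -> perm_eq (left_ops x y) (y :: lower_ops x y).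
Proof. by case: x y => [[] []] [[] []]. Qed.

Lemma sum_left_ops x y (M : zmodType) (F : op -> M) : op_le x y ->
  \sum_(z <- left_ops x y) F z = F y + \sum_(z <- lower_ops x y) F z.
Proof. by move=> /perm_left_ops h; rewrite (perm_big _ h) big_cons. Qed.

Lemma assoc_rel_basis (Q : mtree -> Prop) L R a b c : span Q a ->
  (forall s t u, Q s -> assoc_rel L R << s >> << t >> << u >>) -> assoc_rel L R a b c.
Proof.
rewrite /assoc_rel => + h.
elim/span_ind => [|a1 a2 h1 h2|s Qs].
- by rewrite !big1 // => p _; rewrite /mulN ?bilin0l.
- transitivity (\sum_(p <- L) mulN p.1 (mulN p.2 a1 b) c - \sum_(p <- L) mulN p.1 (mulN p.2 a2 b) c).
    by rewrite -sumrB; apply: eq_bigr => p _; rewrite /mulN !bilinBl.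
  by rewrite h1 h2 -sumrB; apply: eq_bigr => p _; rewrite /mulN !bilinBl.
elim/freeg_indB: b => [|b1 b2 h1 h2|t].
- by rewrite !big1 // => p _; rewrite /mulN ?(bilin0l, bilin0r).
- transitivity (\sum_(p <- L) mulN p.1 (mulN p.2 << s >> b1) c
                - \sum_(p <- L) mulN p.1 (mulN p.2 << s >> b2) c).
    by rewrite -sumrB; apply: eq_bigr => p _; rewrite /mulN !(bilinBl, bilinBr).
  by rewrite h1 h2 -sumrB; apply: eq_bigr => p _; rewrite /mulN !(bilinBl, bilinBr).
elim/freeg_indB: c => [|c1 c2 h1 h2|u]; last exact: h.
- by rewrite !big1 // => p _; rewrite /mulN ?(bilin0l, bilin0r).
transitivity (\sum_(p <- L) mulN p.1 (mulN p.2 << s >> << t >>) c1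
              - \sum_(p <- L) mulN p.1 (mulN p.2 << s >> << t >>) c2).
  by rewrite -sumrB; apply: eq_bigr => p _; rewrite /mulN !(bilinBl, bilinBr).
by rewrite h1 h2 -sumrB; apply: eq_bigr => p _; rewrite /mulN !(bilinBl, bilinBr).
Qed.

(** Here the product of [a] and [b] for [y] is a single tree, and the relation is the defining
equation of [mul] for it. *)
Lemma quad_rel_ncrit x y a b c : op_le x y ->
  span (fun t => ~~ crit y t) a -> quad_rel x y a b c.
Proof.
move=> xy /assoc_rel_basis; apply=> s t u ys.
apply/quad_relE; rewrite sum_left_ops // /mulN.
under eq_bigr do rewrite bilinU.
under [in RHS]eq_bigr do rewrite bilinU.
rewrite bilinU mul_ncrit // bilinDl bilinU mul_crit //.
rewrite bilin_suml bilin_sumr.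
rewrite -[RHS]addr0 -addrA; congr (_ + _).
  apply: eq_bigr => z _; rewrite bilinUl /nodeN bilinUl.
  by apply: fglin_eq => v; rewrite mul_ncrit.
rewrite addrC; apply/eqP; rewrite subr_eq0; apply/eqP.
rewrite big_seq [RHS]big_seq; apply: eq_bigr => z hz; rewrite bilinUr /nodeN bilinUr.
apply: fglin_eq_span (mul_lower t xy hz ys) _ => v hv; exact: mul_ncrit.
Qed.

Definition all_ops : seq op := [seq (i, j) | i <- [:: false; true], j <- [:: false; true]].

Definition rel_pairs : seq (op * op) :=
  [seq p <- [seq (x, y) | x <- all_ops, y <- all_ops] | op_le p.1 p.2].

(** Whether an identity is a sum of relations depends on the pairs of operations only; it
is decided by collecting the relations whose left hand sides occur. *)
Definition sum_of_rels (L R : seq (op * op)) : bool :=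
  let S := [seq p <- rel_pairs | all (mem L) (lhs_pairs p.1 p.2)] in
  perm_eq L (flatten [seq lhs_pairs p.1 p.2 | p <- S]) &&
  perm_eq R (flatten [seq rhs_pairs p.1 p.2 | p <- S]).

Lemma sum_of_relsP L R a b c : sum_of_rels L R ->
  (forall x y, op_le x y -> quad_rel x y a b c) -> assoc_rel L R a b c.
Proof.
move=> /andP[hL hR] h; rewrite /assoc_rel (perm_big _ hL) (perm_big _ hR).
rewrite !big_flatten !big_map big_seq [RHS]big_seq.
apply: eq_bigr => -[x y]; rewrite mem_filter => /andP[_]; rewrite mem_filter => /andP[xy _].
exact: h xy.
Qed.

(** For a chain [x <= y <= p], these are the operations in the middle of the identity
[(a Y b) X c = a Z (b M c)], where [Y], [X] and [Z] are the sums of [left_ops y p],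
[left_ops x y] and [left_ops x p].  In one coordinate it is a relation of dendriform
algebras or, if the chain is constant, the associativity of the sum of both operations. *)
Definition mid_ops (x y p : op) : seq op :=
  let f (i j k : bool) := if i != j then [:: true] else if j != k then [:: false]
                          else [:: false; true] in
  [seq (i, j) | i <- f x.1 y.1 p.1, j <- f x.2 y.2 p.2].

Definition pairs (s t : seq op) : seq (op * op) := [seq (x, y) | x <- s, y <- t].

Lemma sum_of_rels_left x y p : op_le x y -> op_le y p ->
  sum_of_rels (pairs (left_ops x y) (left_ops y p)) (pairs (left_ops x p) (mid_ops x y p)).
Proof. by case: x y p => [[] []] [[] []] [[] []]. Qed.

Lemma sum_of_rels_right x y p : op_le x y -> op_le y p ->
  sum_of_rels (pairs (right_ops x p) (mid_ops x y p)) (pairs (right_ops y p) (right_ops x y)).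
Proof. by case: x y p => [[] []] [[] []] [[] []]. Qed.

Definition mulS (s : seq op) (a b : mmod) : mmod := \sum_(z <- s) mulN z a b.

Lemma assoc_pairs s t s' t' a b c : assoc_rel (pairs s t) (pairs s' t') a b c <->
  mulS s (mulS t a b) c = mulS s' a (mulS t' b c).
Proof.
rewrite /assoc_rel /mulS !big_allpairs_dep /=.
under [X in _ <-> X = _]eq_bigr do rewrite /mulN bilin_suml.
by under [X in _ <-> _ = X]eq_bigr do rewrite /mulN bilin_sumr.
Qed.

Lemma quad_relS x y a b c : quad_rel x y a b c <->
  mulN x (mulS (left_ops x y) a b) c = mulN y a (mulS (right_ops x y) b c).
Proof. exact: quad_relE. Qed.

(** This resolves the critical pair [((u p v) y b) x c] of a chain [x <= y <= p].  Both sides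
are equal to [u p (v Q (b R c))], where [Q] and [R] are the sums of [right_ops y p] and
[right_ops x y]. *)
Lemma mulS_assoc_chain x y p u v b c : op_le x y -> op_le y p ->
  (forall x y b c, op_le x y -> quad_rel x y u b c) ->
  (forall x y b c, op_le x y -> quad_rel x y v b c) ->
  mulN x (mulS (left_ops x y) (mulS (left_ops y p) u v) b) c =
  mulN y (mulS (left_ops y p) u v) (mulS (right_ops x y) b c).
Proof.
move=> xy yp hu hv.
have xp : op_le x p by move: xy yp; case: x y p {hu hv} => [[] []] [[] []] [[] []].
rewrite (proj1 (assoc_pairs _ _ (left_ops x p) (mid_ops x y p) _ _ _)); last first.
  by apply: sum_of_relsP (sum_of_rels_left xy yp) _ => *; exact: hu.
rewrite (proj1 (quad_relS y p u v _) (hu _ _ _ _ yp)) (proj1 (quad_relS x p u _ c) (hu _ _ _ _ xp)).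
congr mulN; apply/assoc_pairs.
by apply: sum_of_relsP (sum_of_rels_right xy yp) _ => *; exact: hv.
Qed.

(** Confluence of the rewriting rules.  For a normal tree [a = u p v] and [x <= y <= p], the
relation is obtained from the one for the sum of the products of [u] and [v] over
[left_ops y p], which follows from the relations for [u] and [v]; the products other than
[a] itself satisfy it by [quad_rel_ncrit]. *)
Lemma quad_rel_normal x y a b c : op_le x y -> span normal a -> quad_rel x y a b c.
Proof.
move=> xy /assoc_rel_basis; apply=> {a b c} s t u ns.
elim: s ns x y xy << t >> << u >> => [i _|m p l IHl r IHr ns] x y xy b c.
  by apply: quad_rel_ncrit xy _; exact: spanU.
case: (boolP (crit y (MNode m p l r))) => [|h]; last by apply: quad_rel_ncrit xy _; exact: spanU.
case: m ns => //= /and3P[/IHl hl /IHr hr plr] yp.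
have := mulS_assoc_chain b c xy yp (fun x y b c h => hl x y h b c) (fun x y b c h => hr x y h b c).
rewrite [mulS (left_ops y p) _ _]/mulS sum_left_ops //.
have -> : mulN p << l >> << r >> = << MNode false p l r >> by rewrite /mulN bilinU mul_ncrit.
set a := << _ >>; set w := \sum_(z <- _) _ => E.
have W : quad_rel x y w b c.
  apply: quad_rel_ncrit xy _; rewrite /w big_seq; apply: big_ind => [||z hz]; [exact: span0|exact: spanD|].
  by rewrite /mulN bilinU; exact: mul_lower yp hz plr.
move/quad_relS: W => W; apply/quad_relS.
(* The relation for [a + w] holds by [E] and the one for [w] by [W]. *)
have mulSD s d e f : mulS s (d + e) f = mulS s d f + mulS s e f.
  by rewrite /mulS -big_split; apply: eq_bigr => z _; rewrite /mulN bilinDl.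
by move: E; rewrite mulSD /mulN !bilinDl -!/(mulN _ _ _) W => /addIr.
Qed.

(** * Signs *)

Section Sign.
Variable M : zmodType.
Implicit Types (k l : nat) (v : M).

Definition sgn k v := if odd k then - v else v.

Lemma sgnD k l v : sgn (k + l) v = sgn k (sgn l v).
Proof. by rewrite /sgn oddD; case: (odd k); case: (odd l); rewrite //= opprK. Qed.
Lemma sgnK k v : sgn k (sgn k v) = v.
Proof. by rewrite /sgn; case: (odd k); rewrite ?opprK. Qed.
Lemma sgn_mod2 k l v : odd k = odd l -> sgn k v = sgn l v.
Proof. by rewrite /sgn => ->. Qed.
Lemma sgnS k v : sgn k.+1 v = - sgn k v.
Proof. by rewrite /sgn /=; case: (odd k); rewrite ?opprK. Qed.
Lemma sgnr0 k : sgn k 0 = 0.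
Proof. by rewrite /sgn oppr0 if_same. Qed.
Lemma sgnB k v w : sgn k (v - w) = sgn k v - sgn k w.
Proof. by rewrite /sgn; case: (odd k); rewrite ?opprB 1?addrC ?opprK. Qed.
Lemma sgnDr k v w : sgn k (v + w) = sgn k v + sgn k w.
Proof. by rewrite /sgn; case: (odd k); rewrite ?opprD. Qed.
Lemma sgn_sum k (I : Type) (s : seq I) (P : pred I) F :
  sgn k (\sum_(i <- s | P i) F i : M) = \sum_(i <- s | P i) sgn k (F i).
Proof. by rewrite /sgn; case: (odd k); rewrite ?sumrN. Qed.

End Sign.

Lemma fglin_sgn (K : choiceType) (M : zmodType) (f : K -> M) k c :
  fglin f (sgn k c) = sgn k (fglin f c).
Proof. by rewrite /sgn; case: (odd k); rewrite ?fglinN. Qed.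

Lemma fglin_sgnf (K : choiceType) (M : zmodType) (f : K -> M) k c :
  fglin (fun x => sgn k (f x)) c = sgn k (fglin f c).
Proof.
by elim/freeg_indB: c => [|c c' h h'|x]; rewrite ?fglinU // ?fglin0 ?fglinB ?h ?h' -?sgnB ?sgnr0.
Qed.

Lemma span_sgn (K : choiceType) (Q : K -> Prop) k c : span Q c -> span Q (sgn k c).
Proof. by rewrite /sgn; case: (odd k) => //; exact: spanN. Qed.

Lemma freegU_sgn (K : choiceType) k (x : K) : << (-1) ^+ k *g x >> = sgn k << x >> :> {freeg K}.
Proof. by rewrite -signr_odd /sgn; case: (odd k) => /=; rewrite ?expr0 // expr1 -freegUN. Qed.

(** * Morphisms of quadri-algebras *)

Section Morphism.
Variable f : mtree -> mmod.
Hypothesis f_node : forall x l r, f (MNode false x l r) = mulN x (f l) (f r).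
Hypothesis f_normal : forall t, span normal (f t).

Lemma morph_nodeN x c d : fglin f (nodeN x c d) = mulN x (fglin f c) (fglin f d).
Proof.
rewrite /nodeN /mulN.
elim/freeg_indB: c => [|c c' h h'|s].
- by rewrite !(bilin0l, fglin0).
- by rewrite !(bilinBl, fglinB) h h'.
elim/freeg_indB: d => [|d d' h h'|t].
- by rewrite !(bilin0r, fglin0).
- by rewrite !(bilinBr, fglinB) h h'.
by rewrite bilinU !fglinU f_node.
Qed.

(** In the recursion for [mul], the images of both sides satisfy the same relation. *)
Lemma morph_mul x s t : fglin f (mul x s t) = mulN x (f s) (f t).
Proof.
move: x s t; apply: mul_ind => [x s t h|x y a b t xy IHa IHb].
  by rewrite mul_ncrit // fglinU f_node.
rewrite mul_crit // fglinB !fglin_sum.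
under eq_bigr do rewrite morph_nodeN fglinU IHb.
under [X in _ - X]eq_bigr do rewrite morph_nodeN fglinU IHa.
rewrite f_node; have := quad_rel_normal (f b) (f t) xy (f_normal a).
move/quad_relE; rewrite sum_left_ops // /mulN bilinDl bilin_suml [in X in _ = X]bilin_sumr => <-.
by rewrite addrK.
Qed.

Lemma morph_mulN x c d : fglin f (mulN x c d) = mulN x (fglin f c) (fglin f d).
Proof.
rewrite /mulN.
elim/freeg_indB: c => [|c c' h h'|s].
- by rewrite !(bilin0l, fglin0).
- by rewrite !(bilinBl, fglinB) h h'.
elim/freeg_indB: d => [|d d' h h'|t].
- by rewrite !(bilin0r, fglin0).
- by rewrite !(bilinBr, fglinB) h h'.
by rewrite bilinU !fglinU morph_mul.
Qed.

End Morphism.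

(** * Leaves, keys of marked vertices and normal forms *)

(** A vertex of a tree is identified by the set of the leaves above it.  The code of this set
also gives an order of the vertices that is independent of the planar structure. *)
Definition key (s : seq nat) : nat := pickle (sort leq s).

Arguments key : simpl never.

Definition key_set (A : nat) : seq nat := odflt [::] (unpickle A).

Arguments key_set : simpl never.

Lemma key_setK s : key_set (key s) =i s.
Proof. by move=> i; rewrite /key_set /key pickleK /= mem_sort. Qed.

Lemma key_perm s s' : perm_eq s s' -> key s = key s'.
Proof. by move/(perm_sortP leq_total leq_trans anti_leq) => h; rewrite /key h. Qed.

Fixpoint mleaves (t : mtree) : seq nat :=
  match t with MLeaf i => [:: i] | MNode _ _ l r => mleaves l ++ mleaves r end.

Fixpoint mkeys (t : mtree) : seq nat :=
  match t with
  | MLeaf _ => [::]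
  | MNode b _ l r =>
      (if b then [:: key (mleaves l ++ mleaves r)] else [::]) ++ mkeys l ++ mkeys r
  end.

Definition mark (t : mtree) : mtree := if t is MNode _ x l r then MNode true x l r else t.
Definition markN : mmod -> mmod := fglin (fun t => << mark t >>).

Definition is_unode (t : mtree) : bool := if t is MNode false _ _ _ then true else false.

Lemma mul_unode x s t : span is_unode (mul x s t).
Proof. by apply: span_sub (mul_root x s t) => u [y [l [r [->]]]]. Qed.

Lemma mulN_unode x c d : span is_unode (mulN x c d).
Proof. by apply: span_bilin (spanT c) (spanT d) _ => s t _ _; apply: mul_unode. Qed.

Section Statistic.
Variables (T : Type) (phi : mtree -> seq T).
Hypothesis phi_node : forall x l r, phi (MNode false x l r) = phi l ++ phi r.

(** The recursion for [mul] moves parentheses, but keeps the order of the factors. *)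
Lemma mul_stat x s t : span (fun u => phi u = phi s ++ phi t) (mul x s t).
Proof.
move: x s t; apply: mul_ind => [x s t h|x y a b t xy IHa IHb].
  by rewrite mul_ncrit //; apply: spanU; rewrite phi_node.
rewrite mul_crit //; apply: spanB; apply: span_sum => z _.
  apply: span_bilin (spanU (Q := eq a) _) (IHb z) _ => // _ u <- h.
  by apply: spanU; rewrite !phi_node h catA.
apply: span_bilin (IHa z) (spanU (Q := eq t) _) _ => // u _ h <-.
by apply: spanU; rewrite !phi_node h.
Qed.

Lemma mulN_stat x c d (s s' : seq T) :
  span (fun u => phi u = s) c -> span (fun u => phi u = s') d ->
  span (fun u => phi u = s ++ s') (mulN x c d).
Proof. by move=> hc hd; apply: span_bilin hc hd _ => a b <- <-; exact: mul_stat. Qed.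

End Statistic.

Fixpoint nf (t : mtree) : mmod :=
  match t with
  | MLeaf _ => << t >>
  | MNode b x l r => let c := mulN x (nf l) (nf r) in if b then markN c else c
  end.

Lemma markN_span (Q Q' : mtree -> Prop) c :
  (forall t, Q t -> Q' (mark t)) -> span Q c -> span Q' (markN c).
Proof. by move=> h hc; apply: span_fglin hc _ => t Qt; apply: spanU; exact: h. Qed.

Lemma normal_mark t : normal (mark t) = normal t. Proof. by case: t. Qed.
Lemma mleaves_mark t : mleaves (mark t) = mleaves t. Proof. by case: t. Qed.

Lemma nf_normal t : span normal (nf t).
Proof.
elim: t => [i|b x l hl r hr] /=; first exact: spanU.
have := mulN_normal x hl hr; case: b => //.
by apply: markN_span => t; rewrite normal_mark.
Qed.

Lemma nf_leaves t : span (fun u => mleaves u = mleaves t) (nf t).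
Proof.
elim: t => [i|b x l hl r hr] /=; first exact: spanU.
have := mulN_stat (phi := mleaves) (fun _ _ _ => erefl) x hl hr; case: b => //.
by apply: markN_span => t; rewrite mleaves_mark.
Qed.

Lemma nf_keys t : span (fun u => mkeys u = mkeys t) (nf t).
Proof.
elim: t => [i|b x l hl r hr] /=; first exact: spanU.
have h := mulN_stat (phi := mkeys) (fun _ _ _ => erefl) x hl hr; case: b => //=.
have h' := mulN_stat (phi := mleaves) (fun _ _ _ => erefl) x (nf_leaves l) (nf_leaves r).
apply: markN_span (spanI (spanI h h') (mulN_unode _ _ _)) => -[i|[] y a b] [[hk hm] //= _].
by move: hk hm => /= -> ->.
Qed.

Lemma nf_unmarked t : unmarked t -> span unmarked (nf t).
Proof.
case: t => [i|[] x l r] //= _; first exact: spanU.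
by apply: span_sub (mulN_unode _ _ _) => -[i|[]].
Qed.

Lemma nf_id t : normal t -> nf t = << t >>.
Proof.
elim: t => [i|b x l hl r hr] //= /and3P[/hl -> /hr -> h].
by rewrite /mulN bilinU mul_ncrit // /markN fglinU; case: b.
Qed.

(** * Removal of a mark *)

Fixpoint unm (A : nat) (t : mtree) : mtree :=
  match t with
  | MLeaf _ => t
  | MNode b x l r => MNode (b && (key (mleaves l ++ mleaves r) != A)) x (unm A l) (unm A r)
  end.

Definition unmark (A : nat) (t : mtree) : mmod := nf (unm A t).

Lemma mleaves_unm A t : mleaves (unm A t) = mleaves t.
Proof. by elim: t => //= b x l -> r ->. Qed.

Lemma mkeys_unm A t : mkeys (unm A t) = [seq B <- mkeys t | B != A].
Proof.
elim: t => //= b x l -> r ->; rewrite !filter_cat !mleaves_unm.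
by congr (_ ++ _); case: b => //=; case: eqP.
Qed.

Lemma unm_unmarked A t : unmarked t -> unmarked (unm A t).
Proof. by case: t => //= -[]. Qed.

Lemma unm_id A t : A \notin mkeys t -> unm A t = t.
Proof.
elim: t => //= b x l hl r hr; rewrite !mem_cat !negb_or => /and3P[h /hl -> /hr ->].
by case: b h => //=; rewrite inE eq_sym => ->.
Qed.

Lemma unmC A B t : unm A (unm B t) = unm B (unm A t).
Proof. by elim: t => //= b x l -> r ->; rewrite !mleaves_unm; case: b => //=; rewrite andbC. Qed.

Lemma unmark_mulN A x c d :
  fglin (unmark A) (mulN x c d) = mulN x (fglin (unmark A) c) (fglin (unmark A) d).
Proof. by apply: morph_mulN => // t; exact: nf_normal. Qed.

Lemma unmark_mark A t : is_unode t ->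
  unmark A (mark t) = if key (mleaves t) == A then unmark A t else markN (unmark A t).
Proof. by case: t => // -[] //= x l r _; rewrite /unmark /= ; case: eqP. Qed.

Lemma unmark_markN A K c : span is_unode c -> span (fun t => key (mleaves t) = K) c ->
  fglin (unmark A) (markN c) =
  if K == A then fglin (unmark A) c else markN (fglin (unmark A) c).
Proof.
move=> h1 h2; rewrite /markN fglin_comp.
transitivity (fglin (fun t => if K == A then unmark A t else markN (unmark A t)) c).
  apply: fglin_eq_span (spanI h1 h2) _ => t [h <-].
  by rewrite fglinU unmark_mark.
by case: eqP => // _; rewrite fglin_comp; apply: fglin_eq.
Qed.

(** [unmark A] is a morphism of quadri-algebras. *)
Lemma unmark_nf A t : fglin (unmark A) (nf t) = nf (unm A t).
Proof.
elim: t => [i|b x l IHl r IHr] /=; first by rewrite fglinU.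
have E : fglin (unmark A) (mulN x (nf l) (nf r)) = mulN x (nf (unm A l)) (nf (unm A r)).
  by rewrite unmark_mulN IHl IHr.
case: b => //=; rewrite (@unmark_markN A (key (mleaves l ++ mleaves r))) ?E; first by case: eqP.
  exact: mulN_unode.
apply: span_sub (mulN_stat (phi := mleaves) _ x (nf_leaves l) (nf_leaves r)) => // t ->.
by [].
Qed.

Lemma unmarkC A B t : fglin (unmark A) (unmark B t) = fglin (unmark B) (unmark A t).
Proof. by rewrite {2 4}/unmark !unmark_nf unmC. Qed.

(** * The complex of marked trees *)

Definition rank (A : nat) (s : seq nat) : nat := count (fun B => (B < A)%N) s.

Definition dmark (t : mtree) : mmod :=
  \sum_(A <- mkeys t) sgn (rank A (mkeys t)) (unmark A t).
Definition dmarkN : mmod -> mmod := fglin dmark.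

Lemma rank_filter A B s : uniq s -> A \in s ->
  (rank B [seq C <- s | C != A] + (A < B))%N = rank B s.
Proof.
move=> us As; have /seq.permP := perm_to_rem As; rewrite rem_filter // /rank => -> /=.
by rewrite addnC.
Qed.

(** Deleting [A] changes the rank of [B] by one exactly if [A < B]; hence the two terms for
a pair of distinct entries have opposite signs. *)
Lemma alternating_sum (M : zmodType) (s : seq nat) (F : nat -> nat -> M) : uniq s ->
  (forall A B, F A B = F B A) ->
  \sum_(A <- s) \sum_(B <- s | B != A) sgn (rank A s + rank B [seq C <- s | C != A]) (F A B) = 0.
Proof.
move=> us FC.
pose G A B := sgn (rank A s + rank B [seq C <- s | C != A]) (F A B).
have GN A B : A \in s -> B \in s -> (B < A)%N -> G B A = - G A B.
  move=> As Bs AB; rewrite /G FC -sgnS; apply: sgn_mod2.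
  have := rank_filter B us As; have := rank_filter A us Bs; rewrite AB.
  have -> : (A < B)%N = false by lia.
  by rewrite addn0 addn1 => <- <-; rewrite addSn /= negbK addnC.
transitivity (\sum_(A <- s) (\sum_(B <- s | (B < A)%N) G A B + \sum_(B <- s | (A < B)%N) G A B)).
  apply: eq_bigr => A _; rewrite (bigID (fun B => (B < A)%N)) /=.
  by congr (_ + _); apply: eq_bigl => B; lia.
rewrite big_split /= [X in _ + X](exchange_big_dep xpredT) //= -big_split /=.
rewrite big_seq big1 // => A As; rewrite -big_split /= big_seq_cond big1 // => B /andP[Bs BA].
by rewrite (GN A B) // subrr.
Qed.

Lemma mleaves_gt0 t : (0 < size (mleaves t))%N.
Proof. by elim: t => //= b x l hl r hr; rewrite size_cat; lia. Qed.

Lemma mleaves_mem t : exists i, i \in mleaves t.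
Proof.
by elim: t => [i|b x l [i hi] r _]; exists i => /=; rewrite ?inE ?mem_cat ?hi ?eqxx.
Qed.

(** This separates the keys of different vertices: a leaf above one of them is not above the
other. *)
Lemma key_subset t A : A \in mkeys t ->
  {subset key_set A <= mleaves t} /\ exists i, i \in key_set A.
Proof.
elim: t A => //= b x l hl r hr A; rewrite !mem_cat => /or3P[].
- case: b => //; rewrite inE => /eqP ->; split=> [i|]; first by rewrite key_setK.
  by have [i hi] := mleaves_mem l; exists i; rewrite key_setK mem_cat hi.
- by case/hl => h1 h2; split=> // i /h1 hi; rewrite mem_cat hi.
by case/hr => h1 h2; split=> // i /h1 hi; rewrite mem_cat hi orbT.
Qed.

Lemma uniq_cat_disj (s s' : seq nat) i : uniq (s ++ s') -> i \in s -> i \in s' -> False.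
Proof. by rewrite cat_uniq => /and3P[_ /hasPn h _] hs /h; rewrite hs. Qed.

Lemma uniq_mkeys t : uniq (mleaves t) -> uniq (mkeys t).
Proof.
elim: t => //= b x l hl r hr u; have ul : uniq (mleaves l) by move: u; rewrite cat_uniq => /andP[].
have ur : uniq (mleaves r) by move: u; rewrite cat_uniq => /and3P[].
have [i il] := mleaves_mem l; have [j jr] := mleaves_mem r.
have lr : uniq (mkeys l ++ mkeys r).
  rewrite cat_uniq hl // hr // andbT; apply/hasPn => A Ar; apply/negP => Al.
  have [sl [k kA]] := key_subset Al; have [sr _] := key_subset Ar.
  exact: uniq_cat_disj u (sl _ kA) (sr _ kA).
case: b => //=; rewrite lr andbT mem_cat; apply/negP => /orP[] /key_subset[h _].
  have jl : j \in mleaves l by apply: h; rewrite key_setK mem_cat jr orbT.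
  exact: uniq_cat_disj u jl jr.
have ir : i \in mleaves r by apply: h; rewrite key_setK mem_cat il.
exact: uniq_cat_disj u il ir.
Qed.

Definition marked_basis (n d : nat) (t : mtree) : Prop :=
  [/\ normal t, unmarked t, perm_eq (mleaves t) (iota 0 n) & size (mkeys t) = d].

Lemma marked_basis_uniq n d t : marked_basis n d t -> uniq (mkeys t).
Proof. by case=> _ _ h _; apply: uniq_mkeys; rewrite (perm_uniq h) iota_uniq. Qed.

Lemma unmark_span A t :
  span (fun u => [/\ normal u, mleaves u = mleaves t & mkeys u = [seq B <- mkeys t | B != A]])
    (unmark A t).
Proof.
have := spanI (nf_normal (unm A t)) (spanI (nf_leaves (unm A t)) (nf_keys (unm A t))).
by apply: span_sub => u [? []]; rewrite mleaves_unm mkeys_unm.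
Qed.

Lemma dmarkK t : uniq (mkeys t) -> dmarkN (dmark t) = 0.
Proof.
move=> ut; rewrite /dmark /dmarkN fglin_sum.
rewrite -[RHS](alternating_sum ut (F := fun A B => fglin (unmark B) (unmark A t))); last first.
  by move=> A B; exact: unmarkC.
rewrite big_seq [RHS]big_seq; apply: eq_bigr => A At; rewrite fglin_sgn.
pose s := [seq C <- mkeys t | C != A].
rewrite (fglin_eq_span (g := fun u => \sum_(B <- s) sgn (rank B s) (unmark B u)) (unmark_span A t)); last first.
  by move=> u [_ _ ku]; rewrite /dmark ku.
rewrite fglin_sumf sgn_sum big_filter; apply: eq_bigr => B BA.
by rewrite sgnD fglin_sgnf.
Qed.

(** * Normalisation lowers a weight *)

Definition op_rank (x : op) : nat := x.1 + x.2.

(** Rewriting [(a y b) x c] into [a y (b z c)] lowers the sum of the sizes of the left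
subtrees by the size of [a].  The factor 4 makes this outweigh the ranks of the
operations, which are at most 2. *)
Fixpoint wt (t : mtree) : nat :=
  match t with
  | MLeaf _ => 0
  | MNode _ x l r => wt l + wt r + 4 * size (mleaves l) + op_rank x
  end.

Definition no_heavier (t u : mtree) : Prop := mleaves u = mleaves t /\ (wt u <= wt t)%N.

Lemma lower_ops_rank x y z : op_le x y -> z \in lower_ops x y -> (op_rank z < op_rank y)%N.
Proof. by case: x y z => [[] []] [[] []] [[] []]. Qed.

Lemma op_rank_le2 (x : op) : (op_rank x <= 2)%N. Proof. by case: x => [[] []]. Qed.

Lemma mul_lighter x s t : crit x s ->
  span (fun u => (wt u < wt (MNode false x s t))%N) (mul x s t).
Proof.
suff: span (fun u => no_heavier (MNode false x s t) u /\
               (crit x s -> (wt u < wt (MNode false x s t))%N)) (mul x s t).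
  by move=> h xs; apply: span_sub h => u [_ /(_ xs)].
move: x s t; apply: mul_ind => [x s t h|x y a b t xy IHa IHb].
  by rewrite mul_ncrit //; apply: spanU; rewrite (negbTE h).
rewrite mul_crit // big_seq [X in _ - X]big_seq.
apply: spanB; (apply: big_ind => [||z hz]; [exact: span0 | exact: spanD |]).
  apply: span_bilin (spanU (Q := eq a) _) (IHb z) _ => // _ u <- [[/= lu wu] _].
  apply: spanU; have hz2 := op_rank_le2 z; have ha := mleaves_gt0 a.
  by split=> [|_]; rewrite /no_heavier /= ?lu ?catA // size_cat; [split=> //|]; lia.
apply: span_bilin (IHa z) (spanU (Q := eq t) _) _ => // u _ [[/= lu wu] _] <-.
apply: spanU; have hz2 := lower_ops_rank xy hz.
by split=> [|_]; rewrite /no_heavier /= ?lu // size_cat; [split=> //|]; lia.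
Qed.

Lemma mul_no_heavier x s t : span (no_heavier (MNode false x s t)) (mul x s t).
Proof.
have hl := mul_stat (phi := mleaves) (fun _ _ _ => erefl) x s t.
case: (boolP (crit x s)) => [/(mul_lighter t) h|h].
  by apply: span_sub (spanI hl h) => u [? /ltnW].
by rewrite mul_ncrit //; apply: spanU.
Qed.

Lemma wt_mark t : wt (mark t) = wt t. Proof. by case: t. Qed.

Lemma nf_no_heavier t : span (no_heavier t) (nf t).
Proof.
elim: t => [i|b x l hl r hr] /=; first exact: spanU.
have h : span (no_heavier (MNode b x l r)) (mulN x (nf l) (nf r)).
  apply: span_bilin hl hr _ => s t [ls ws] [lt wt'].
  apply: span_sub (mul_no_heavier x s t) => u [/= lu wu].
  by split; rewrite /= ?lu ?ls ?lt //; move: wu; rewrite ls; lia.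
case: b h => // h; apply: markN_span h => t.
by rewrite /no_heavier mleaves_mark wt_mark.
Qed.

Lemma nf_lighter t : ~~ normal t -> span (fun u => (wt u < wt t)%N) (nf t).
Proof.
elim: t => [//|b x l hl r hr] nt /=.
have h : span (fun u => (wt u < wt (MNode b x l r))%N) (mulN x (nf l) (nf r)).
  case: (boolP (normal l && normal r)) => [/andP[nl nr]|nlr].
    rewrite (nf_id nl) (nf_id nr) /mulN bilinU; apply: mul_lighter.
    by move: nt; rewrite /= nl nr /= negbK.
  pose Q (t u : mtree) := no_heavier t u /\ (~~ normal t -> (wt u < wt t)%N).
  have hQ (s : mtree) : (~~ normal s -> span (fun u => (wt u < wt s)%N) (nf s)) -> span (Q s) (nf s).
    case: (boolP (normal s)) => [ns _|ns /(_ isT) hs].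
      by rewrite nf_id //; apply: spanU; rewrite /Q ns.
    by apply: span_sub (spanI (nf_no_heavier s) hs) => u [].
  apply: span_bilin (hQ _ hl) (hQ _ hr) _ => s t [[ls ws] ws'] [[lt wt'] wt''].
  apply: span_sub (mul_no_heavier x s t) => u [/= lu wu].
  move: wu nlr; rewrite ls negb_and => wu /orP[/ws'|/wt'']; lia.
by case: b nt h => // _ h; apply: markN_span h => t; rewrite wt_mark.
Qed.

(** * A distinguished non-critical edge *)

(** The distinguished edge is the first one that cannot be critical on the way along the left
spine: an edge to a right child, or to a left child whose label is not above that of its
parent.  The value consists of its mark and its key. *)
Fixpoint dist (t : mtree) : option (bool * nat) :=
  match t with
  | MNode _ x l r =>
      match r, l with
      | MNode b _ _ _, _ => Some (b, key (mleaves r))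
      | _, MNode b y _ _ => if op_le x y then dist l else Some (b, key (mleaves l))
      | _, _ => None
      end
  | _ => None
  end.

Fixpoint set_dist (v : bool) (t : mtree) : mtree :=
  match t with
  | MNode b x l r =>
      match r, l with
      | MNode _ y r1 r2, _ => MNode b x l (MNode v y r1 r2)
      | _, MNode _ y l1 l2 =>
          if op_le x y then MNode b x (set_dist v l) r else MNode b x (MNode v y l1 l2) r
      | _, _ => t
      end
  | _ => t
  end.

(** This is [crit] regardless of the mark: the search for the distinguished edge goes past
such a left child. *)
Definition le_root (x : op) (t : mtree) : bool :=
  if t is MNode _ y _ _ then op_le x y else false.

Lemma dist_ind (P : mtree -> Prop) :
  (forall i, P (MLeaf i)) ->
  (forall b x i j, P (MNode b x (MLeaf i) (MLeaf j))) ->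
  (forall b x l c y r1 r2, P (MNode b x l (MNode c y r1 r2))) ->
  (forall b x c y l1 l2 i, ~~ op_le x y -> P (MNode b x (MNode c y l1 l2) (MLeaf i))) ->
  (forall b x l i, le_root x l -> P l -> P (MNode b x l (MLeaf i))) ->
  forall t, P t.
Proof.
move=> h1 h2 h3 h4 h5; elim=> // b x [i|c y l1 l2] IHl [j|c' z r1 r2] _ //.
by case: (boolP (op_le x y)) => xy; [apply: h5 | apply: h4].
Qed.

Lemma dist_deep b x l i : le_root x l -> dist (MNode b x l (MLeaf i)) = dist l.
Proof. by case: l => //= c y l1 l2 ->. Qed.

Lemma set_deep v b x l i : le_root x l ->
  set_dist v (MNode b x l (MLeaf i)) = MNode b x (set_dist v l) (MLeaf i).
Proof. by case: l => //= c y l1 l2 ->. Qed.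

Lemma le_root_set x v l : le_root x (set_dist v l) = le_root x l.
Proof. by case: l => //= c y [i|? ? ? ?] [j|? ? ? ?] //=; case: ifP. Qed.

Lemma le_root_unm x A l : le_root x (unm A l) = le_root x l.
Proof. by case: l. Qed.

Lemma mleaves_set v t : mleaves (set_dist v t) = mleaves t.
Proof.
elim/dist_ind: t => // [b x c y l1 l2 i xy|b x l i xl IH]; first by rewrite /= (negbTE xy).
by rewrite set_deep //= IH.
Qed.

Lemma set_set v w t : set_dist v (set_dist w t) = set_dist v t.
Proof.
elim/dist_ind: t => // [b x c y l1 l2 i xy|b x l i xl IH].
  by rewrite /= !(negbTE xy) /= (negbTE xy).
by rewrite !set_deep ?le_root_set // IH.
Qed.

Lemma dist_set v t : dist (set_dist v t) = omap (fun p => (v, p.2)) (dist t).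
Proof.
elim/dist_ind: t => // [b x c y l1 l2 i xy|b x l i xl IH].
  by rewrite /= !(negbTE xy) /= (negbTE xy).
by rewrite set_deep // !dist_deep ?le_root_set.
Qed.

Lemma set_dist_id v A t : dist t = Some (v, A) -> set_dist v t = t.
Proof.
elim/dist_ind: t => // [b x l c y r1 r2|b x c y l1 l2 i xy|b x l i xl IH].
- by move=> /= [->].
- by rewrite /= (negbTE xy) => -[->].
by rewrite dist_deep // set_deep // => /IH ->.
Qed.

Lemma mkeys_set A t v : dist t = Some (v, A) ->
  perm_eq (mkeys (set_dist true t)) (A :: mkeys (set_dist false t)).
Proof.
elim/dist_ind: t => // [b x l c y r1 r2|b x c y l1 l2 i xy|b x l i xl IH].
- by move=> /= [_ <-]; apply/seq.permP => p; rewrite /= !count_cat /= !count_cat /=; lia.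
- by rewrite /= (negbTE xy) => -[_ <-] /=; apply/seq.permP => p; rewrite /= !count_cat /= !count_cat /=; lia.
rewrite dist_deep // !set_deep // => /IH /seq.permP h /=; rewrite !cats0 !mleaves_set.
by apply/seq.permP => p; rewrite /= !count_cat h /=; lia.
Qed.

Lemma normal_set v t : normal t -> normal (set_dist v t).
Proof.
elim/dist_ind: t => // [b x c y l1 l2 i xy|b x l i xl IH].
  by rewrite [set_dist _ _]/= (negbTE xy) => /= /andP[-> _]; case: v => //=; rewrite xy.
rewrite set_deep //= => /andP[/IH -> /=].
have : unmarked (set_dist v l) = unmarked l.
  by case: (l) => //= c y [j|? ? ? ?] [k|? ? ? ?] //=; case: ifP.
have := le_root_set x v l; case: (l) xl => // c y l1 l2; case: (set_dist v _) => //= c' y' l1' l2'.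
by move=> -> ->; case: c; case: c'.
Qed.

Lemma unmarked_set v t : unmarked (set_dist v t) = unmarked t.
Proof. by case: t => //= c y [i|? ? ? ?] [j|? ? ? ?] //=; case: ifP. Qed.

Lemma wt_set v t : wt (set_dist v t) = wt t.
Proof.
elim/dist_ind: t => // [b x c y l1 l2 i xy|b x l i xl IH].
  by rewrite /= (negbTE xy).
by rewrite set_deep //= IH mleaves_set.
Qed.

Lemma dist_unm A t : dist (unm A t) = omap (fun p => (p.1 && (p.2 != A), p.2)) (dist t).
Proof.
elim/dist_ind: t => // [b x l c y r1 r2|b x c y l1 l2 i xy|b x l i xl IH].
- by rewrite /= !mleaves_unm.
- by rewrite /= (negbTE xy) /= !mleaves_unm.
by rewrite [unm A _]/= !dist_deep ?le_root_unm.
Qed.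

Lemma set_unm v A B w t : dist t = Some (w, A) -> A != B ->
  unm B (set_dist v t) = set_dist v (unm B t).
Proof.
move=> + AB; elim/dist_ind: t => // [b x l c y r1 r2|b x c y l1 l2 i xy|b x l i xl IH].
- by move=> /= [_ ->]; rewrite AB andbT.
- by rewrite /= (negbTE xy) => -[_ E] /=; rewrite E AB andbT.
rewrite dist_deep // set_deep // => h.
by rewrite [unm B (MNode _ _ l _)]/= set_deep ?le_root_unm //= (IH h) mleaves_set.
Qed.

Lemma unm_dist_set A v w t : dist t = Some (w, A) ->
  unm A (set_dist v t) = set_dist false (unm A t).
Proof.
elim/dist_ind: t => // [b x l c y r1 r2|b x c y l1 l2 i xy|b x l i xl IH].
- by move=> /= [_ ->]; rewrite !eqxx !andbF.
- by rewrite /= (negbTE xy) => -[_ E] /=; rewrite E !eqxx !andbF.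
rewrite dist_deep // set_deep // => h.
by rewrite [unm A (MNode _ _ l _)]/= set_deep ?le_root_unm //= (IH h) mleaves_set.
Qed.

Lemma unm_set_dist A v t : dist t = Some (v, A) -> uniq (mkeys (set_dist true t)) ->
  unm A (set_dist true t) = set_dist false t.
Proof.
move=> h; rewrite (perm_uniq (mkeys_set h)) => /andP[Af _].
have h' : dist (set_dist false t) = Some (false, A) by rewrite dist_set h.
by rewrite -[in LHS](set_set true false) (unm_dist_set _ h') unm_id // set_set.
Qed.

(** Without a distinguished edge, the tree is a left comb all of whose internal edges are
critical and thus marked.  The last term accounts for the tree with a single leaf. *)
Lemma dist_none t : dist t = None -> normal t ->
  ((size (mkeys t) + unmarked t) = (size (mleaves t)).-1 + (size (mleaves t) == 1))%N.
Proof.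
elim/dist_ind: t => // [[]||b x l i xl IH] //.
  by move=> b x c y l1 l2 i xy; rewrite /= (negbTE xy).
rewrite dist_deep //= => /IH {}IH /andP[/IH {}IH nl].
rewrite /= !cats0 !size_cat /=.
have l1 : (1 < size (mleaves l))%N.
  case: (l) xl => //= ? ? l1 l2 _; rewrite size_cat.
  by have := mleaves_gt0 l1; have := mleaves_gt0 l2; lia.
have ul : unmarked l = false by case: (l) xl nl => // -[] //= ? ? ? ->.
by move: IH; rewrite ul; case: b => /=; lia.
Qed.

(** * Acyclicity of the complex of marked trees *)

Definition unm_basis (A : nat) (t : mtree) : mmod :=
  if normal (unm A t) then << unm A t >> else 0.

(** The part of the differential that preserves the tree of operations. *)
Definition dlead (t : mtree) : mmod :=
  \sum_(A <- mkeys t) sgn (rank A (mkeys t)) (unm_basis A t).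

Definition homotopy (t : mtree) : mmod :=
  if dist t is Some (false, A) then sgn (rank A (mkeys t)) << set_dist true t >> else 0.

Lemma wt_unm A t : wt (unm A t) = wt t.
Proof. by elim: t => //= b x l -> r ->; rewrite mleaves_unm. Qed.

Lemma marked_basis_unmark n d t A u : marked_basis n d.+1 t -> A \in mkeys t ->
  normal u -> unmarked u -> mleaves u = mleaves t ->
  mkeys u = [seq B <- mkeys t | B != A] -> marked_basis n d u.
Proof.
move=> bt At nu mu lu ku; have ut := marked_basis_uniq bt; case: bt => _ _ lt kt.
by split=> //; rewrite ?lu // ku -rem_filter // size_rem // kt.
Qed.

Definition lighter (n d m : nat) (u : mtree) : Prop := marked_basis n d u /\ (wt u < m)%N.

(** Normalisation fixes normal trees and makes other trees lighter. *)
Lemma dmark_lead n d t : marked_basis n d.+1 t ->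
  span (lighter n d (wt t)) (dmark t - dlead t).
Proof.
move=> bt; rewrite /dmark /dlead -sumrB; apply: span_sum => A At; rewrite -sgnB.
apply: span_sgn; rewrite /unm_basis; case: (boolP (normal _)) => h.
  by rewrite /unmark nf_id // subrr; exact: span0.
have mt : unmarked t by case: bt.
have := spanI (spanI (unmark_span A t) (nf_unmarked (unm_unmarked A mt))) (nf_lighter h).
rewrite subr0 wt_unm; apply: span_sub => u [[[nu lu ku] mu] wu]; split=> //.
exact: marked_basis_unmark bt At nu mu lu ku.
Qed.

Lemma marked_basis_set n d t A : marked_basis n d t -> dist t = Some (false, A) ->
  marked_basis n d.+1 (set_dist true t).
Proof.
case=> nt mt lt kt h; split; rewrite ?mleaves_set ?unmarked_set //; first exact: normal_set.
by rewrite (perm_size (mkeys_set h)) /= (set_dist_id h) kt.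
Qed.

Lemma homotopy_span n d t m : marked_basis n d t -> (wt t < m)%N ->
  span (lighter n d.+1 m) (homotopy t).
Proof.
move=> bt wm; rewrite /homotopy; case E: (dist t) => [[[] A]|]; try exact: span0.
by apply/span_sgn/spanU; split; [exact: marked_basis_set bt E | rewrite wt_set].
Qed.

Lemma rank_perm A s s' : perm_eq s s' -> rank A s = rank A s'.
Proof. by move/seq.permP; apply. Qed.

(** As the distinguished edge is not critical, its mark does not affect whether another mark
can be removed without creating a critical edge. *)
Lemma dlead_homotopy n d t v A : marked_basis n d t -> dist t = Some (v, A) ->
  fglin dlead (homotopy t) + fglin homotopy (dlead t) = << t >>.
Proof.
move=> bt h; have [nt _ lt _] := bt.
have ut : uniq (mkeys (set_dist true t)).
  by apply: uniq_mkeys; rewrite mleaves_set (perm_uniq lt) iota_uniq.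
have hk := mkeys_set h; have tid := set_dist_id h.
rewrite /homotopy h fglin_sum; case: v h tid => h tid.
- rewrite fglin0 add0r; rewrite tid in ut hk.
  have At : A \in mkeys t by rewrite (perm_mem hk) mem_head.
  rewrite (perm_big _ hk) big_cons /= [X in _ + X]big_seq big1 => [|B Bt]; last first.
    have AB : A != B.
      by apply: contraTneq Bt => <-; move: ut; rewrite (perm_uniq hk) => /andP[].
    rewrite fglin_sgn /unm_basis; case: ifP => _; rewrite ?fglin0 ?sgnr0 //.
    by rewrite fglinU dist_unm h /= AB sgnr0.
  have E : unm A t = set_dist false t by rewrite -{1}tid (unm_set_dist h) // tid.
  rewrite addr0 fglin_sgn /unm_basis E normal_set // fglinU dist_set h /=.
  rewrite set_set tid -sgnD (rank_perm _ hk) /rank /= ltnn add0n sgnD.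
  exact: sgnK.
pose T := set_dist true t; have hT : dist T = Some (true, A) by rewrite dist_set h.
rewrite tid in hk; rewrite fglin_sgn fglinU {1}/dlead (perm_big _ hk) big_cons.
have Ant : A \notin mkeys t by move: ut; rewrite (perm_uniq hk) => /andP[].
have E : unm A T = t by rewrite (unm_set_dist h).
rewrite {1}/unm_basis E nt (rank_perm _ hk) {1}/rank /= ltnn add0n -/(rank _ _).
rewrite sgnDr sgnK -addrA -[RHS]addr0; congr (_ + _).
rewrite sgn_sum -big_split /= big_seq big1 // => B Bt.
have AB : A != B by apply: contraNneq Ant => ->.
rewrite fglin_sgn /unm_basis /T (set_unm _ h AB).
have -> : normal (set_dist true (unm B t)) = normal (unm B t).
  apply/idP/idP => [/(normal_set false)|/(normal_set true)] //.
  by rewrite set_set (@set_dist_id _ A) // dist_unm h.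
case: ifP => _; rewrite ?fglin0 ?sgnr0 ?addr0 // fglinU dist_unm h /= mkeys_unm -!sgnD.
rewrite (rank_perm _ hk) /=.
have utt : uniq (mkeys t) by apply: uniq_mkeys; rewrite (perm_uniq lt) iota_uniq.
(* The two orders of removing the mark of [B] and marking [A] have opposite signs. *)
have := rank_filter A utt Bt => <-.
set a := rank A _; set b := rank B (mkeys t); set v := << _ >>.
have -> : (a + (B < A) + ((A < B) + b) = (b + a).+1)%N by lia.
by rewrite sgnS addNr.
Qed.

(** The terms of the differential outside [dlead] are lighter, and the homotopy preserves the
weight. *)
Lemma dmark_homotopy n d t m : marked_basis n d t -> dist t != None -> (wt t <= m)%N ->
  span (lighter n d m) (<< t >> - dmarkN (homotopy t) - fglin homotopy (dmark t)).
Proof.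
move=> bt ht wm; case E: (dist t) ht => [[v A]|] // _.
rewrite -(dlead_homotopy bt E).
have -> (x y z w : mmod) : x + y - z - w = (x - z) - (w - y).
  by rewrite opprB addrACA addrA.
apply: spanB.
  rewrite /dmarkN -fglin_subf; apply: span_fglin (homotopy_span bt (ltnSn _)) _ => u [bu wu].
  rewrite -opprB; apply: spanN; apply: span_sub (dmark_lead bu) => w [bw ww].
  by split=> //; apply: leq_trans ww _; apply: leq_trans wm.
rewrite -fglinB; case: d bt {E} => [|d] bt.
  case: bt => _ _ _ /size0nil kt; rewrite /dmark /dlead kt !big_nil subrr fglin0; exact: span0.
apply: span_fglin (dmark_lead bt) _ => u [bu wu]; apply: homotopy_span => //.
exact: leq_trans wu wm.
Qed.

Lemma dist_basis n d t : (1 < n)%N -> d.+1 != n.-1 -> marked_basis n d t -> dist t != None.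
Proof.
move=> n1 + [nt mt lt kt]; apply: contra_neq => h.
have := dist_none h nt; rewrite mt (perm_size lt) size_iota kt addn1.
by move=> ->; case: n n1 {lt} => [|[]] // n _; rewrite addn0.
Qed.

(** Subtracting the boundary of its image under the homotopy makes a cycle lighter. *)
Lemma marked_cycle n d c : (1 < n)%N -> d.+1 != n.-1 -> span (marked_basis n d) c ->
  dmarkN c = 0 -> exists2 e, span (marked_basis n d.+1) e & c = dmarkN e.
Proof.
move=> n1 dn hc.
have [m hm] : exists m, span (lighter n d m) c.
  elim/span_ind: hc => [|c1 c2 [m1 h1] [m2 h2]|t bt]; first by exists 0%N; exact: span0.
    exists (m1 + m2)%N; apply: spanB; [apply: span_sub h1|apply: span_sub h2] => u [bu wu];
      by split=> //; lia.
  by exists (wt t).+1; apply: spanU.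
elim: m c {hc} hm => [|m IH] c hc dc.
  exists 0; first exact: span0.
  rewrite /dmarkN fglin0; apply: span_False; by apply: span_sub hc => u [].
have hb : span (marked_basis n d) c by apply: span_sub hc => u [].
have he : span (marked_basis n d.+1) (fglin homotopy c).
  by apply: span_fglin hb _ => u bu; apply: span_sub (homotopy_span bu (ltnSn _)) => v [].
have [||e hes ce] := IH (c - dmarkN (fglin homotopy c)).
- have -> : c - dmarkN (fglin homotopy c) =
      fglin (fun t => << t >> - dmarkN (homotopy t) - fglin homotopy (dmark t)) c.
    rewrite !fglin_subf fglin_id -[X in _ = _ - X]fglin_comp -/(dmarkN c) dc fglin0 subr0.
    by rewrite /dmarkN fglin_comp.
  apply: span_fglin hc _ => u [bu wu]; apply: dmark_homotopy => //; exact: dist_basis bu.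
- rewrite /dmarkN fglinB -/(dmarkN c) dc sub0r fglin_comp; apply/eqP; rewrite oppr_eq0; apply/eqP.
  rewrite (fglin_eq_span (g := fun=> 0) he) ?fglin_0f // => u /marked_basis_uniq.
  exact: dmarkK.
exists (e + fglin homotopy c); first exact: spanD.
by rewrite /dmarkN fglinD -/(dmarkN e) -ce subrK.
Qed.

(** * Evaluation of operations on linear combinations of marked trees *)

Notation otree := (ptree op).

Fixpoint evt (S : otree) (ys : seq mmod) : mmod :=
  match S with
  | PLeaf => head 0 ys
  | PNode x l r => mulN x (evt l (take (nleaves l) ys)) (evt r (drop (nleaves l) ys))
  end.

Lemma evt_node x l r ys zs : size ys = nleaves l ->
  evt (PNode x l r) (ys ++ zs) = mulN x (evt l ys) (evt r zs).
Proof. by move=> h /=; rewrite -h take_size_cat // drop_size_cat. Qed.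

Lemma slot_split (T : Type) (m n : nat) (pre post : seq T) :
  (size pre + (size post).+1 = m + n)%N ->
  (exists post1 post2, [/\ post = post1 ++ post2, (size pre + (size post1).+1 = m)%N & size post2 = n])
  \/ (exists pre1 pre2, [/\ pre = pre1 ++ pre2, size pre1 = m & (size pre2 + (size post).+1 = n)%N]).
Proof.
move=> h; case: (ltnP (size pre) m) => hm; [left | right].
  exists (take (m - (size pre).+1) post), (drop (m - (size pre).+1) post).
  by rewrite cat_take_drop size_takel ?size_drop; [split=> //|]; lia.
exists (take m pre), (drop m pre).
by rewrite cat_take_drop size_takel ?size_drop //; split=> //; lia.
Qed.

Lemma evt_slotB S pre post c c' : (size pre + (size post).+1 = nleaves S)%N ->
  evt S (pre ++ (c - c') :: post) = evt S (pre ++ c :: post) - evt S (pre ++ c' :: post).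
Proof.
elim: S pre post => [|x l IHl r IHr] pre post h.
  by case: pre post h => [|? ?] [|? ?] //= h; exfalso; lia.
case: (slot_split (m := nleaves l) (n := nleaves r) h) => [[post1 [post2 [-> h1 h2]]]|[pre1 [pre2 [-> h1 h2]]]].
  rewrite -!cat_cons !catA !evt_node ?size_cat //.
  by rewrite IHl // /mulN bilinBl.
by rewrite -!catA !evt_node // IHr // /mulN bilinBr.
Qed.

Lemma evt_slot0 S pre post : (size pre + (size post).+1 = nleaves S)%N ->
  evt S (pre ++ 0 :: post) = 0.
Proof. by move=> h; rewrite -{1}(subrr 0) evt_slotB // subrr. Qed.

(** The list of arguments is cut at the input where [T] is grafted. *)
Lemma evt_graft S T pre ys post : (size pre + (size post).+1 = nleaves S)%N ->
  size ys = nleaves T ->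
  evt (graft (size pre) S T) (pre ++ ys ++ post) = evt S (pre ++ evt T ys :: post).
Proof.
move=> + hT; elim: S pre post => [|x l IHl r IHr] pre post h.
  by case: pre post h => [|? ?] [|? ?] //= h; rewrite ?cats0 //; exfalso; lia.
case: (slot_split (m := nleaves l) (n := nleaves r) h) => [[post1 [post2 [-> h1 h2]]]|[pre1 [pre2 [-> h1 h2]]]].
  have il : (size pre < nleaves l)%N by lia.
  have -> : pre ++ evt T ys :: post1 ++ post2 = (pre ++ evt T ys :: post1) ++ post2 by rewrite -catA.
  rewrite [graft _ _ _]/= il !catA !evt_node ?size_cat //; last first.
    by have := nleaves_graft T il; rewrite hT; lia.
  by rewrite -catA IHl.
have -> : graft (size (pre1 ++ pre2)) (PNode x l r) T = PNode x l (graft (size pre2) r T).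
  rewrite /= size_cat h1 addKn; have -> // : (nleaves l + size pre2 < nleaves l)%N = false by lia.
by rewrite -!catA !evt_node // IHr.
Qed.

Definition normal_seq (ys : seq mmod) : Prop := forall y, y \in ys -> span normal y.

Lemma normal_seq_cat ys zs : normal_seq (ys ++ zs) <-> normal_seq ys /\ normal_seq zs.
Proof.
split=> [h|[h1 h2] y]; last by rewrite mem_cat => /orP[/h1|/h2].
by split=> y hy; apply: h; rewrite mem_cat hy ?orbT.
Qed.

Lemma normal_seq_cons y ys : normal_seq (y :: ys) <-> span normal y /\ normal_seq ys.
Proof.
split=> [h|[h1 h2] z]; last by rewrite inE => /orP[/eqP ->|/h2].
by split=> [|z hz]; apply: h; rewrite inE ?eqxx ?hz ?orbT.
Qed.

Lemma evt_normal S ys : normal_seq ys -> span normal (evt S ys).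
Proof.
elim: S ys => [|x l IHl r IHr] ys h /=.
  by case: ys h => [_|y ys /normal_seq_cons[]] //=; exact: span0.
have [h1 h2] : normal_seq (take (nleaves l) ys) /\ normal_seq (drop (nleaves l) ys).
  by apply/normal_seq_cat; rewrite cat_take_drop.
by apply: mulN_normal; [exact: IHl | exact: IHr].
Qed.

Definition evF n (f : fr_car op n) (ys : seq mmod) : mmod :=
  fglin (fun t : ptree_of op n => evt (val t) ys) f.

Lemma evF_tree n t ys : nleaves t = n -> evF (tree_elt n t) ys = evt t ys.
Proof. by move=> /eqP h; rewrite (tree_eltE h) /evF fglinU. Qed.

Lemma evFB n (f g : fr_car op n) ys : evF (f - g) ys = evF f ys - evF g ys.
Proof. exact: fglinB. Qed.
Lemma evFD n (f g : fr_car op n) ys : evF (f + g) ys = evF f ys + evF g ys.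
Proof. exact: fglinD. Qed.
Lemma evF0 n ys : evF (0 : fr_car op n) ys = 0.
Proof. exact: fglin0. Qed.

Lemma evF_normal n (f : fr_car op n) ys : normal_seq ys -> span normal (evF f ys).
Proof. by move=> h; apply: span_fglin (spanT f) _ => t _; exact: evt_normal. Qed.

Lemma evF_slotB n (f : fr_car op n) pre post c c' : (size pre + (size post).+1 = n)%N ->
  evF f (pre ++ (c - c') :: post) = evF f (pre ++ c :: post) - evF f (pre ++ c' :: post).
Proof.
move=> h; rewrite -fglin_subf; apply: fglin_eq => -[t /= /eqP tn].
by rewrite evt_slotB ?tn.
Qed.

Lemma evF_slot0 n (f : fr_car op n) pre post : (size pre + (size post).+1 = n)%N ->
  evF f (pre ++ 0 :: post) = 0.
Proof. by move=> h; rewrite -{1}(subrr 0) evF_slotB // subrr. Qed.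

Lemma evF_comp k m n (f : fr_car op m) (g : fr_car op n) pre ys post :
  k.+1 = (m + n)%N -> (size pre + (size post).+1 = m)%N -> size ys = n ->
  evF (fr_comp k (size pre) f g) (pre ++ ys ++ post) = evF f (pre ++ evF g ys :: post).
Proof.
move=> hk hm hn; elim/fr_ind: f => [|f f' h h'|t tm].
- by rewrite fr_comp0l !evF0.
- by rewrite fr_compBl !evFB h h'.
elim/fr_ind: g => [|g g' h h'|s sn].
- by rewrite fr_comp0r !evF0 evF_tree // evt_slot0 // tm.
- by rewrite fr_compBr !evFB h h' -evF_slotB.
rewrite fr_compU // !evF_tree ?evt_graft ?tm ?sn //.
have := @nleaves_graft _ (size pre) t s; rewrite tm sn; lia.
Qed.

(** * Evaluation in the operad of quadri-algebras *)

Definition relator (x y : op) : free_ns_operad op 3 :=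
  \sum_(z <- left_ops x y) comp1 (gen x) (gen z) -
  \sum_(z <- right_ops x y) comp2 (gen y) (gen z).

Lemma evF_comp1 x y a b c :
  evF (comp1 (gen x) (gen y)) [:: a; b; c] = mulN x (mulN y a b) c.
Proof. by rewrite /comp1 /= fr_compU // evF_tree. Qed.

Lemma evF_comp2 x y a b c :
  evF (comp2 (gen x) (gen y)) [:: a; b; c] = mulN x a (mulN y b c).
Proof. by rewrite /comp2 /= fr_compU // evF_tree. Qed.

Lemma evF_sum n (I : Type) (s : seq I) (F : I -> fr_car op n) ys :
  evF (\sum_(i <- s) F i) ys = \sum_(i <- s) evF (F i) ys.
Proof. exact: fglin_sum. Qed.

Lemma evF_relator x y ys : op_le x y -> size ys = 3 -> normal_seq ys -> evF (relator x y) ys = 0.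
Proof.
case: ys => [|a [|b [|c []]]] // xy _ /normal_seq_cons[ha _].
rewrite /relator evFB !evF_sum.
under eq_bigr do rewrite evF_comp1.
under [X in _ - X]eq_bigr do rewrite evF_comp2.
have /quad_relE := quad_rel_normal b c xy ha.
by rewrite /mulN bilin_suml bilin_sumr => ->; rewrite subrr.
Qed.

Lemma comp1Dr X (a b c : free_ns_operad X 2) : comp1 a (b + c) = comp1 a b + comp1 a c.
Proof. exact: ns_compDr. Qed.
Lemma comp2Dr X (a b c : free_ns_operad X 2) : comp2 a (b + c) = comp2 a b + comp2 a c.
Proof. exact: ns_compDr. Qed.

Definition op_chains : seq (op * op) :=
  let nw := (false, false) in let ne := (true, false) in
  let sw := (false, true) in let se := (true, true) in
  [:: (nw, nw); (nw, ne); (ne, ne); (nw, sw); (nw, se); (ne, se); (sw, sw); (sw, se); (se, se)].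

Lemma op_chainsP x y : ((x, y) \in op_chains) = op_le x y.
Proof. by case: x y => [[] []] [[] []]. Qed.

Lemma bq_rel_Quad : @bq_rel Quad = zspan [set` [seq relator p.1 p.2 | p <- op_chains]].
Proof.
rewrite /Quad /span_bq /=.
match goal with |- zspan (mkset (fun x => is_true (@in_mem _ x (@mem _ _ ?l)))) = _ =>
  have -> : l = [seq relator p.1 p.2 | p <- op_chains] end; last by [].
rewrite /op_chains /relator /left_ops /right_ops /left_coord /right_coord /= !big_cons !big_nil !addr0.
rewrite !(comp1Dr, comp2Dr) -!addrA; reflexivity.
Qed.

Lemma relator_in x y : op_le x y -> @bq_rel Quad (relator x y).
Proof.
rewrite -op_chainsP bq_rel_Quad => h; apply: zspan_gen.
by apply/mapP; exists (x, y).
Qed.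

Lemma evF_rel (r : free_ns_operad op 3) ys : @bq_rel Quad r ->
  size ys = 3 -> normal_seq ys -> evF r ys = 0.
Proof.
rewrite bq_rel_Quad => + h3 hys; elim=> {r} [r /mapP[[x y]]||r r' _ h _ h'].
- by rewrite op_chainsP => xy ->; exact: evF_relator.
- exact: evF0.
by rewrite evFB h h' subr0.
Qed.

Notation Quad' := (quo_ns_operad (@bq_rel Quad)).

(** By [quad_rel_normal], relations evaluate to zero on normal trees, and so do all their
composites. *)
Lemma evF_ideal n (f : free_ns_operad op n) ys : @ns_ideal _ (@bq_rel Quad) n f ->
  size ys = n -> normal_seq ys -> evF f ys = 0.
Proof.
move=> hf; elim: hf ys => {n f} [r hr|n|n f g _ hf _ hg|k m n i f g hk im _ hf|k m n i f g hk im _ hg] ys hs hys.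
- exact: evF_rel hs hys.
- exact: evF0.
- by rewrite evFB hf // hg // subr0.
- have [pre [mid [post [E hp hm]]]] : exists pre mid post, [/\ ys = pre ++ mid ++ post, size pre = i & size mid = n].
    exists (take i ys), (take n (drop i ys)), (drop n (drop i ys)).
    by rewrite !cat_take_drop !size_takel ?size_drop //; lia.
  have hpost : (size pre + (size post).+1 = m)%N by move: hs; rewrite E !size_cat; lia.
  rewrite E -hp [ns_comp _ _ _ _]/= evF_comp //.
  have /normal_seq_cat[n1 /normal_seq_cat[n2 n3]] : normal_seq (pre ++ mid ++ post) by rewrite -E.
  apply: hf; first by rewrite size_cat.
  by apply/normal_seq_cat; split=> //; apply/normal_seq_cons; split=> //; exact: evF_normal.
have [pre [mid [post [E hp hm]]]] : exists pre mid post, [/\ ys = pre ++ mid ++ post, size pre = i & size mid = n].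
  exists (take i ys), (take n (drop i ys)), (drop n (drop i ys)).
  by rewrite !cat_take_drop !size_takel ?size_drop //; lia.
have hpost : (size pre + (size post).+1 = m)%N by move: hs; rewrite E !size_cat; lia.
have /normal_seq_cat[n1 /normal_seq_cat[n2 n3]] : normal_seq (pre ++ mid ++ post) by rewrite -E.
rewrite E -hp [ns_comp _ _ _ _]/= evF_comp // hg //.
exact: evF_slot0.
Qed.

Definition ev n (a : Quad' n) (ys : seq mmod) : mmod := evF (generic_quotient.repr a) ys.

Section Eval.
Variable n : nat.
Implicit Types (a b : Quad' n) (ys : seq mmod).

Lemma ev_pi (f : free_ns_operad op n) ys : size ys = n -> normal_seq ys ->
  ev (quo_pi (@bq_rel Quad) f : Quad' n) ys = evF f ys.
Proof.
move=> hs hys; rewrite /ev; set g := generic_quotient.repr _.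
have /evF_ideal h : @ns_ideal _ (@bq_rel Quad) n (g - f) by apply/quo_piP; rewrite quo_piK.
by apply/eqP; rewrite -subr_eq0 -evFB h.
Qed.

Lemma evD a b ys : size ys = n -> normal_seq ys -> ev (a + b) ys = ev a ys + ev b ys.
Proof.
move=> hs hys; elim/quo_ind: a => f; elim/quo_ind: b => g.
by rewrite -quo_piD !ev_pi // evFD.
Qed.

Lemma ev0 ys : size ys = n -> normal_seq ys -> ev (0 : Quad' n) ys = 0.
Proof. by move=> hs hys; apply: (addrI (ev (0 : Quad' n) ys)); rewrite -evD // !addr0. Qed.

Lemma ev_normal a ys : normal_seq ys -> span normal (ev a ys).
Proof. exact: evF_normal. Qed.

Lemma ev_slotB a pre post c c' : (size pre + (size post).+1 = n)%N ->
  ev a (pre ++ (c - c') :: post) = ev a (pre ++ c :: post) - ev a (pre ++ c' :: post).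
Proof. exact: evF_slotB. Qed.

End Eval.

Lemma ev_comp k m n (a : Quad' m) (b : Quad' n) pre ys post :
  k.+1 = (m + n)%N -> (size pre + (size post).+1 = m)%N -> size ys = n ->
  normal_seq (pre ++ ys ++ post) ->
  ev (ns_comp k (size pre) a b) (pre ++ ys ++ post) = ev a (pre ++ ev b ys :: post).
Proof.
move=> hk hm hn hys; have /normal_seq_cat[n1 /normal_seq_cat[n2 n3]] := hys.
elim/quo_ind: a => f; elim/quo_ind: b => g.
rewrite [ns_comp _ _ _ _]/= quo_compE //; last by lia.
rewrite !ev_pi //; first exact: evF_comp.
- by rewrite !size_cat; lia.
- by rewrite size_cat.
by apply/normal_seq_cat; split=> //; apply/normal_seq_cons; split=> //; exact: evF_normal.
Qed.

(** * Inversions *)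

Section Inversions.
Local Open Scope nat_scope.
Implicit Types s u v : seq nat.

Fixpoint inv s : nat := if s is x :: s' then rank x s' + inv s' else 0.

Definition cross s u : nat := \sum_(x <- s) rank x u.

Lemma rank_cat x s u : rank x (s ++ u) = rank x s + rank x u.
Proof. exact: count_cat. Qed.

Lemma cross_catr s u u' : cross s (u ++ u') = cross s u + cross s u'.
Proof. by rewrite /cross -big_split; apply: eq_bigr => x _; exact: rank_cat. Qed.

Lemma inv_cat s u : inv (s ++ u) = inv s + inv u + cross s u.
Proof.
elim: s => [|x s IH] /=; first by rewrite /cross big_nil add0n addn0.
by rewrite IH /cross big_cons rank_cat; lia.
Qed.

Lemma cross_perml s s' u : perm_eq s s' -> cross s u = cross s' u.
Proof. exact: perm_big. Qed.

Lemma cross_permr s u u' : perm_eq u u' -> cross s u = cross s u'.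
Proof. by move=> h; apply: eq_bigr => x _; exact: rank_perm. Qed.

Lemma inv_perm_mid a b u v : perm_eq u v ->
  inv (a ++ u ++ b) + inv v = inv (a ++ v ++ b) + inv u.
Proof.
move=> h; rewrite !inv_cat !cross_catr (cross_perml b h) (cross_permr a h); lia.
Qed.

Lemma cross_sumr s u : cross s u = \sum_(y <- u) count (fun x => y < x) s.
Proof.
rewrite /cross /rank; under eq_bigr do rewrite -sum1_count big_mkcond.
by rewrite exchange_big; apply: eq_bigr => y _ /=; rewrite -sum1_count -big_mkcond.
Qed.

Lemma count_lt_gt x s : x \notin s -> rank x s + count (fun y => x < y) s = size s.
Proof.
by rewrite /rank; elim: s => //= y s IH; rewrite inE negb_or => /andP[xy /IH]; lia.
Qed.

Lemma cross_sym s u : uniq (s ++ u) -> cross s u + cross u s = size s * size u.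
Proof.
move=> h; rewrite addnC cross_sumr -big_split /= big_seq.
rewrite (eq_bigr (fun=> size u)) => [|x xs]; first by rewrite -big_seq big_const_seq count_predT iter_addn_0 mulnC.
rewrite addnC; apply: count_lt_gt; apply/negP => xu; exact: uniq_cat_disj h xs xu.
Qed.

(** The entries before [x] are either smaller than [x], and are counted by the rank, or larger,
and form an inversion with [x]; a later entry smaller than [x] is counted by both. *)
Lemma inv_delete s x u : uniq (s ++ x :: u) ->
  odd (inv (s ++ u) + size s) = odd (inv (s ++ x :: u) + rank x (s ++ x :: u)).
Proof.
move=> h; have xs : x \notin s.
  by apply/negP => xs; apply: uniq_cat_disj h xs _; rewrite mem_head.
have E : cross s (x :: u) = cross s u + count (fun y => x < y) s.
  by rewrite -cat1s cross_catr addnC [cross s [:: x]]cross_sumr big_seq1.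
rewrite !inv_cat E rank_cat /= {3}/rank /= ltnn -(count_lt_gt xs) -/(rank _ _).
set a := inv s + inv u + cross s u.
have -> : inv s + (rank x u + inv u) + (cross s u + count (fun y => x < y) s) + (rank x s + (0 + rank x u))
  = a + (rank x s + count (fun y => x < y) s) + (rank x u + rank x u) by rewrite /a; lia.
by rewrite [in RHS]oddD [X in _ (+) X]oddD addbb addbF.
Qed.

Lemma cross_flatten s (ls : seq (seq nat)) : cross s (flatten ls) = \sum_(l <- ls) cross s l.
Proof.
elim: ls => [|l ls IH]; last by rewrite big_cons /= cross_catr IH.
by rewrite big_nil /= /cross big1.
Qed.

Lemma inv_flatten (ls : seq (seq nat)) :
  inv (flatten ls) = \sum_(i < size ls) inv (nth [::] ls i) +
    \sum_(i < size ls) \sum_(j < size ls | i < j) cross (nth [::] ls i) (nth [::] ls j).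
Proof.
elim: ls => [|l ls IH]; first by rewrite !big_ord0.
rewrite [flatten _]/= inv_cat IH cross_flatten [size (l :: ls)]/= !big_ord_recl.
rewrite [X in _ = _ + (X + _)]big_mkcond big_ord_recl /= add0n.
have -> : \sum_(m <- ls) cross l m = \sum_(i < size ls) cross l (nth [::] ls i).
  by rewrite (big_nth [::]) big_mkord.
under [X in _ = _ + (_ + X)]eq_bigr do rewrite big_mkcond big_ord_recl /= add0n -big_mkcond.
by rewrite /= [_ + (_ + _)]addnA -[LHS]addnA; congr (_ + _); rewrite addnC.
Qed.

(** Every pair of entries in two blocks is an inversion in exactly one of the two orders of the
blocks.  Exchanging blocks of lengths [p] and [q] thus contributes [p * q]. *)
Lemma inv_flatten_perm k (s : 'S_k) (ls : seq (seq nat)) : size ls = k -> uniq (flatten ls) ->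
  odd (inv (flatten [seq nth [::] ls i | i <- word s])) =
  odd (inv (flatten ls) + \sum_(i < k) \sum_(j < k | (i < j) && (s j < s i))
         size (nth [::] ls (s i)) * size (nth [::] ls (s j))).
Proof.
move=> hk uls; pose ls' := [seq nth [::] ls i | i <- word s].
have hk' : size ls' = k by rewrite size_map size_word.
have nls' (i : 'I_k) : nth [::] ls' i = nth [::] ls (s i).
  rewrite (nth_map 0) ?size_word // /word (nth_map i) ?size_enum_ord //.
  by rewrite nth_ord_enum.
rewrite !inv_flatten hk hk'.
pose C (i j : 'I_k) := cross (nth [::] ls i) (nth [::] ls j).
have E1 : \sum_(i < k) inv (nth [::] ls' i) = \sum_(i < k) inv (nth [::] ls i).
  by rewrite [RHS](reindex_inj (@perm_inj _ s)); apply: eq_bigr => i _; rewrite nls'.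
pose X := \sum_(i < k) \sum_(j < k | (i < j) && (s i < s j)) C (s i) (s j).
have E2 : \sum_(i < k) \sum_(j < k | i < j) cross (nth [::] ls' i) (nth [::] ls' j) =
    X + \sum_(i < k) \sum_(j < k | (i < j) && (s j < s i)) C (s i) (s j).
  rewrite -big_split; apply: eq_bigr => i _; rewrite (bigID (fun j : 'I_k => s i < s j)) /=.
  congr (_ + _); first by apply: eq_bigr => j _; rewrite !nls'.
  apply: eq_big => [j|j _]; last by rewrite !nls'.
  case: ltnP => //= ij; rewrite -leqNgt leq_eqVlt; case: eqVneq => //= E.
  by move/val_inj/perm_inj: E ij => ->; rewrite ltnn.
have E3 : \sum_(i < k) \sum_(j < k | i < j) cross (nth [::] ls i) (nth [::] ls j) =
    X + \sum_(i < k) \sum_(j < k | (i < j) && (s j < s i)) C (s j) (s i).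
  transitivity (\sum_(i < k) \sum_(j < k | s i < s j) C (s i) (s j)).
    rewrite (reindex_inj (@perm_inj _ s)); apply: eq_bigr => i _.
    by rewrite (reindex_inj (@perm_inj _ s)).
  rewrite [X in _ + X](exchange_big_dep xpredT) //= -big_split; apply: eq_bigr => i _.
  rewrite (bigID (fun j : 'I_k => i < j)) /=; congr (_ + _); apply: eq_bigl => j; first by rewrite andbC.
  case: (ltngtP i j) => ij /=; rewrite ?andbT ?andbF //.
  by move/val_inj: ij => ->; rewrite ltnn.
have disj (i j : 'I_k) : i < j -> uniq (nth [::] ls i ++ nth [::] ls j).
  move=> ij; apply: subseq_uniq uls.
  rewrite -[X in flatten X](cat_take_drop j ls) flatten_cat (drop_nth [::]) ?hk //.
  rewrite -[take j ls](cat_take_drop i) flatten_cat (drop_nth [::]); last by rewrite size_takel ?hk // ltnW.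
  rewrite nth_take //= -!catA; apply: subseq_trans (suffix_subseq _ _).
  apply: cat_subseq => //; apply: subseq_trans (suffix_subseq _ _); exact: prefix_subseq.
rewrite E1 E2 E3; set a := \sum_(i < k) inv _.
have -> : \sum_(i < k) \sum_(j < k | (i < j) && (s j < s i)) size (nth [::] ls (s i)) * size (nth [::] ls (s j)) =
  \sum_(i < k) \sum_(j < k | (i < j) && (s j < s i)) C (s i) (s j) +
  \sum_(i < k) \sum_(j < k | (i < j) && (s j < s i)) C (s j) (s i).
  rewrite -big_split; apply: eq_bigr => i _; rewrite -big_split; apply: eq_bigr => j /andP[_ ji] /=.
  by rewrite mulnC -cross_sym ?disj // addnC.
set b := \sum_(i < k) _; set c := \sum_(i < k) _.
suff -> : a + (X + c) + (b + c) = a + (X + b) + (c + c) by rewrite [RHS]oddD [odd (c + c)]oddD addbb addbF.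
by lia.
Qed.

End Inversions.

(** * Evaluation of the operations of the regular operad *)

Notation QuadOp := (bq_operad Quad).

Definition arrange (T : Type) (x0 : T) n (s : 'S_n) (ys : seq T) : seq T :=
  [seq nth x0 ys j | j <- word s].

Lemma nth_word n (s : 'S_n) (i : 'I_n) : nth 0%N (word s) i = s i.
Proof. by rewrite /word (nth_map i) ?size_enum_ord // nth_ord_enum. Qed.

Lemma size_arrange T (x0 : T) n (s : 'S_n) ys : size (arrange x0 s ys) = n.
Proof. by rewrite size_map size_word. Qed.

Lemma perm_arrange (T : eqType) (x0 : T) n (s : 'S_n) ys :
  size ys = n -> perm_eq (arrange x0 s ys) ys.
Proof.
move=> h; have := perm_map (nth x0 ys) (perm_word s).
by rewrite -[X in iota 0 X]h -/(mkseq _ _) mkseq_nth.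
Qed.

Lemma map_arrange (T T' : Type) (f : T -> T') x0 n (s : 'S_n) ys : size ys = n ->
  [seq f y | y <- arrange x0 s ys] = arrange (f x0) s [seq f y | y <- ys].
Proof.
move=> h; rewrite /arrange -map_comp; apply/eq_in_map => j; rewrite mem_word => jn /=.
by rewrite (nth_map x0) ?h.
Qed.

Lemma arrangeM (T : Type) (x0 : T) n (s t : 'S_n) ys :
  arrange x0 (s * t)%g ys = arrange x0 s (arrange x0 t ys).
Proof.
rewrite {1 2}/arrange {1 2}/word -!map_comp; apply: eq_map => j /=.
by rewrite permM /arrange (nth_map 0%N) ?size_word // nth_word.
Qed.

Lemma arrange1 (T : Type) (x0 : T) n ys : size ys = n -> arrange x0 (1 : 'S_n)%g ys = ys.
Proof. by move=> <-; rewrite /arrange word1 -/(mkseq _ _) mkseq_nth. Qed.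

Definition sgev n (a : QuadOp n) (ys : seq mmod) : mmod :=
  \sum_(s : 'S_n) ev ((a : sg_car Quad' n) s) (arrange 0 s ys).

Lemma normal_arrange n (s : 'S_n) ys : size ys = n -> normal_seq ys -> normal_seq (arrange 0 s ys).
Proof. by move=> h hys y; rewrite (perm_mem (perm_arrange 0 s h)); exact: hys. Qed.

Section Sgev.
Variable n : nat.
Implicit Types (a b : QuadOp n) (ys : seq mmod).

Lemma sgevD a b ys : size ys = n -> normal_seq ys -> sgev (a + b) ys = sgev a ys + sgev b ys.
Proof.
move=> hs hys; rewrite -big_split; apply: eq_bigr => s _; rewrite ffunE evD ?size_arrange //.
exact: normal_arrange.
Qed.

Lemma sgev0 ys : size ys = n -> normal_seq ys -> sgev (0 : QuadOp n) ys = 0.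
Proof.
move=> hs hys; apply: big1 => s _; rewrite ffunE ev0 ?size_arrange //.
exact: normal_arrange.
Qed.

Lemma sgevU (a : Quad' n) s ys : size ys = n -> normal_seq ys ->
  sgev (sg_elt a s : QuadOp n) ys = ev a (arrange 0 s ys).
Proof.
move=> hs hys; rewrite /sgev (bigD1 s) //= big1 ?addr0 => [|t /negbTE ts]; first by rewrite ffunE eqxx.
by rewrite ffunE ts ev0 ?size_arrange //; exact: normal_arrange.
Qed.

Lemma sgev_act a s ys : sgev (op_act a s) ys = sgev a (arrange 0 s ys).
Proof.
rewrite /sgev (reindex_inj (mulIg s)) /=; apply: eq_bigr => t _.
by rewrite ffunE mulgK arrangeM.
Qed.

Lemma word_split (s : 'S_n) i : (i < n)%N ->
  exists w1 w2, [/\ word s = w1 ++ i :: w2, i \notin w1 & i \notin w2].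
Proof.
move=> hi; have := uniq_word s; have : i \in word s by rewrite mem_word.
case/splitPr => w1 w2 u; exists w1, w2; split=> //.
  by apply/negP => h; apply: uniq_cat_disj u h _; rewrite mem_head.
by move: u; rewrite cat_uniq /= => /and3P[_ _ /andP[]].
Qed.

Lemma arrange_slot (s : 'S_n) (pre post : seq mmod) : (size pre < n)%N ->
  exists w1 w2, [/\ forall c, arrange 0 s (pre ++ c :: post) = w1 ++ c :: w2,
    (size w1 + (size w2).+1 = n)%N & size w1 = index (size pre) (word s)].
Proof.
move=> h; have [w1 [w2 [E h1 h2]]] := word_split s h.
pose f := nth 0 (pre ++ 0 :: post).
exists (map f w1), (map f w2); split=> [c||].
- rewrite /arrange E map_cat /= nth_cat ltnn subnn /=.
  have hf j : j != size pre -> nth 0 (pre ++ c :: post) j = f j.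
    by move=> hj; rewrite /f !nth_cat; case: ltngtP hj => // hj _; case: (j - _)%N (subn_gt0 (size pre) j) => //; rewrite hj.
  congr (_ ++ _ :: _); apply/eq_in_map => j hj; apply: hf.
    by apply: contraNneq h1 => <-.
  by apply: contraNneq h2 => <-.
- by rewrite !size_map -(size_word s) E size_cat.
by rewrite size_map E index_cat (negbTE h1) /= eqxx addn0.
Qed.

Lemma sgev_slotB a pre post c c' : (size pre + (size post).+1 = n)%N ->
  sgev a (pre ++ (c - c') :: post) = sgev a (pre ++ c :: post) - sgev a (pre ++ c' :: post).
Proof.
move=> h; rewrite -sumrB; apply: eq_bigr => s _.
have [|w1 [w2 [E hw _]]] := @arrange_slot s pre post; first by rewrite -h addnS ltnS leq_addr.
by rewrite !E ev_slotB.
Qed.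

Lemma sgev_slot0 a pre post : (size pre + (size post).+1 = n)%N ->
  sgev a (pre ++ 0 :: post) = 0.
Proof. by move=> h; rewrite -{1}(subrr 0) sgev_slotB // subrr. Qed.

Lemma sgev_slotD a pre post c c' : (size pre + (size post).+1 = n)%N ->
  sgev a (pre ++ (c + c') :: post) = sgev a (pre ++ c :: post) + sgev a (pre ++ c' :: post).
Proof.
by move=> h; rewrite -[c' in LHS]opprK sgev_slotB // -[- c']sub0r sgev_slotB // sgev_slot0 // sub0r opprK.
Qed.

Lemma sgev_normal a ys : size ys = n -> normal_seq ys -> span normal (sgev a ys).
Proof.
move=> hs hys; apply: span_sum => s _; apply: ev_normal; exact: normal_arrange.
Qed.

End Sgev.

(** The substitution of words in the partial composite selects the same arguments as the
nested evaluation. *)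
Lemma sgev_comp k m n (a : QuadOp m) (b : QuadOp n) pre ys post :
  k.+1 = (m + n)%N -> (size pre + (size post).+1 = m)%N -> size ys = n ->
  normal_seq (pre ++ ys ++ post) ->
  sgev (ns_comp k (size pre) a b) (pre ++ ys ++ post) = sgev a (pre ++ sgev b ys :: post).
Proof.
move=> hk hm hn hys; have /normal_seq_cat[n1 /normal_seq_cat[n2 n3]] := hys.
have hp : (size pre < m)%N by rewrite -hm addnS ltnS leq_addr.
have hsz : size (pre ++ ys ++ post) = k by rewrite !size_cat; lia.
have hn' c : span normal c -> normal_seq (pre ++ c :: post).
  by move=> hc; apply/normal_seq_cat; split=> //; apply/normal_seq_cons.
have hs' c : size (pre ++ c :: post) = m by rewrite size_cat.
rewrite [ns_comp _ _ _ _]/=; elim/sg_ind: a => [|a a' h h'|a s].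
- by rewrite sg_comp0l // !sgev0 //; apply: hn'; exact: sgev_normal.
- by rewrite sg_compDl // !sgevD ?h ?h' //; apply: hn'; exact: sgev_normal.
elim/sg_ind: b => [|b b' h h'|b t].
- by rewrite sg_comp0r // !sgev0 // sgev_slot0.
- by rewrite sg_compDr // [in RHS]sgevD // sgev_slotD // -h -h' sgevD.
rewrite sg_compU // !sgevU //; last by apply: hn'; apply: ev_normal; exact: normal_arrange.
have [w1 [w2 [E h1 h2]]] := word_split s hp.
pose zs := pre ++ ev b (arrange 0 t ys) :: post.
have hzs : arrange 0 s zs = map (nth 0 zs) w1 ++ ev b (arrange 0 t ys) :: map (nth 0 zs) w2.
  by rewrite /arrange E map_cat /= nth_cat ltnn subnn.
pose sh j := if (j < size pre)%N then j else (j + n).-1.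
have F w : size pre \notin w -> map (nth 0 (pre ++ ys ++ post)) (map sh w) = map (nth 0 zs) w.
  move=> hw; rewrite -map_comp; apply/eq_in_map => j jw.
  have hj : j != size pre by apply: contraNneq hw => <-.
  rewrite /= /sh /zs !nth_cat hn; move: (size pre) hj => p hj.
  case: (ltnP j p) => hjp; first by rewrite hjp.
  have -> : ((j + n).-1 < p)%N = false by lia.
  have -> : ((j + n).-1 - p < n)%N = false by lia.
  have -> : (j - p = (j - p).-1.+1)%N by lia.
  by rewrite /=; congr nth; lia.
have -> : arrange 0 (perm_comp k (size pre) s t) (pre ++ ys ++ post) =
    map (nth 0 zs) w1 ++ arrange 0 t ys ++ map (nth 0 zs) w2.
  rewrite /arrange word_perm_comp // E subst_word_in // size_word !map_cat !F //.
  congr (_ ++ (_ ++ _)); rewrite -map_comp; apply/eq_in_map => j; rewrite mem_word => hj /=.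
  by rewrite nth_cat ltnNge leq_addr /= addKn nth_cat hn hj.
have hN : normal_seq (arrange 0 s zs).
  by apply: normal_arrange; [exact: hs' | apply: hn'; apply: ev_normal; exact: normal_arrange].
move: hN; rewrite hzs => /normal_seq_cat[m1 /normal_seq_cons[_ m2]].
have -> : index (size pre) (word s) = size (map (nth 0 zs) w1).
  by rewrite size_map E index_cat (negbTE h1) /= eqxx addn0.
apply: ev_comp; rewrite ?size_arrange //.
  by rewrite !size_map; have := size_word s; rewrite E size_cat.
by apply/normal_seq_cat; split=> //; apply/normal_seq_cat; split=> //; exact: normal_arrange.
Qed.

(** * Vertices of bar trees *)

Arguments bar_wf {P} t.
Arguments bar_leaves {P} t.

Section BarTree.
Variable P : operad.
Implicit Types t u : bar_tree P.

Lemma bar_tree_induction (Q : bar_tree P -> Prop) :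
  (forall i, Q (BLeaf i)) ->
  (forall k (a : P k) ts, (forall u, u \in ts -> Q u) -> Q (BNode a ts)) ->
  forall t, Q t.
Proof.
move=> h1 h2; fix IH 1 => -[i|k a ts]; [exact: h1 | apply: h2].
elim: ts => [v hv|u ts IHts v]; first by exfalso; rewrite in_nil in hv.
rewrite inE => /orP[/eqP ->|]; [exact: IH | exact: IHts].
Qed.

Fixpoint bkeys t : seq nat :=
  match t with
  | BLeaf _ => [::]
  | BNode _ _ ts => key (flatten [seq bar_leaves u | u <- ts]) :: flatten [seq bkeys u | u <- ts]
  end.

Definition ekeys t : seq nat := behead (bkeys t).

Definition good t : bool := bar_wf t && uniq (bar_leaves t).

Lemma bkeysE t : bkeys t = if t is BNode _ _ _ then key (bar_leaves t) :: ekeys t else [::].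
Proof. by case: t. Qed.

Lemma size_bkeys t : size (bkeys t) = bar_degree t.
Proof.
elim/bar_tree_induction: t => //= k a ts IH; rewrite size_flatten /shape -map_comp.
by congr (sumn _).+1; apply/eq_in_map => u /IH.
Qed.

Lemma flatten_map_split (T : eqType) (T' : Type) (f : T -> seq T') (x : T) ts : x \in ts ->
  exists ts1 ts2, ts = ts1 ++ x :: ts2 /\
    flatten (map f ts) = flatten (map f ts1) ++ f x ++ flatten (map f ts2).
Proof.
by case/splitPr => ts1 ts2; exists ts1, ts2; rewrite map_cat flatten_cat.
Qed.

Lemma mem_flatten_map (T T' : eqType) (f : T -> seq T') ts y :
  y \in flatten (map f ts) -> exists2 x, x \in ts & y \in f x.
Proof. by move=> /flattenP[_ /mapP[x hx ->] hy]; exists x. Qed.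

Lemma sub_flatten_map (T T' : eqType) (f : T -> seq T') ts x : x \in ts ->
  {subset f x <= flatten (map f ts)}.
Proof. by move=> hx y hy; apply/flattenP; exists (f x) => //; apply: map_f. Qed.

Lemma bar_leaves_mem t : bar_wf t -> exists i, i \in bar_leaves t.
Proof.
elim/bar_tree_induction: t => [i _|k a ts IH] /=; first by exists i; rewrite inE.
case/and3P=> k1 /eqP st /allP wf; case: ts st IH wf k1 => [<- //|u ts] _ IH wf _.
have [||i hi] := IH u; rewrite ?mem_head ?wf ?mem_head //.
by exists i; rewrite mem_cat hi.
Qed.

Lemma bkey_subset t A : bar_wf t -> A \in bkeys t ->
  {subset key_set A <= bar_leaves t} /\ exists i, i \in key_set A.
Proof.
elim/bar_tree_induction: t A => //= k a ts IH A wf; rewrite inE => /orP[/eqP ->|].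
  split=> [i|]; first by rewrite key_setK.
  have [i hi] := @bar_leaves_mem (BNode a ts) wf; exists i; by rewrite key_setK.
case/and3P: wf => _ _ /allP wf /mem_flatten_map[u hu /(IH _ hu _ (wf _ hu))[h1 h2]].
by split=> // i /h1; exact: sub_flatten_map.
Qed.

Lemma uniq_flatten_bkeys ts : all bar_wf ts -> (forall u, u \in ts -> uniq (bkeys u)) ->
  uniq (flatten [seq bar_leaves u | u <- ts]) -> uniq (flatten [seq bkeys u | u <- ts]).
Proof.
elim: ts => //= u ts IH /andP[wu /allP wts] hu ul; rewrite cat_uniq hu ?mem_head //=.
rewrite IH; last 1 first.
- by move: ul; rewrite cat_uniq => /and3P[].
- rewrite andbT; apply/hasPn => A /mem_flatten_map[v hv Av]; apply/negP => Au.
  have [sv [i Ai]] := bkey_subset (wts v hv) Av; have [su _] := bkey_subset wu Au.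
  apply: uniq_cat_disj ul (su _ Ai) _; apply: (sub_flatten_map hv); exact: sv.
- by apply/allP.
by move=> v hv; apply: hu; rewrite inE hv orbT.
Qed.

Lemma good_child k (a : P k) ts u : good (BNode a ts) -> u \in ts -> good u.
Proof.
move=> /andP[/= /and3P[_ _ /allP wf] ul] hu; rewrite /good wf //=.
by have [ts1 [ts2 [_ E]]] := flatten_map_split bar_leaves hu; move: ul; rewrite E !cat_uniq => /and3P[_ _ /and3P[]].
Qed.

(** As the arities are at least two, some leaf above a vertex is not above a given child. *)
Lemma uniq_bkeys t : good t -> uniq (bkeys t).
Proof.
elim/bar_tree_induction: t => // k a ts IH gt; have /andP[/= /and3P[k1 /eqP st wf] ul] := gt.
rewrite uniq_flatten_bkeys ?andbT //; last first.
  by move=> u hu; apply: IH => //; exact: good_child gt hu.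
apply/negP => /mem_flatten_map[u hu /(bkey_subset (allP wf u hu))[h _]].
have [ts1 [ts2 [E EL]]] := flatten_map_split bar_leaves hu.
have [v hv] : exists v, v \in ts1 ++ ts2.
  move: k1; rewrite -st E size_cat /=; case: ts1 {E EL} => [|v ts1]; last by exists v; rewrite mem_head.
  by case: ts2 => [|v ts2] //; exists v; rewrite mem_head.
have [i hi] : exists i, i \in bar_leaves v.
  apply: bar_leaves_mem; apply: (allP wf); move: hv; rewrite E !mem_cat inE.
  by case/orP => ->; rewrite ?orbT.
have iu : i \in bar_leaves u.
  apply: h; rewrite key_setK EL !mem_cat; move: hv; rewrite mem_cat.
  by case/orP => /(sub_flatten_map (f := bar_leaves)) /(_ i hi) ->; rewrite ?orbT.
move: ul; rewrite EL; move: hv; rewrite mem_cat => /orP[] /(sub_flatten_map (f := bar_leaves)) /(_ i hi) hi'.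
  by move=> /uniq_cat_disj /(_ hi'); apply; rewrite mem_cat iu.
by rewrite cat_uniq => /and3P[_ _ /uniq_cat_disj]; apply; [exact: iu | exact: hi'].
Qed.

Lemma bar_weightE t : bar_wf t -> (bar_weight t).+1 = size (bar_leaves t).
Proof.
elim/bar_tree_induction: t => // k a ts IH /and3P[/= k1 /eqP st /allP wf].
rewrite size_flatten /shape -map_comp.
have -> : sumn (map (size \o bar_leaves) ts) = sumn [seq (bar_weight u).+1 | u <- ts].
  by congr sumn; apply/eq_in_map => u hu /=; rewrite IH //; exact: wf.
suff -> : sumn [seq (bar_weight u).+1 | u <- ts] = (size ts + sumn [seq bar_weight u | u <- ts])%N.
  by rewrite st; lia.
by elim: (ts) => //= u s ->; lia.
Qed.

End BarTree.

Arguments bkeys {P} t.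

(** * From bar trees to marked trees *)

(** A vertex evaluates its decoration on the values of its subtrees; marking their roots
records that they belong to other blocks. *)
Fixpoint phi (t : bar_tree QuadOp) : mmod :=
  match t with
  | BLeaf i => << MLeaf i >>
  | BNode k a ts => sgev a [seq markN (phi u) | u <- ts]
  end.

Section EvalStat.
Variable f : mtree -> seq nat.
Hypothesis f_node : forall x l r, f (MNode false x l r) = f l ++ f r.

Definition stat_seq (ys : seq mmod) (ss : seq (seq nat)) : Prop :=
  size ys = size ss /\
  forall i, (i < size ys)%N -> span (fun t => perm_eq (f t) (nth [::] ss i)) (nth 0 ys i).

Lemma evt_stat S ys ss : size ys = nleaves S -> stat_seq ys ss ->
  span (fun t => perm_eq (f t) (flatten ss)) (evt S ys).
Proof.
elim: S ys ss => [|x l IHl r IHr] ys ss hs [hss h] /=.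
  case: ys ss hs hss h => [|y []] // [|s []] // _ _ /(_ 0%N isT) /=.
  by apply: span_sub => t; rewrite cats0.
have [hl hr] : size (take (nleaves l) ys) = nleaves l /\ size (drop (nleaves l) ys) = nleaves r.
  by rewrite size_takel ?size_drop hs //= ?leq_addr // addKn.
have Hl : stat_seq (take (nleaves l) ys) (take (nleaves l) ss).
  split=> [|i]; first by rewrite !size_take hss.
  by rewrite hl => hi; rewrite !nth_take //; apply: h; rewrite hs /= ltn_addr.
have Hr : stat_seq (drop (nleaves l) ys) (drop (nleaves l) ss).
  split=> [|i]; first by rewrite !size_drop hss.
  by rewrite hr => hi; rewrite !nth_drop //; apply: h; rewrite hs /= ltn_add2l.
rewrite -[X in flatten X](cat_take_drop (nleaves l)) flatten_cat.
apply: span_bilin (IHl _ _ hl Hl) (IHr _ _ hr Hr) _ => s t hs' ht.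
apply: span_sub (mul_stat f_node x s t) => u ->; exact: perm_cat.
Qed.

Lemma ev_stat n (a : Quad' n) ys ss : size ys = n -> stat_seq ys ss ->
  span (fun t => perm_eq (f t) (flatten ss)) (ev a ys).
Proof.
move=> hs h; rewrite /ev /evF; apply: span_fglin (spanT _) _ => -[t tn] _ /=.
by apply: evt_stat => //; rewrite hs (eqP tn).
Qed.

Lemma sgev_stat n (a : QuadOp n) ys ss : size ys = n -> stat_seq ys ss ->
  span (fun t => perm_eq (f t) (flatten ss)) (sgev a ys).
Proof.
move=> hs [hss h]; apply: span_sum => s _.
have hp : perm_eq (flatten (arrange [::] s ss)) (flatten ss).
  by apply: perm_flatten; apply: perm_arrange; rewrite -hss.
apply: span_sub (ev_stat _ (size_arrange 0 s ys) (ss := arrange [::] s ss) _) => [t ht|].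
  exact: perm_trans ht hp.
split=> [|i hi]; first by rewrite !size_arrange.
have {}hi : (i < n)%N by move: hi; rewrite size_arrange.
rewrite !(nth_map 0%N) ?size_word //; apply: h; rewrite hs.
by rewrite (nth_word s (Ordinal hi)).
Qed.

End EvalStat.

Lemma evt_unode S ys : (1 < nleaves S)%N -> span is_unode (evt S ys).
Proof. by case: S => //= x l r _; exact: mulN_unode. Qed.

Lemma sgev_unode n (a : QuadOp n) ys : (1 < n)%N -> span is_unode (sgev a ys).
Proof.
move=> n1; apply: span_sum => s _; rewrite /ev /evF; apply: span_fglin (spanT _) _ => -[t tn] _ /=.
by apply: evt_unode; rewrite (eqP tn).
Qed.

Lemma evt_unmark A S ys : size ys = nleaves S ->
  fglin (unmark A) (evt S ys) = evt S [seq fglin (unmark A) y | y <- ys].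
Proof.
elim: S ys => [|x l IHl r IHr] ys hs /=; first by case: ys hs.
rewrite unmark_mulN IHl ?IHr ?map_take ?map_drop //.
  by rewrite size_drop hs /= addKn.
by rewrite size_takel // hs /= leq_addr.
Qed.

Lemma sgev_unmark A n (a : QuadOp n) ys : size ys = n ->
  fglin (unmark A) (sgev a ys) = sgev a [seq fglin (unmark A) y | y <- ys].
Proof.
move=> hs; rewrite fglin_sum; apply: eq_bigr => s _.
have -> : arrange 0 s [seq fglin (unmark A) y | y <- ys] = [seq fglin (unmark A) y | y <- arrange 0 s ys].
  by rewrite map_arrange // fglin0.
rewrite fglin_comp.
apply: fglin_eq => -[t tn] /=; rewrite evt_unmark //.
by rewrite size_arrange (eqP tn).
Qed.

Definition phi_type (t : bar_tree QuadOp) (u : mtree) : Prop :=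
  [/\ normal u, unmarked u, perm_eq (mleaves u) (bar_leaves t) & perm_eq (mkeys u) (ekeys t)].

Definition mphi (t : bar_tree QuadOp) : mmod := markN (phi t).

Definition mphi_type (t : bar_tree QuadOp) (u : mtree) : Prop :=
  [/\ normal u, perm_eq (mleaves u) (bar_leaves t) & perm_eq (mkeys u) (bkeys t)].

Lemma phi_unode k (a : QuadOp k) ts : (1 < k)%N -> span is_unode (phi (BNode a ts)).
Proof. exact: sgev_unode. Qed.

Lemma mphi_span t : bar_wf t -> span (phi_type t) (phi t) -> span (mphi_type t) (mphi t).
Proof.
case: t => [i _ _|k a ts wf h].
  by rewrite /mphi /markN /= fglinU; apply: spanU.
apply: markN_span (spanI h (phi_unode a ts _)) => [u|]; last by case/and3P: wf.
case: u => [i|[] x l r] [[nu _ lu ku] //= _]; split=> //=.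
by rewrite -(key_perm lu) perm_cons.
Qed.

Lemma phi_span t : bar_wf t -> span (phi_type t) (phi t).
Proof.
elim/bar_tree_induction: t => [i _|k a ts IH wf]; first by apply: spanU.
have /and3P[k1 /eqP st /allP wts] := wf.
have H u : u \in ts -> span (mphi_type u) (mphi u).
  by move=> hu; apply: mphi_span; [exact: wts | apply: IH => //; exact: wts].
have hn : normal_seq [seq mphi u | u <- ts].
  by move=> _ /mapP[u hu ->]; apply: span_sub (H u hu) => v [].
have hs : size [seq mphi u | u <- ts] = k by rewrite size_map.
have h1 : stat_seq mleaves [seq mphi u | u <- ts] [seq bar_leaves u | u <- ts].
  split=> [|i]; rewrite !size_map // => hi.
  rewrite !(nth_map (BLeaf 0)) //; apply: span_sub (H _ (mem_nth _ hi)) => v [] //.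
have h2 : stat_seq mkeys [seq mphi u | u <- ts] [seq bkeys u | u <- ts].
  split=> [|i]; rewrite !size_map // => hi.
  rewrite !(nth_map (BLeaf 0)) //; apply: span_sub (H _ (mem_nth _ hi)) => v [] //.
have := spanI (spanI (sgev_normal a hs hn) (sgev_unode a [seq mphi u | u <- ts] k1))
  (spanI (sgev_stat (fun _ _ _ => erefl) a hs h1) (sgev_stat (fun _ _ _ => erefl) a hs h2)).
by apply: span_sub => v [[nv mv] [lv kv]]; split=> //; case: v mv {nv lv kv} => // -[].
Qed.

(** * Contractions of edges and removal of marks *)

Lemma mphi_normal t : bar_wf t -> span normal (mphi t).
Proof. by move=> wf; apply: span_sub (mphi_span wf (phi_span wf)) => u []. Qed.

Lemma mphi_normal_seq ts : all bar_wf ts -> normal_seq [seq mphi u | u <- ts].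
Proof. by move=> /allP wf _ /mapP[u /wf hu ->]; exact: mphi_normal. Qed.

Lemma unmark_mphi_notin A u : bar_wf u -> A \notin bkeys u ->
  fglin (unmark A) (mphi u) = mphi u.
Proof.
move=> wf Au; rewrite -[RHS]fglin_id.
apply: fglin_eq_span (mphi_span wf (phi_span wf)) _ => t [nt _ kt].
by rewrite /unmark unm_id ?nf_id // (perm_mem kt).
Qed.

Lemma unmark_phi_notin A u : bar_wf u -> A \notin ekeys u ->
  fglin (unmark A) (phi u) = phi u.
Proof.
move=> wf Au; rewrite -[RHS]fglin_id.
apply: fglin_eq_span (phi_span wf) _ => t [nt _ _ kt].
by rewrite /unmark unm_id ?nf_id // (perm_mem kt).
Qed.

Definition is_bnode (P : operad) (t : bar_tree P) : bool := if t is BNode _ _ _ then true else false.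

Lemma unmark_mphi A u : bar_wf u -> is_bnode u ->
  fglin (unmark A) (mphi u) =
  if key (bar_leaves u) == A then fglin (unmark A) (phi u) else markN (fglin (unmark A) (phi u)).
Proof.
case: u => // k a us wf _; apply: unmark_markN; first by apply: phi_unode; case/and3P: wf.
by apply: span_sub (phi_span wf) => t [_ _ lt _]; exact: key_perm.
Qed.

Section ContractionList.
Variables (P : operad) (m : nat) (a : P m).

(** The inner loop of [contractions]: [ts1] lists the subtrees already passed. *)
Fixpoint contr_from (ts1 ts2 : seq (bar_tree P)) : seq (bar_tree P) :=
  match ts2 with
  | [::] => [::]
  | u :: ts3 =>
      (if u is BNode n b us
       then [:: BNode (ns_comp (m + n).-1 (size ts1) a b) (ts1 ++ us ++ ts3)]
       else [::])
      ++ [seq BNode a (ts1 ++ v :: ts3) | v <- contractions u]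
      ++ contr_from (rcons ts1 u) ts3
  end.

Lemma contractionsE ts : contractions (BNode a ts) = contr_from [::] ts.
Proof. by []. Qed.

End ContractionList.

(** Contracting the edge number [l] removes its key, and corresponds to removing the mark
with this key. *)
Definition contr_spec (t : bar_tree QuadOp) (l : nat) (t' : bar_tree QuadOp) : Prop :=
  [/\ bar_wf t' && is_bnode t', bar_leaves t' = bar_leaves t,
      ekeys t' = take l (ekeys t) ++ drop l.+1 (ekeys t) &
      phi t' = fglin (unmark (nth 0%N (ekeys t) l)) (phi t)].

Definition contr_list t l cs n : Prop :=
  size cs = n /\ forall j, (j < n)%N -> contr_spec t (l + j) (nth t cs j).

Lemma contr_list_cat t l c1 c2 n1 n2 :
  contr_list t l c1 n1 -> contr_list t (l + n1) c2 n2 -> contr_list t l (c1 ++ c2) (n1 + n2).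
Proof.
move=> [s1 h1] [s2 h2]; split=> [|j hj]; first by rewrite size_cat s1 s2.
rewrite nth_cat s1; case: ltnP => hj1; first exact: h1.
have -> : (l + j = l + n1 + (j - n1))%N by lia.
by apply: h2; lia.
Qed.

Lemma delete_cat (T : Type) (s1 s2 s3 : seq T) l : (l < size s2)%N ->
  take (size s1 + l) (s1 ++ s2 ++ s3) ++ drop (size s1 + l).+1 (s1 ++ s2 ++ s3) =
  s1 ++ (take l s2 ++ drop l.+1 s2) ++ s3.
Proof.
case: s2 => // x0 s2 hl.
have E : s1 ++ (x0 :: s2) ++ s3 =
    (s1 ++ take l (x0 :: s2)) ++ nth x0 (x0 :: s2) l :: (drop l.+1 (x0 :: s2) ++ s3).
  by rewrite -catA -cat_cons -drop_nth // [take _ _ ++ _]catA cat_take_drop.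
have hs : size (s1 ++ take l (x0 :: s2)) = (size s1 + l)%N by rewrite size_cat size_takel // ltnW.
by rewrite E -hs take_size_cat // -cat_rcons drop_size_cat ?size_rcons // !catA.
Qed.

Section OneChild.
Variables (m : nat) (a : QuadOp m) (ts1 ts3 : seq (bar_tree QuadOp)).
Variables (n : nat) (b : QuadOp n) (us : seq (bar_tree QuadOp)).
Let u := BNode b us.
Let t := BNode a (ts1 ++ u :: ts3).
Let L1 := flatten [seq bkeys v | v <- ts1].
Let L3 := flatten [seq bkeys v | v <- ts3].
Hypothesis gt : good t.

Let wft : bar_wf t. Proof. by case/andP: gt. Qed.
Let wf1 : all bar_wf ts1. Proof. by case/and3P: wft => _ _; rewrite all_cat => /andP[]. Qed.
Let wf3 : all bar_wf ts3. Proof. by case/and3P: wft => _ _; rewrite all_cat => /and3P[]. Qed.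
Let wfu : bar_wf u. Proof. by case/and3P: wft => _ _; rewrite all_cat => /and3P[]. Qed.
Let st : (size ts1 + (size ts3).+1 = m)%N.
Proof. by case/and3P: wft => _ /eqP <- _; rewrite size_cat. Qed.
Let m1 : (1 < m)%N. Proof. by case/and3P: wft. Qed.
Let n1 : (1 < n)%N. Proof. by case/and3P: wfu. Qed.
Let su : size us = n. Proof. by case/and3P: wfu => _ /eqP. Qed.
Let wfus : all bar_wf us. Proof. by case/and3P: wfu. Qed.

Let ekeys_t : ekeys t = L1 ++ (key (bar_leaves u) :: ekeys u) ++ L3.
Proof. by rewrite /ekeys /= map_cat flatten_cat. Qed.

Let uniq_t : uniq (L1 ++ (key (bar_leaves u) :: ekeys u) ++ L3).
Proof. by have := uniq_bkeys gt; rewrite bkeysE ekeys_t => /andP[]. Qed.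

Let fix1 A : A \in key (bar_leaves u) :: ekeys u ->
  map (fglin (unmark A)) (map mphi ts1) = map mphi ts1.
Proof.
move=> hA; rewrite -map_comp; apply/eq_in_map => v hv /=.
apply: unmark_mphi_notin; first exact: (allP wf1).
apply/negP => Av; apply: uniq_cat_disj uniq_t (sub_flatten_map hv Av) _.
by rewrite mem_cat hA.
Qed.

Let fix3 A : A \in key (bar_leaves u) :: ekeys u ->
  map (fglin (unmark A)) (map mphi ts3) = map mphi ts3.
Proof.
move=> hA; rewrite -map_comp; apply/eq_in_map => v hv /=.
apply: unmark_mphi_notin; first exact: (allP wf3).
move: uniq_t; rewrite cat_uniq => /and3P[_ _ U].
by apply/negP => Av; apply: uniq_cat_disj U hA (sub_flatten_map hv Av).
Qed.

Let phi_t A : A \in key (bar_leaves u) :: ekeys u ->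
  fglin (unmark A) (phi t) = sgev a (map mphi ts1 ++ fglin (unmark A) (mphi u) :: map mphi ts3).
Proof.
move=> hA; rewrite sgev_unmark; last by rewrite size_map size_cat.
by rewrite map_cat map_cat [map _ (_ :: _)]/= [map _ (_ :: _)]/= fix1 // fix3.
Qed.

Let uniq_u : uniq (key (bar_leaves u) :: ekeys u).
Proof. by move: uniq_t; rewrite !cat_uniq => /and3P[_ _ /and3P[]]. Qed.

(** Without its mark, the value of the subtree [u] is that of its root decoration on [us]. *)
Lemma contr_child : contr_spec t (size L1)
  (BNode (ns_comp (m + n).-1 (size ts1) a b) (ts1 ++ us ++ ts3)).
Proof.
split.
- rewrite /= !andbT !all_cat wf1 wfus wf3 !size_cat su.
  by have := st; have := m1; have := n1; lia.
- by rewrite /= !map_cat !flatten_cat /= !catA.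
- by rewrite ekeys_t take_size_cat // -cat_rcons drop_size_cat ?size_rcons // /ekeys /= !map_cat !flatten_cat.
rewrite ekeys_t nth_cat ltnn subnn /= phi_t ?mem_head // unmark_mphi // eqxx.
rewrite unmark_phi_notin //; last by case/andP: uniq_u.
rewrite !map_cat -(size_map mphi ts1).
apply: sgev_comp; rewrite ?size_map //; first by have := m1; lia.
rewrite -!map_cat; apply: mphi_normal_seq; rewrite !all_cat wf1 wf3.
by rewrite wfus.
Qed.

Lemma contr_inside l v : (l < size (ekeys u))%N -> contr_spec u l v ->
  contr_spec t (size L1 + l.+1) (BNode a (ts1 ++ v :: ts3)).
Proof.
move=> lu [/andP[wfv nv] lv kv phiv].
have ku : bkeys v = key (bar_leaves u) :: (take l (ekeys u) ++ drop l.+1 (ekeys u)).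
  by rewrite bkeysE -lv -kv; case: (v) nv.
split.
- by rewrite /= !andbT m1 !all_cat /= wf1 wf3 wfv !size_cat /= st eqxx.
- by rewrite /= !map_cat !flatten_cat /= lv.
- rewrite ekeys_t /ekeys /= map_cat flatten_cat /= ku -/L1 -/L3.
  by rewrite (@delete_cat _ L1 (key _ :: ekeys u) L3 l.+1).
rewrite ekeys_t nth_cat ltnNge leq_addr /= addKn /= nth_cat lu.
have hA : nth 0%N (ekeys u) l \in ekeys u by rewrite mem_nth.
rewrite phi_t ?inE ?hA ?orbT // unmark_mphi // ifF; last first.
  by apply/negbTE; apply: contraTneq uniq_u => ->; rewrite /= hA.
by rewrite -phiv map_cat.
Qed.

End OneChild.

Lemma contr_from_spec m (a : QuadOp m) ts1 ts2 :
  good (BNode a (ts1 ++ ts2)) ->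
  (forall u, u \in ts2 -> good u -> contr_list u 0 (contractions u) (size (ekeys u))) ->
  contr_list (BNode a (ts1 ++ ts2)) (size (flatten [seq bkeys u | u <- ts1]))
    (contr_from a ts1 ts2) (size (flatten [seq bkeys u | u <- ts2])).
Proof.
elim: ts2 ts1 => [|u ts3 IH] ts1 gt H /=; first by [].
have gu : good u by apply: good_child gt _; rewrite mem_cat mem_head orbT.
have Hu := H u (mem_head _ _) gu.
have {IH} := IH (rcons ts1 u); rewrite cat_rcons map_rcons flatten_rcons size_cat.
move=> /(_ gt) IH.
rewrite size_cat catA; apply: contr_list_cat; last first.
  by apply: IH => v hv; apply: H; rewrite inE hv orbT.
case: u gt {H IH} gu Hu => [i|n b us] gt gu [Hs Hu] //=.
rewrite -[X in contr_list _ _ _ X]add1n -[X in contr_list _ _ X _]cat1s.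
apply: contr_list_cat; first by split=> // -[|j] // _; rewrite addn0; exact: contr_child.
split=> [|j hj]; first by rewrite size_map Hs.
rewrite (nth_map (BNode b us)) ?Hs // -addnA add1n.
apply: contr_inside => //; exact: Hu.
Qed.

Lemma contractions_spec t : good t -> contr_list t 0 (contractions t) (size (ekeys t)).
Proof.
elim/bar_tree_induction: t => [i _|k a ts IH gt]; first by [].
by rewrite contractionsE; apply: (contr_from_spec (ts1 := [::])).
Qed.

(** * The chain map to marked trees *)

(** This number compares the depth first order of the edges with the order of their keys; its
parity turns signs that depend on the planar structure into signs that do not. *)
Definition kappa (P : operad) (t : bar_tree P) : nat := inv (ekeys t).

Definition Phi (t : bar_tree QuadOp) : mmod :=
  if good t then sgn (kappa t) (phi t) else 0.
Definition PhiN : {freeg (bar_tree QuadOp)} -> mmod := fglin Phi.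

Lemma dmarkN_phi t : bar_wf t ->
  dmarkN (phi t) = \sum_(l < size (ekeys t))
    sgn (rank (nth 0%N (ekeys t) l) (ekeys t)) (fglin (unmark (nth 0%N (ekeys t) l)) (phi t)).
Proof.
move=> wf; rewrite /dmarkN.
rewrite (fglin_eq_span (g := fun u => \sum_(A <- ekeys t) sgn (rank A (ekeys t)) (unmark A u)) (phi_span wf)).
  rewrite fglin_sumf (big_nth 0%N) big_mkord.
  by apply: eq_bigr => l _; rewrite fglin_sgnf.
move=> u [_ _ _ ku]; rewrite /dmark (perm_big _ ku).
by apply: eq_bigr => A _; rewrite (rank_perm _ ku).
Qed.

(** The sign of the contraction number [l] becomes the sign of the rank of its key, by
[inv_delete]. *)
Lemma PhiN_diff t : good t -> PhiN (bar_diff << t >>) = dmarkN (Phi t).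
Proof.
move=> gt; have [hs hc] := contractions_spec gt; have /andP[wft ut] := gt.
rewrite /Phi gt /dmarkN fglin_sgn -/(dmarkN _) dmarkN_phi // sgn_sum.
rewrite /PhiN /bar_diff fglinU fglin_sum -hs; apply: eq_bigr => l _.
have hl : (l < size (ekeys t))%N by rewrite -hs.
have [/andP[wf' _] lv kv ph] := hc l hl; rewrite add0n in lv kv ph wf'.
rewrite freegU_sgn fglin_sgn fglinU /Phi /good wf' lv ut /= ph -!sgnD; apply: sgn_mod2.
rewrite addnC [in RHS]addnC /kappa kv.
have := @inv_delete (take l (ekeys t)) (nth 0%N (ekeys t) l) (drop l.+1 (ekeys t)).
rewrite -drop_nth // cat_take_drop size_takel ?(ltnW hl) // => -> //; first by rewrite addnC.
by have := uniq_bkeys gt; rewrite /ekeys; case: (bkeys t) => //= A s /andP[].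
Qed.

Definition add_type (t t' : bar_tree QuadOp) : Prop :=
  [/\ bar_wf t' = bar_wf t, bar_leaves t' = bar_leaves t & bkeys t' = bkeys t].

Lemma add_type_in k (a : QuadOp k) ts1 ts2 t t' : add_type t t' ->
  add_type (BNode a (ts1 ++ t :: ts2)) (BNode a (ts1 ++ t' :: ts2)).
Proof.
case=> h1 h2 h3; split=> /=.
- by rewrite !all_cat !size_cat /= h1.
- by rewrite !map_cat !flatten_cat /= h2.
by rewrite !map_cat !flatten_cat /= h2 h3.
Qed.

Lemma map_slot (T T' : Type) (f : T -> T') (s1 s2 : seq T) x :
  [seq f y | y <- s1 ++ x :: s2] = [seq f y | y <- s1] ++ f x :: [seq f y | y <- s2].
Proof. by rewrite map_cat. Qed.

Lemma bar_addP t t1 t2 : @bar_add QuadOp t t1 t2 ->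
  [/\ add_type t t1, add_type t t2 & bar_wf t -> phi t = phi t1 + phi t2].
Proof.
elim=> [k a b ts|k a ts1 ts2 {}t {}t1 {}t2 _ [h1 h2 h3]].
  split=> // /and3P[_ /eqP hs wf]; apply: sgevD; rewrite ?size_map //.
  exact: mphi_normal_seq.
split; try exact: add_type_in.
case/and3P=> _ /eqP hs; rewrite all_cat /= => /and3P[_ wf _].
rewrite /= !map_slot (h3 wf) /markN fglinD; apply: sgev_slotD.
by rewrite !size_map -hs size_cat.
Qed.

Definition act_type (e : nat) (t t' : bar_tree QuadOp) : Prop :=
  [/\ bar_wf t' = bar_wf t, perm_eq (bar_leaves t') (bar_leaves t) &
      good t -> odd (kappa t' + e) = odd (kappa t)].

Lemma arrange_dflt (T : Type) (x0 x1 : T) n (s : 'S_n) ys : size ys = n ->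
  arrange x0 s ys = arrange x1 s ys.
Proof.
by move=> h; apply/eq_in_map => j; rewrite mem_word -h => hj; exact: set_nth_default.
Qed.

Lemma bar_act_bnode e t t1 : @bar_act QuadOp e t t1 -> is_bnode t /\ is_bnode t1.
Proof. by case. Qed.

Lemma bar_actP e t t1 : @bar_act QuadOp e t t1 ->
  [/\ act_type e t t1, perm_eq (bkeys t1) (bkeys t) & bar_wf t -> phi t = phi t1].
Proof.
elim=> [k a s ts hs|k a ts1 ts2 {}e {}t {}t1 hact [[w l o] kp p]].
  set ts' := [seq _ | i <- word s].
  have hts' : ts' = arrange (BLeaf 0) s ts by [].
  have pts : perm_eq ts' ts by exact: perm_arrange.
  have pL : perm_eq (flatten (map bar_leaves ts')) (flatten (map bar_leaves ts)).
    by apply: perm_flatten; apply: perm_map.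
  have pK : perm_eq (flatten (map bkeys ts')) (flatten (map bkeys ts)).
    by apply: perm_flatten; apply: perm_map.
  split; last 1 first.
  - move=> _; rewrite /= sgev_act hts' map_arrange //.
    by rewrite (arrange_dflt 0 (markN (phi (BLeaf 0)))) // size_map.
  - split=> //=; first by rewrite (perm_size pts) (perm_all _ pts).
    move=> gt.
    have E : flatten (map bkeys ts') = flatten [seq nth [::] (map bkeys ts) i | i <- word s].
      by rewrite hts' map_arrange.
    rewrite /kappa /ekeys /= E oddD (inv_flatten_perm s) ?size_map //; last first.
      by have := uniq_bkeys gt => /= /andP[].
    rewrite oddD -addbA; set x := (\sum_(i < k) _)%N.
    suff -> : x = act_exponent s ts by rewrite addbb addbF.
    apply: eq_bigr => i _; apply: eq_bigr => j _.
    by rewrite !(nth_map (BLeaf 0)) ?hs // !size_bkeys.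
  by rewrite /= (key_perm pL) perm_cons.
have pL : perm_eq (flatten (map bar_leaves (ts1 ++ t1 :: ts2))) (flatten (map bar_leaves (ts1 ++ t :: ts2))).
  by rewrite !map_cat !flatten_cat /= perm_cat2l perm_cat2r.
split.
- split=> //=; first by rewrite !all_cat !size_cat /= w.
  move=> gt; have gt' : good t by apply: good_child gt _; rewrite mem_cat mem_head orbT.
  have := inv_perm_mid (flatten (map bkeys ts1)) (flatten (map bkeys ts2)) kp.
  rewrite /kappa /ekeys /= !map_cat !flatten_cat /=.
  have [n0 n1] := bar_act_bnode hact.
  have E (v : bar_tree QuadOp) : is_bnode v -> inv (bkeys v) = (rank (key (bar_leaves v)) (ekeys v) + kappa v)%N.
    by case: v.
  rewrite !E // (key_perm l).
  have -> : rank (key (bar_leaves t)) (ekeys t1) = rank (key (bar_leaves t)) (ekeys t).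
    apply: rank_perm; move: kp; rewrite !bkeysE; case: (t) (t1) n0 n1 l => [//|? ? ?] [//|? ? ?] _ _ l.
    by rewrite (key_perm l) perm_cons.
  have := o gt'; set K1 := inv (_ ++ bkeys t1 ++ _); set K := inv (_ ++ _ ++ _).
  move: (rank _ _) (kappa t1) (kappa t) => r x y h1 h2.
  have : (odd (K1 + y) = odd (K + x))%N by congr odd; lia.
  by rewrite !oddD; move: h1; rewrite oddD; case: (odd x); case: (odd y); case: (odd e); case: (odd K); case: (odd K1).
- by rewrite /= (key_perm pL) perm_cons !map_cat !flatten_cat /= perm_cat2l perm_cat2r.
case/and3P=> _ _; rewrite all_cat /= => /and3P[_ wf _].
by rewrite /= !map_slot (p wf).
Qed.

Lemma PhiN_rel c : bar_rel c -> PhiN c = 0.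
Proof.
rewrite /PhiN; elim=> {c} [c [[t [t1 [t2 [/bar_addP[h1 h2 h3] ->]]]]|[e [t [t1 [/bar_actP[[w l o] k p] ->]]]]]||c c' _ h _ h'].
- rewrite !fglinB !fglinU /Phi /good.
  have [-> -> e1] := h1; have [-> -> e2] := h2.
  have -> : kappa t1 = kappa t by rewrite /kappa /ekeys e1.
  have -> : kappa t2 = kappa t by rewrite /kappa /ekeys e2.
  case: ifP => [/andP[wf _]|]; last by rewrite !subr0.
  by rewrite h3 // sgnDr -addrA -opprD subrr.
- rewrite fglinB freegU_sgn fglin_sgn !fglinU /Phi.
  have -> : good t1 = good t by rewrite /good w (perm_uniq l).
  case: ifP => [gt|]; last by rewrite sgnr0 subr0.
  have /andP[wf _] := gt; rewrite p // -sgnD addnC (sgn_mod2 _ (o gt)) subrr //.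
- exact: fglin0.
by rewrite fglinB h h' subr0.
Qed.

(** * From marked trees to bar trees *)

Fixpoint skel (t : mtree) : otree :=
  match t with
  | MNode false x l r => PNode x (skel l) (skel r)
  | _ => PLeaf
  end.

Definition planar k (q : Quad' k) : QuadOp k := sg_elt q 1%g.

Definition qtree k (S : otree) : Quad' k := quo_pi (@bq_rel Quad) (tree_elt k S).

(** The subtrees attached to the block of the root: cutting below a marked vertex gives a
single bar tree, and the lists for the two sides of an unmarked vertex are concatenated. *)
Fixpoint bars_of (t : mtree) : seq (bar_tree QuadOp) :=
  match t with
  | MLeaf i => [:: BLeaf i]
  | MNode b x l r =>
      let ts := bars_of l ++ bars_of r in
      if b then [:: BNode (planar (qtree (size ts) (PNode x (skel l) (skel r)))) ts] else ts
  end.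

Definition bar_of (t : mtree) : bar_tree QuadOp :=
  match t with
  | MLeaf i => BLeaf i
  | MNode _ x l r =>
      let ts := bars_of l ++ bars_of r in
      BNode (planar (qtree (size ts) (PNode x (skel l) (skel r)))) ts
  end.

Lemma size_bars_of t : size (bars_of t) = nleaves (skel t).
Proof. by elim: t => //= -[] // x l hl r hr; rewrite size_cat hl hr. Qed.

Lemma bars_of_mark t : bars_of (mark t) = [:: bar_of t].
Proof. by case: t. Qed.

Lemma bars_of_wf t : all bar_wf (bars_of t).
Proof.
elim: t => // b x l hl r hr; have h : all bar_wf (bars_of l ++ bars_of r) by rewrite all_cat hl hr.
case: b => //=; rewrite h eqxx andbT !andbT size_cat !size_bars_of.
by have := nleaves_gt0 (skel l); have := nleaves_gt0 (skel r); lia.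
Qed.

Lemma bar_of_wf t : bar_wf (bar_of t).
Proof. by have := bars_of_wf (mark t); rewrite bars_of_mark /= andbT. Qed.

Lemma bars_of_leaves t : flatten [seq bar_leaves u | u <- bars_of t] = mleaves t.
Proof.
by elim: t => //= -[] x l hl r hr /=; rewrite ?cats0 map_cat flatten_cat hl hr.
Qed.

Lemma bar_of_leaves t : bar_leaves (bar_of t) = mleaves t.
Proof. by have := bars_of_leaves (mark t); rewrite bars_of_mark /= cats0 mleaves_mark. Qed.

Lemma bars_of_keys t : flatten [seq bkeys u | u <- bars_of t] = mkeys t.
Proof.
elim: t => //= -[] x l hl r hr /=; last by rewrite map_cat flatten_cat hl hr.
by rewrite cats0 !map_cat !flatten_cat hl hr !bars_of_leaves.
Qed.

Lemma bar_of_keys t : unmarked t -> ekeys (bar_of t) = mkeys t.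
Proof. by case: t => // -[] //= x l r _; rewrite /ekeys /= map_cat flatten_cat !bars_of_keys. Qed.

Lemma sgev_planar k (q : Quad' k) ys : size ys = k -> normal_seq ys ->
  sgev (planar q) ys = ev q ys.
Proof. by move=> hs hn; rewrite sgevU // arrange1. Qed.

Lemma ev_qtree k S ys : nleaves S = k -> size ys = k -> normal_seq ys ->
  ev (qtree k S) ys = evt S ys.
Proof. by move=> hS hs hn; rewrite ev_pi // evF_tree. Qed.

Lemma mphi_bars_of t : normal t -> evt (skel t) [seq mphi u | u <- bars_of t] = << t >>.
Proof.
elim: t => [i _|b x l hl r hr /= /and3P[/hl {}hl /hr {}hr xl]].
  by rewrite /= /mphi /markN fglinU.
have E : evt (PNode x (skel l) (skel r)) [seq mphi u | u <- bars_of l ++ bars_of r] = << MNode false x l r >>.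
  rewrite map_cat evt_node ?size_map ?size_bars_of // hl hr /mulN bilinU mul_ncrit //.
case: b => //=; rewrite /mphi /= sgev_planar ?size_map //; last first.
  by apply: mphi_normal_seq; rewrite all_cat !bars_of_wf.
rewrite ev_qtree ?size_map //; last by apply: mphi_normal_seq; rewrite all_cat !bars_of_wf.
  by rewrite E /markN fglinU.
by rewrite size_cat !size_bars_of.
Qed.

(** As the tree is normal, all the products in the evaluation are graftings. *)
Lemma phi_bar_of t : normal t -> unmarked t -> phi (bar_of t) = << t >>.
Proof.
case: t => // -[] // x l r nt _; rewrite /= sgev_planar ?size_map //; last first.
  by apply: mphi_normal_seq; rewrite all_cat !bars_of_wf.
rewrite ev_qtree ?size_map //.
- exact: mphi_bars_of nt.
- by rewrite /= size_cat !size_bars_of.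
by apply: mphi_normal_seq; rewrite all_cat !bars_of_wf.
Qed.

(** * Skeletons *)

Lemma qtree_comp k m n i S T : nleaves S = m -> nleaves T = n -> k.+1 = (m + n)%N -> (i < m)%N ->
  ns_comp k i (qtree m S) (qtree n T) = qtree k (graft i S T).
Proof.
move=> hS hT hk im; transitivity (quo_pi (@bq_rel Quad) (ns_comp k i (tree_elt m S : free_ns_operad op m) (tree_elt n T : free_ns_operad op n))).
  exact: quo_compE.
by congr quo_pi; exact: fr_compU.
Qed.

Section NodeQ.
Variables (k m n : nat).
Hypothesis kmn : k = (m + n)%N.

(** Grafting on a vertex [x] makes the operad, summed over the arities, the free quadri-algebra
on one generator. *)
Definition nodeQ (x : op) (p : Quad' m) (q : Quad' n) : Quad' k :=
  ns_comp k m (ns_comp m.+1 0 (qtree 2 (PNode x PLeaf PLeaf)) p) q.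

Lemma nodeQBl x p p' q : nodeQ x (p - p') q = nodeQ x p q - nodeQ x p' q.
Proof. by rewrite /nodeQ ns_compBr // ns_compBl //; lia. Qed.

Lemma nodeQBr x p q q' : nodeQ x p (q - q') = nodeQ x p q - nodeQ x p q'.
Proof. by rewrite /nodeQ ns_compBr //; lia. Qed.

Lemma nodeQ_tree x S T : nleaves S = m -> nleaves T = n ->
  nodeQ x (qtree m S) (qtree n T) = qtree k (PNode x S T).
Proof.
move=> hS hT; rewrite /nodeQ (qtree_comp (m := 2)) // qtree_comp //=; try lia.
by rewrite hS ltnn.
Qed.

End NodeQ.

Lemma fglin_map (K : choiceType) (M M' : zmodType) (h : M -> M') (f : K -> M) c :
  (forall v w, h (v - w) = h v - h w) -> h (fglin f c) = fglin (fun x => h (f x)) c.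
Proof.
move=> hB; have h0 : h 0 = 0 by rewrite -(subrr 0) hB subrr.
by elim/freeg_indB: c => [|c c' e e'|x]; rewrite ?fglin0 // ?fglinB ?hB ?e ?e' // !fglinU.
Qed.

Lemma comp1_tree (X : Type) (x y : X) :
  comp1 (gen x) (gen y) = tree_elt 3 (PNode x (PNode y PLeaf PLeaf) PLeaf).
Proof. exact: fr_compU. Qed.

Lemma comp2_tree (X : Type) (x y : X) :
  comp2 (gen x) (gen y) = tree_elt 3 (PNode x PLeaf (PNode y PLeaf PLeaf)).
Proof. exact: fr_compU. Qed.

(** The relator is composed with the three trees from right to left, so that the positions of
the remaining inputs do not change. *)
Lemma qtree_rel k x y S1 S2 S3 : op_le x y ->
  k = (nleaves S1 + nleaves S2 + nleaves S3)%N ->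
  \sum_(z <- left_ops x y) qtree k (PNode x (PNode z S1 S2) S3) =
  \sum_(z <- right_ops x y) qtree k (PNode y S1 (PNode z S2 S3)).
Proof.
move=> xy hk; set n1 := nleaves S1 in hk; set n2 := nleaves S2 in hk; set n3 := nleaves S3 in hk.
pose F (f : free_ns_operad op 3) : free_ns_operad op k :=
  fr_comp k 0 (fr_comp (n2 + n3).+1 1 (fr_comp n3.+2 2 f (tree_elt n3 S3)) (tree_elt n2 S2))
    (tree_elt n1 S1).
have FB f g : F (f - g) = F f - F g by rewrite /F !fr_compBl.
have F0 : F 0 = 0 by rewrite -(subrr 0) FB subrr.
have F_sum s (G : op -> free_ns_operad op 3) : F (\sum_(z <- s) G z) = \sum_(z <- s) F (G z).
  have FD f g : F (f + g) = F f + F g by rewrite -[g in LHS]opprK FB -[- g in LHS]sub0r FB F0 sub0r opprK.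
  exact: (big_morph F FD F0).
have F1 z w : F (comp1 (gen z) (gen w)) = tree_elt k (PNode z (PNode w S1 S2) S3).
  by rewrite comp1_tree /F !fr_compU //= -?/n2 -?/n3; lia.
have F2 z w : F (comp2 (gen z) (gen w)) = tree_elt k (PNode z S1 (PNode w S2 S3)).
  by rewrite comp2_tree /F !fr_compU //= -?/n2 -?/n3; lia.
have : @ns_ideal _ (@bq_rel Quad) k (F (relator x y)).
  apply: ns_ideal_compl; [by lia | by [] |].
  apply: ns_ideal_compl; [by lia | by [] |].
  apply: ns_ideal_compl; [by lia | by [] |].
  exact/ns_ideal_gen/relator_in.
rewrite /relator FB !F_sum => /quo_piP.
have piS s (G : op -> free_ns_operad op k) : quo_pi (@bq_rel Quad) (\sum_(z <- s) G z) = \sum_(z <- s) quo_pi (@bq_rel Quad) (G z).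
  have pi0 : quo_pi (@bq_rel Quad) (0 : free_ns_operad op k) = 0.
    by apply: (addrI (quo_pi (@bq_rel Quad) (0 : free_ns_operad op k))); rewrite -quo_piD !addr0.
  exact: (big_morph _ (@quo_piD _ _ _) pi0).
rewrite !piS; under eq_bigr do rewrite F1.
by under [X in _ = X -> _]eq_bigr do rewrite F2.
Qed.

Definition qskel k (t : mtree) : Quad' k := qtree k (skel t).

Lemma qskel_node k m n x l r : k = (m + n)%N -> nleaves (skel l) = m -> nleaves (skel r) = n ->
  qskel k (MNode false x l r) = nodeQ k x (qskel m l) (qskel n r).
Proof. by move=> h hl hr; rewrite nodeQ_tree. Qed.

Definition skel_size n (t : mtree) : Prop := nleaves (skel t) = n.

Lemma mul_skel_size x s t :
  span (skel_size (nleaves (skel s) + nleaves (skel t))) (mul x s t).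
Proof.
have := mul_stat (phi := fun t => nseq (nleaves (skel t)) 0%N) _ x s t.
move=> h; apply: span_sub (h _) => [u /(congr1 size)|y l r].
  by rewrite size_cat !size_nseq.
by rewrite /= nseqD.
Qed.

(** Rewriting uses relations that hold in the operad, by [qtree_rel]. *)
Lemma qskel_mul k x s t : k = (nleaves (skel s) + nleaves (skel t))%N ->
  fglin (qskel k) (mul x s t) = qskel k (MNode false x s t).
Proof.
move: x s t k; apply: mul_ind => [x s t h|x y a b t xy IHa IHb] k hk.
  by rewrite mul_ncrit // fglinU.
have hk1 : k = (nleaves (skel a) + (nleaves (skel b) + nleaves (skel t)))%N by rewrite hk /= addnA.
rewrite mul_crit // fglinB !fglin_sum.
have E1 z : fglin (qskel k) (nodeN y << a >> (mul z b t)) =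
    qskel k (MNode false y a (MNode false z b t)).
  rewrite (qskel_node _ hk1) // -IHb // fglin_map; last first.
    by move=> v w; rewrite nodeQBr.
  rewrite /nodeN bilinUl fglin_comp; apply: fglin_eq_span (mul_skel_size z b t) _ => u hu.
  by rewrite fglinU (qskel_node _ hk1).
have E2 z : fglin (qskel k) (nodeN x (mul z a b) << t >>) =
    qskel k (MNode false x (MNode false z a b) t).
  rewrite (qskel_node _ hk) // -IHa // (fglin_map (h := fun p => nodeQ k x p _)); last first.
    by move=> v w; rewrite nodeQBl.
  rewrite /nodeN bilinUr fglin_comp; apply: fglin_eq_span (mul_skel_size z a b) _ => u hu.
  by rewrite fglinU (qskel_node _ hk).
under eq_bigr do rewrite E1.
under [X in _ - X]eq_bigr do rewrite E2.
rewrite /qskel /= -qtree_rel // ?sum_left_ops // ?addrK // hk1; lia.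
Qed.

Lemma evt_skel_size S ys : size ys = nleaves S ->
  (forall y, y \in ys -> span (skel_size 1) y) -> span (skel_size (nleaves S)) (evt S ys).
Proof.
elim: S ys => [|x l IHl r IHr] ys hs h /=.
  by case: ys hs h => [|y []] // _ h; apply: h; rewrite mem_head.
apply: span_bilin (IHl _ _ _) (IHr _ _ _) _ => [|y hy||y hy|s t hs' ht].
- by rewrite size_takel // hs leq_addr.
- by apply: h; rewrite -(cat_take_drop (nleaves l) ys) mem_cat hy.
- by rewrite size_drop hs /= addKn.
- by apply: h; rewrite -(cat_take_drop (nleaves l) ys) mem_cat hy orbT.
by have := mul_skel_size x s t; rewrite hs' ht.
Qed.

Lemma qskel_evt S ys k : nleaves S = k -> size ys = k ->
  (forall y, y \in ys -> exists t, y = << mark t >>) ->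
  fglin (qskel k) (evt S ys) = qtree k S.
Proof.
move=> <-; elim: S ys => [|x l IHl r IHr] ys hs h /=.
  case: ys hs h => [|y []] // _ /(_ y (mem_head _ _))[t ->] /=.
  by rewrite fglinU; case: t.
have h1 y : y \in take (nleaves l) ys -> exists t, y = << mark t >>.
  by move=> hy; apply: h; rewrite -(cat_take_drop (nleaves l) ys) mem_cat hy.
have h2 y : y \in drop (nleaves l) ys -> exists t, y = << mark t >>.
  by move=> hy; apply: h; rewrite -(cat_take_drop (nleaves l) ys) mem_cat hy orbT.
have s1 : size (take (nleaves l) ys) = nleaves l by rewrite size_takel // hs leq_addr.
have s2 : size (drop (nleaves l) ys) = nleaves r by rewrite size_drop hs /= addKn.
have sz y : (exists t, y = << mark t >>) -> span (skel_size 1) y.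
  by move=> [t ->]; apply: spanU; case: t.
have hl := evt_skel_size s1 (fun y hy => sz y (h1 y hy)).
have hr := evt_skel_size s2 (fun y hy => sz y (h2 y hy)).
rewrite -(nodeQ_tree (m := nleaves l) (n := nleaves r) erefl x erefl erefl) -(IHl _ s1 h1) -(IHr _ s2 h2).
rewrite (fglin_map (h := fun p => nodeQ _ x p _)) => [|v w]; last by rewrite nodeQBl.
rewrite /mulN fglin_comp; apply: fglin_eq_span hl _ => s hs'.
rewrite fglin_comp fglin_map => [|v w]; last by rewrite nodeQBr.
apply: fglin_eq_span hr _ => t ht; rewrite qskel_mul ?hs' ?ht //.
exact: qskel_node.
Qed.

(** * Bar trees modulo the unsigned relations *)

Notation bmod := {freeg (bar_tree QuadOp)}.

(** The restriction to trees with the same leaves makes these relations stable under plugging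
into a larger tree. *)
Definition urel (L : seq nat) : set bmod :=
  zspan ([set c | exists t t1 t2, [/\ bar_add t t1 t2, good t, perm_eq (bar_leaves t) L &
                    c = << t >> - << t1 >> - << t2 >>]]
     `|` [set c | exists e t t1, [/\ bar_act e t t1, good t, perm_eq (bar_leaves t) L &
                    c = << t >> - << t1 >>]]).

Lemma urel0 L : urel L 0. Proof. exact: zspan0. Qed.
Lemma urelB L c d : urel L c -> urel L d -> urel L (c - d). Proof. exact: zspanB. Qed.
Lemma urelN L c : urel L c -> urel L (- c).
Proof. by rewrite -sub0r; apply/urelB/urel0. Qed.
Lemma urelD L c d : urel L c -> urel L d -> urel L (c + d).
Proof. by move=> h /urelN h'; rewrite -[d]opprK; apply: urelB. Qed.
Lemma urel_trans L c d e : urel L (c - d) -> urel L (d - e) -> urel L (c - e).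
Proof. by move=> h h'; have := urelD h h'; rewrite addrA subrK. Qed.
Lemma urel_sym L c d : urel L (c - d) -> urel L (d - c).
Proof. by move/urelN; rewrite opprB. Qed.
Lemma urel_refl L c : urel L (c - c).
Proof. by rewrite subrr; exact: urel0. Qed.
Lemma urel_congB L c d c' d' :
  urel L (c - d) -> urel L (c' - d') -> urel L ((c - c') - (d - d')).
Proof.
move=> h h'; suff -> : (c - c') - (d - d') = (c - d) - (c' - d') by exact: urelB.
by rewrite !opprB [d' - d]addrC [d' - c']addrC addrACA.
Qed.

Lemma urel_perm L L' c : perm_eq L L' -> urel L c -> urel L' c.
Proof.
move=> h; elim=> {c} [c [[t [t1 [t2 [h1 h2 h3 h4]]]]|[e [t [t1 [h1 h2 h3 h4]]]]]||c d _ hc _ hd].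
- by apply: zspan_gen; left; exists t, t1, t2; split=> //; exact: perm_trans h3 h.
- by apply: zspan_gen; right; exists e, t, t1; split=> //; exact: perm_trans h3 h.
- exact: urel0.
exact: urelB.
Qed.

Lemma urel_fglin L (K : choiceType) (Q : K -> Prop) (f g : K -> bmod) c :
  span Q c -> (forall x, Q x -> urel L (f x - g x)) -> urel L (fglin f c - fglin g c).
Proof.
move=> hc h; elim/span_ind: hc => [|c1 c2 h1 h2|x Qx].
- by rewrite !fglin0; exact: urel_refl.
- by rewrite !fglinB; exact: urel_congB.
by rewrite !fglinU; exact: h.
Qed.

Lemma urel_add L t t1 t2 : bar_add t t1 t2 -> good t -> perm_eq (bar_leaves t) L ->
  urel L (<< t >> - << t1 >> - << t2 >>).
Proof. by move=> *; apply: zspan_gen; left; exists t, t1, t2. Qed.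

Lemma urel_act L e t t1 : bar_act e t t1 -> good t -> perm_eq (bar_leaves t) L ->
  urel L (<< t >> - << t1 >>).
Proof. by move=> *; apply: zspan_gen; right; exists e, t, t1. Qed.

Definition twist : bmod -> bmod := fglin (fun t => sgn (kappa t) << t >>).

(** The sign of [kappa] absorbs the Koszul sign of [bar_act], and [bar_add] does not change
[kappa]. *)
Lemma twist_urel L c : urel L c -> bar_rel (twist c).
Proof.
have relN (d : bmod) : bar_rel d -> bar_rel (- d) by rewrite -sub0r; apply/zspanB/zspan0.
have relS k (d : bmod) : bar_rel d -> bar_rel (sgn k d).
  by rewrite /sgn; case: (odd k) => // /relN.
rewrite /twist; elim=> {c} [c [[t [t1 [t2 [h gt _ ->]]]]|[e [t [t1 [h gt _ ->]]]]]||c d _ hc _ hd].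
- have [[_ _ e1] [_ _ e2] _] := bar_addP h.
  rewrite !fglinB !fglinU; have -> : kappa t1 = kappa t by rewrite /kappa /ekeys e1.
  have -> : kappa t2 = kappa t by rewrite /kappa /ekeys e2.
  by rewrite -!sgnB; apply/relS/zspan_gen; left; exists t, t1, t2.
- have [[_ _ o] _ _] := bar_actP h.
  rewrite fglinB !fglinU -(sgn_mod2 << t >> (o gt)).
  suff -> : sgn (kappa t1 + e) << t >> - sgn (kappa t1) << t1 >> =
      sgn (kappa t1 + e) (<< t >> - << (-1) ^+ e *g t1 >> : bmod).
    by apply/relS/zspan_gen; right; exists e, t, t1.
  by rewrite freegU_sgn sgnB (sgnD _ e (sgn e _)) sgnK.
- rewrite fglin0; exact: zspan0.
by rewrite fglinB; exact: zspanB.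
Qed.

Section Context.
Variables (k : nat) (a : QuadOp k) (ts1 ts2 : seq (bar_tree QuadOp)).

Definition plug (t : bar_tree QuadOp) : bar_tree QuadOp := BNode a (ts1 ++ t :: ts2).

Lemma plug_leaves t t' : perm_eq (bar_leaves t) (bar_leaves t') ->
  perm_eq (bar_leaves (plug t)) (bar_leaves (plug t')).
Proof. by move=> h; rewrite /= !map_cat !flatten_cat perm_cat2l /= perm_cat2r. Qed.

Lemma good_plug t t' : good (plug t) -> bar_wf t' ->
  perm_eq (bar_leaves t') (bar_leaves t) -> good (plug t').
Proof.
move=> /andP[wf u] wf' h; rewrite /good (perm_uniq (plug_leaves h)) u andbT.
by move: wf; rewrite /= !all_cat !size_cat /= wf' => /and3P[-> -> /and3P[-> _ ->]].
Qed.

Lemma urel_plug t c : good (plug t) -> urel (bar_leaves t) c ->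
  urel (bar_leaves (plug t)) (fglin (fun u => << plug u >>) c).
Proof.
move=> gt; elim=> {c} [c [[u [u1 [u2 [h gu pu ->]]]]|[e [u [u1 [h gu pu ->]]]]]||c d _ hc _ hd].
- rewrite !fglinB !fglinU; apply: urel_add; last exact: plug_leaves.
    exact: bar_add_in.
  by apply: good_plug gt _ pu; case/andP: gu.
- rewrite !fglinB !fglinU; apply: (@urel_act _ e); last exact: plug_leaves.
    exact: bar_act_in.
  by apply: good_plug gt _ pu; case/andP: gu.
- rewrite fglin0; exact: urel0.
by rewrite fglinB; exact: urelB.
Qed.

End Context.

(** * Bar trees are determined by their images *)

Definition bar_ofN : mmod -> bmod := fglin (fun u => << bar_of u >>).

Section Planar.
Variables (k : nat) (ts : seq (bar_tree QuadOp)).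
Hypothesis gt : good (BNode (0 : QuadOp k) ts).
Let L := bar_leaves (BNode (0 : QuadOp k) ts).

Definition node_of (a : QuadOp k) : bmod := << BNode a ts >>.

Lemma urel_node0 : urel L (node_of 0).
Proof.
have := urel_add (bar_add_root (0 : QuadOp k) 0 ts); rewrite addr0 => /(_ L gt (perm_refl _)).
by rewrite subrr sub0r => /urelN; rewrite opprK.
Qed.

Lemma urel_nodeD a b : urel L (node_of (a + b) - (node_of a + node_of b)).
Proof. by rewrite opprD addrA; apply: urel_add; first exact: bar_add_root. Qed.

Lemma urel_nodeB a b : urel L (node_of (a - b) - (node_of a - node_of b)).
Proof.
have := urel_nodeD (a - b) b; rewrite subrK => /urel_sym.
by rewrite opprB addrA.
Qed.

Lemma planarB (p q : Quad' k) : planar (p - q) = planar p - planar q :> QuadOp k.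
Proof. by apply/ffunP => s; rewrite !ffunE; case: ifP; rewrite ?subr0. Qed.

Lemma planar0 : planar (0 : Quad' k) = 0.
Proof. exact: sg_elt0. Qed.

Lemma urel_planar (K : choiceType) (g : K -> Quad' k) c :
  urel L (fglin (fun u => node_of (planar (g u))) c - node_of (planar (fglin g c))).
Proof.
elim/freeg_indB: c => [|c c' h h'|x]; last by rewrite !fglinU; exact: urel_refl.
  by rewrite !fglin0 planar0 sub0r; apply/urelN/urel_node0.
rewrite !fglinB planarB; apply: urel_trans (urel_congB h h') _.
exact/urel_sym/urel_nodeB.
Qed.

End Planar.

Lemma evt_slot_fglin S pre post (K : choiceType) (f : K -> mmod) c :
  (size pre + (size post).+1 = nleaves S)%N ->
  evt S (pre ++ fglin f c :: post) = fglin (fun x => evt S (pre ++ f x :: post)) c.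
Proof. by move=> h; apply: (fglin_map (h := fun y => evt S (pre ++ y :: post))) => v w; exact: evt_slotB. Qed.

Definition markU (u : mtree) : mmod := << mark u >>.

(** All the terms of the evaluation have the same subtrees [us] and differ in the skeletons
of their root blocks only, which add up to [S] in the operad. *)
Lemma urel_bar_of_block S us k : nleaves S = k -> size us = k ->
  (1 < k)%N -> good (BNode (0 : QuadOp k) (map bar_of us)) ->
  urel (bar_leaves (BNode (0 : QuadOp k) (map bar_of us)))
    (<< BNode (planar (qtree k S)) (map bar_of us) >> - bar_ofN (evt S (map markU us))).
Proof.
move=> hS hus k1 gt.
have hY : span (fun u => is_unode u /\ bars_of u = map bar_of us) (evt S (map markU us)).
  have h1 : span is_unode (evt S (map markU us)) by apply: evt_unode; rewrite hS.
  suff h2 : span (fun u => bars_of u = map bar_of us) (evt S (map markU us)) by exact: spanI h1 h2.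
  have : forall S us, size us = nleaves S -> span (fun u => bars_of u = map bar_of us) (evt S (map markU us)).
    elim=> [|x l IHl r IHr] vs hs.
      by case: vs hs => [|v []] // _; apply: spanU; rewrite bars_of_mark.
    have [v1 [v2 [-> s1 s2]]] : exists v1 v2, [/\ vs = v1 ++ v2, size v1 = nleaves l & size v2 = nleaves r].
      exists (take (nleaves l) vs), (drop (nleaves l) vs).
      by rewrite cat_take_drop size_takel ?size_drop hs ?leq_addr // addKn.
    rewrite !map_cat evt_node ?size_map //; apply: mulN_stat => //; [exact: IHl | exact: IHr].
  by apply; rewrite hS.
apply: urel_sym.
rewrite /bar_ofN (fglin_eq_span (g := fun u => << BNode (planar (qskel k u)) (map bar_of us) >>) hY); last first.
  case=> [i|[] x l r] [hu E] //; congr (<< _ >>); rewrite /= in E.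
  by rewrite /= E size_map hus.
have := urel_planar gt (qskel k) (evt S (map markU us)); rewrite (qskel_evt hS) ?size_map //.
by move=> y /mapP[u _ ->]; exists u.
Qed.

Definition reduces (t : bar_tree QuadOp) : Prop := urel (bar_leaves t) (<< t >> - bar_ofN (phi t)).

(** The subtrees are normalised one by one; those in [us] have already been dealt with. *)
Lemma reduces_block S k ts us : nleaves S = k -> (size us + size ts = k)%N -> (1 < k)%N ->
  good (BNode (planar (qtree k S)) (map bar_of us ++ ts)) ->
  (forall t, t \in ts -> reduces t) ->
  urel (bar_leaves (BNode (0 : QuadOp k) (map bar_of us ++ ts)))
    (<< BNode (planar (qtree k S)) (map bar_of us ++ ts) >> - bar_ofN (evt S (map markU us ++ map mphi ts))).
Proof.
move=> hS + k1; elim: ts us => [|t ts IH] us hk gt H.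
  move: gt; rewrite !cats0 => gt; apply: urel_bar_of_block => //.
  by rewrite -hk addn0.
have gt' : good t by apply: good_child gt _; rewrite mem_cat mem_head orbT.
have Ht := H t (mem_head _ _).
apply: (@urel_trans _ _ (fglin (fun u => << plug (planar (qtree k S)) (map bar_of us) ts (bar_of u) >>) (phi t))).
  have := urel_plug (t := t) gt Ht; rewrite fglinB fglinU /bar_ofN fglin_comp.
  by under [X in urel _ (_ - X) -> _]fglin_eq do rewrite fglinU.
rewrite /mphi [map _ (t :: ts)]/= /markN evt_slot_fglin; last by rewrite !size_map hS.
rewrite /bar_ofN fglin_comp; apply: urel_fglin (phi_span _) _; first by case/andP: gt'.
move=> u [nu mu lu ku].
have := IH (rcons us u); rewrite !map_rcons !cat_rcons size_rcons addSnnS => /(_ hk).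
have lp : perm_eq (bar_leaves (bar_of u)) (bar_leaves t) by rewrite bar_of_leaves.
have gp := good_plug gt (bar_of_wf u) lp.
move=> /(_ gp) h; apply: urel_perm (h _); first exact: plug_leaves.
by move=> v hv; apply: H; rewrite inE hv orbT.
Qed.

Lemma reduces_planar k (q : Quad' k) ts : good (BNode (planar q) ts) ->
  (forall t, t \in ts -> reduces t) -> reduces (BNode (planar q) ts).
Proof.
move=> gt H; have gt0 : good (BNode (0 : QuadOp k) ts) by [].
have /andP[/and3P[k1 /eqP hs wf] _] := gt0.
have hn := mphi_normal_seq wf; have hm : size (map mphi ts) = k by rewrite size_map.
rewrite /reduces [phi _]/= -/(map mphi ts) sgev_planar //.
elim/quo_ind: q gt => f gt; rewrite ev_pi //.
elim/fr_ind: f gt => [|f g hf hg|S hS] gt.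
- have -> : quo_pi (@bq_rel Quad) (0 : free_ns_operad op k) = 0.
    by apply: (addrI (quo_pi (@bq_rel Quad) (0 : free_ns_operad op k))); rewrite -quo_piD !addr0.
  by rewrite planar0 evF0 /bar_ofN fglin0 subr0; exact: urel_node0.
- have -> : quo_pi (@bq_rel Quad) (f - g) = quo_pi (@bq_rel Quad) f - quo_pi (@bq_rel Quad) g.
    apply: (addIr (quo_pi (@bq_rel Quad) g)); rewrite subrK -quo_piD; congr quo_pi; exact: subrK.
  rewrite planarB evFB /bar_ofN fglinB; apply: urel_trans (urel_nodeB gt0 _ _) _.
  by apply: urel_congB; [exact: hf | exact: hg].
rewrite evF_tree //.
exact: (reduces_block (us := [::]) hS hs k1 gt H).
Qed.

Lemma urel_sum L (I : eqType) (s : seq I) (F G : I -> bmod) :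
  (forall i, i \in s -> urel L (F i - G i)) ->
  urel L (\sum_(i <- s) F i - \sum_(i <- s) G i).
Proof.
move=> h; rewrite -sumrB big_seq; apply: big_ind => [||i hi]; [exact: urel0 | exact: urelD | exact: h].
Qed.

Lemma urel_node_sum k ts (I : Type) (s : seq I) (F : I -> QuadOp k) :
  good (BNode (0 : QuadOp k) ts) ->
  urel (bar_leaves (BNode (0 : QuadOp k) ts)) (node_of ts (\sum_(i <- s) F i) - \sum_(i <- s) node_of ts (F i)).
Proof.
move=> gt; elim: s => [|i s IH]; first by rewrite !big_nil subr0; exact: urel_node0.
rewrite !big_cons; apply: urel_trans (urel_nodeD gt _ _) _.
by rewrite opprD addrACA subrr add0r.
Qed.

(** The decoration of the root is a sum over the permutations.  By [bar_act], each summand is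
equivalent to one for the identity, with permuted subtrees. *)
Lemma good_reduces t : good t -> reduces t.
Proof.
elim/bar_tree_induction: t => [i _|k a ts IH gt].
  by rewrite /reduces /bar_ofN /= fglinU; exact: urel_refl.
have H t : t \in ts -> reduces t by move=> ht; apply: IH => //; exact: good_child gt ht.
have /andP[/and3P[k1 /eqP hs wf] ul] := gt.
have gt0 : good (BNode (0 : QuadOp k) ts) by [].
rewrite /reduces.
have E : a = \sum_(s : 'S_k) op_act (planar ((a : sg_car Quad' k) s)) s :> QuadOp k.
  rewrite {1}(sg_sum a); apply: eq_bigr => s _.
  by rewrite [op_act _ _]/= sg_actU mul1g.
apply: (@urel_trans _ _ (\sum_(s : 'S_k) node_of ts (op_act (planar ((a : sg_car Quad' k) s)) s))).
  have := urel_node_sum (index_enum _) (fun s : 'S_k => op_act (planar ((a : sg_car Quad' k) s)) s) gt0.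
  by rewrite -E.
rewrite [phi _]/= /sgev /bar_ofN fglin_sum; apply: urel_sum => s _.
pose ts' := arrange (BLeaf 0) s ts.
have pts : perm_eq ts' ts by exact: perm_arrange.
have pL : perm_eq (flatten (map bar_leaves ts')) (flatten (map bar_leaves ts)).
  by apply: perm_flatten; apply: perm_map.
have gt' : good (BNode (planar ((a : sg_car Quad' k) s)) ts').
  by rewrite /good (perm_uniq pL) ul andbT /= k1 (perm_size pts) hs eqxx (perm_all _ pts).
apply: (@urel_trans _ _ << BNode (planar ((a : sg_car Quad' k) s)) ts' >>).
  exact: urel_act (bar_act_root _ s hs) gt0 (perm_refl _).
have H' t : t \in ts' -> reduces t by rewrite (perm_mem pts) => /H.
have := reduces_planar gt' H'; rewrite /reduces [phi _]/= sgev_planar; last 2 first.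
- by rewrite size_map size_arrange.
- by apply: mphi_normal_seq; rewrite (perm_all _ pts).
rewrite map_arrange // (arrange_dflt _ 0) ?size_map // => h.
exact: urel_perm h.
Qed.

(** * Koszulness *)

Definition good_on (L : seq nat) (t : bar_tree QuadOp) : Prop :=
  good t /\ perm_eq (bar_leaves t) L.

(** By [good_reduces], a combination of good trees is determined by its image among the marked
trees. *)
Lemma bar_rel_bar_of L c : span (good_on L) c -> bar_rel (c - twist (bar_ofN (PhiN c))).
Proof.
elim/span_ind => [|c1 c2 h1 h2|t [gt pL]].
- by rewrite /PhiN /bar_ofN /twist !fglin0 subr0; exact: zspan0.
- rewrite /PhiN /bar_ofN /twist !fglinB -/(PhiN _) -/(PhiN _) -/(bar_ofN _) -/(bar_ofN _) -/(twist _) -/(twist _).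
  suff -> (x y z w : bmod) : x - y - (z - w) = (x - z) - (y - w) by exact: zspanB.
  by rewrite !opprB [w - z]addrC [w - y]addrC addrACA.
have h := twist_urel (good_reduces gt).
have E : << t >> - twist (bar_ofN (PhiN << t >>)) = sgn (kappa t) (twist (<< t >> - bar_ofN (phi t))).
  rewrite /PhiN fglinU /Phi gt /bar_ofN fglin_sgn /twist fglin_sgn fglinB fglinU sgnB sgnK.
  by [].
rewrite E /sgn; case: (odd _) => //; rewrite -sub0r; apply: zspanB => //; exact: zspan0.
Qed.

Lemma bar_diff_good L t : good_on L t -> span (good_on L) (bar_diff << t >>).
Proof.
move=> [gt pL]; have [hs hc] := contractions_spec gt; have /andP[wf ul] := gt.
rewrite /bar_diff fglinU; apply: span_sum => l _; rewrite freegU_sgn; apply/span_sgn/spanU.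
have hl : (l < size (ekeys t))%N by rewrite -hs.
have [/andP[wf' _] lv _ _] := hc l hl.
by rewrite /good_on /good lv wf' ul.
Qed.

Lemma PhiN_diffN L c : span (good_on L) c -> PhiN (bar_diff c) = dmarkN (PhiN c).
Proof.
elim/span_ind => [|c1 c2 h1 h2|t [gt _]].
- by rewrite /bar_diff /PhiN /dmarkN !fglin0.
- by move: h1 h2; rewrite /bar_diff /PhiN /dmarkN !fglinB => -> ->.
by rewrite PhiN_diff // /PhiN fglinU.
Qed.

Lemma bar_basisP n w d t : @bar_basis QuadOp n w d t -> d <> w ->
  [/\ good_on (iota 0 n) t, w.+1 = n, (1 < n)%N & d = (size (ekeys t)).+1].
Proof.
case/and4P=> wf lv /eqP hw /eqP hd dw.
have hn : w.+1 = n by rewrite -hw bar_weightE // (perm_size lv) size_iota.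
split=> //; first by rewrite /good_on /good wf (perm_uniq lv) iota_uniq.
  case: t wf lv hw hd => [i|k a ts] wf lv hw hd; first by move: dw; rewrite -hd -hw.
  by rewrite -hn -hw ltnS /=; case/and3P: wf; lia.
by rewrite -hd -size_bkeys; case: t wf lv hw hd => [i|k a ts] //= _ _ hw hd; move: dw; rewrite -hd -hw.
Qed.

Lemma Phi_basis n t : good_on (iota 0 n) t -> span (marked_basis n (size (ekeys t))) (Phi t).
Proof.
move=> [gt lt]; rewrite /Phi gt; apply: span_sgn.
have /andP[wf _] := gt; apply: span_sub (phi_span wf) => u [nu mu lu ku].
by split=> //; [exact: perm_trans lu lt | exact: perm_size].
Qed.

Lemma bar_of_basis n d u : (1 < n)%N -> marked_basis n d u ->
  [/\ good_on (iota 0 n) (bar_of u) & bar_basis n n.-1 d.+1 (bar_of u)].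
Proof.
move=> n1 [nu mu lu ku]; have pl : perm_eq (bar_leaves (bar_of u)) (iota 0 n) by rewrite bar_of_leaves.
have un : is_bnode (bar_of u).
  by case: u {nu mu ku pl} lu => // i /perm_size; rewrite size_iota /=; lia.
split; first by rewrite /good_on /good bar_of_wf (perm_uniq pl) iota_uniq.
rewrite /bar_basis bar_of_wf pl -size_bkeys /=; apply/andP; split.
  apply/eqP/succn_inj; rewrite bar_weightE ?bar_of_wf // (perm_size pl) size_iota; lia.
by rewrite bkeysE; case: (bar_of u) un (bar_of_keys mu) => //= k a ts _ ->; rewrite ku.
Qed.

Lemma PhiN_bar_of n d e : (1 < n)%N -> span (marked_basis n d) e -> PhiN (twist (bar_ofN e)) = e.
Proof.
move=> n1 he; rewrite -[RHS]fglin_id /bar_ofN /twist /PhiN !fglin_comp.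
apply: fglin_eq_span he _ => u bu; rewrite fglinU fglin_sgn fglinU.
have [[gu _] _] := bar_of_basis n1 bu; have [nu mu _ _] := bu.
by rewrite /Phi gu sgnK phi_bar_of.
Qed.

Lemma koszul_Quad : koszul QuadOp.
Proof.
move=> n w d dw c hc hdc.
have {}hc : span (bar_basis n w d) c by apply/span_domP.
case: (pselect (exists t, @bar_basis QuadOp n w d t)) => [[t0 /bar_basisP/(_ dw)[_ hn n1 hd]]|no]; last first.
  have -> : c = 0 by apply: span_False; apply: span_sub hc => t ht; apply: no; exists t.
  exists 0; first by rewrite /bar_chain /= dom0.
  by rewrite /bar_diff fglin0 subr0; exact: zspan0.
set d' := size (ekeys t0) in hd.
have hg : span (good_on (iota 0 n)) c by apply: span_sub hc => t /bar_basisP/(_ dw)[].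
have hP : span (marked_basis n d') (PhiN c).
  apply: span_fglin hc _ => t /bar_basisP/(_ dw)[gt _ _ ht].
  by have := Phi_basis gt; have -> : size (ekeys t) = d' by move: ht; rewrite hd => -[].
have hdP : dmarkN (PhiN c) = 0 by rewrite -(PhiN_diffN hg) PhiN_rel.
have dn : d'.+1 != n.-1 by rewrite -hd -hn; apply/eqP.
have [e he ce] := marked_cycle n1 dn hP hdP.
pose b := twist (bar_ofN e).
have hb : span (fun t => good_on (iota 0 n) t /\ bar_basis n w d.+1 t) b.
  rewrite /b /twist /bar_ofN fglin_comp; apply: span_fglin he _ => u bu; rewrite fglinU.
  have [h1 h2] := bar_of_basis n1 bu; apply/span_sgn/spanU; split=> //.
  by rewrite hd; move: h2; rewrite -hn.
have hbg : span (good_on (iota 0 n)) b by apply: span_sub hb => t [].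
exists b; first by apply/span_domP; apply: span_sub hb => t [].
have hz : span (good_on (iota 0 n)) (c - bar_diff b).
  apply: spanB => //; rewrite /bar_diff; apply: span_fglin hbg _ => t ht.
  by have := bar_diff_good ht; rewrite /bar_diff fglinU.
have := bar_rel_bar_of hz.
have -> : PhiN (c - bar_diff b) = 0.
  rewrite /PhiN fglinB -!/(PhiN _) (PhiN_diffN hbg) /b (PhiN_bar_of n1 he) ce.
  exact: subrr.
by rewrite /bar_ofN /twist !fglin0 subr0.
Qed.

(** * The black square product *)

Definition dend_relator (x y : bool) : free_ns_operad bool 3 :=
  \sum_(z <- left_coord x y) comp1 (gen x) (gen z) -
  \sum_(z <- right_coord x y) comp2 (gen y) (gen z).

Definition dend_chains : seq (bool * bool) := [:: (false, false); (false, true); (true, true)].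

Lemma dend_chainsP x y : ((x, y) \in dend_chains) = (x ==> y).
Proof. by case: x y => [] []. Qed.

Lemma bq_rel_Dend : @bq_rel Dend = zspan [set` [seq dend_relator p.1 p.2 | p <- dend_chains]].
Proof.
rewrite /Dend /span_bq /=.
match goal with |- zspan (mkset (fun x => is_true (@in_mem _ x (@mem _ _ ?l)))) = _ =>
  have -> : l = [seq dend_relator p.1 p.2 | p <- dend_chains] end; last by [].
by rewrite /dend_chains /dend_relator /left_coord /right_coord /= !big_cons !big_nil !addr0.
Qed.

Lemma psi_tree_elt (X Y : finType) (S : ptree X) (T : ptree Y) :
  nleaves S = 3 -> nleaves T = 3 -> psi (tree_elt 3 S) (tree_elt 3 T) = psi_tree S T.
Proof. by move=> /eqP hS /eqP hT; rewrite (tree_eltE hS) (tree_eltE hT) /psi !fglinU. Qed.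

(** In [psi], the products of a left with a right hand side vanish, and the sign in the product
of two right hand sides makes up for the one lost in the product of their signs. *)
Lemma psi_relator (x y x' y' : bool) :
  psi (dend_relator x y) (dend_relator x' y') = relator (x, x') (y, y').
Proof.
have psiBl (X Y : finType) (r r' : free_ns_operad X 3) (s : free_ns_operad Y 3) :
    psi (r - r') s = psi r s - psi r' s by exact: fglinB.
have psi_suml (X Y : finType) (I : Type) (t : seq I) F (s : free_ns_operad Y 3) :
    psi (\sum_(i <- t) F i : free_ns_operad X 3) s = \sum_(i <- t) psi (F i) s by exact: fglin_sum.
have psiBr (X Y : finType) (r : free_ns_operad X 3) (s s' : free_ns_operad Y 3) :
    psi r (s - s') = psi r s - psi r s' by exact: bilinBr.
have psi_sumr (X Y : finType) (I : Type) (t : seq I) F (r : free_ns_operad X 3) :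
    psi r (\sum_(i <- t) F i : free_ns_operad Y 3) = \sum_(i <- t) psi r (F i) by exact: bilin_sumr.
rewrite /dend_relator psiBl !psiBr !psi_suml.
rewrite [X in _ - X - _]big1 => [|i _]; last first.
  by rewrite psi_sumr big1 // => j _; rewrite comp1_tree comp2_tree psi_tree_elt.
rewrite [X in _ - (X - _)]big1 => [|i _]; last first.
  by rewrite psi_sumr big1 // => j _; rewrite comp1_tree comp2_tree psi_tree_elt.
rewrite subr0 sub0r opprK /relator; congr (_ + _).
  rewrite /left_ops big_allpairs_dep exchange_big /=; apply: eq_bigr => i _.
  rewrite psi_sumr; apply: eq_bigr => j _.
  by rewrite !comp1_tree psi_tree_elt //= comp1_tree.
rewrite /right_ops big_allpairs_dep exchange_big /= -sumrN; apply: eq_bigr => i _.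
rewrite psi_sumr -sumrN; apply: eq_bigr => j _.
by rewrite !comp2_tree psi_tree_elt //= comp2_tree.
Qed.

Lemma zspan_sub (M : zmodType) (A B : set M) :
  (forall r, A r -> zspan B r) -> forall r, zspan A r -> zspan B r.
Proof. by move=> h r; elim=> {r} [r /h||r s _ hr _ hs] //; [exact: zspan0 | exact: zspanB]. Qed.

Lemma bq_rel_black_square : @bq_rel (black_square Dend Dend) = @bq_rel Quad.
Proof.
rewrite bq_rel_Quad; apply/funext => r; apply/propext; split; apply: zspan_sub => {}r.
  case=> p hp [q hq <-]; move: hp hq; rewrite bq_rel_Dend.
  elim=> {p} [p /mapP[[x y] xy ->]||p p' _ hp _ hp'] hq.
  - elim: hq => {q} [q /mapP[[x' y'] xy' ->]||q q' _ hq _ hq'].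
    + apply: zspan_gen; apply/mapP; exists ((x, x'), (y, y')); last exact: psi_relator.
      by move: xy xy'; rewrite op_chainsP !dend_chainsP /op_le /= => -> ->.
    + by rewrite [psi _ _]bilin0r; exact: zspan0.
    by rewrite [psi _ _]bilinBr; exact: zspanB.
  - by rewrite [psi _ _]bilin0l; exact: zspan0.
  by rewrite [psi _ _]bilinBl; apply: zspanB; [exact: hp | exact: hp'].
case/mapP=> [[[x x'] [y y']]]; rewrite op_chainsP => /andP[xy xy'] ->.
apply: zspan_gen; exists (dend_relator x y); last exists (dend_relator x' y'); last exact: psi_relator.
  by rewrite bq_rel_Dend; apply: zspan_gen; apply/mapP; exists (x, y); rewrite ?dend_chainsP.
by rewrite bq_rel_Dend; apply: zspan_gen; apply/mapP; exists (x', y'); rewrite ?dend_chainsP.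
Qed.

Lemma bq_data_eq (X : finType) (R R' : set (free_ns_operad X 3)) h0 hB h0' hB' :
  R = R' -> @BQData X R h0 hB = @BQData X R' h0' hB'.
Proof. by move=> E; subst R'; congr BQData; exact: Prop_irrelevance. Qed.

Theorem theorem51 : Quad = black_square Dend Dend /\ koszul (bq_operad Quad).
Proof.
split; last exact: koszul_Quad.
by apply: bq_data_eq; rewrite -[LHS]/(@bq_rel Quad) -bq_rel_black_square.
Qed.
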